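(* Let $d\in\{2,3,4\}$, let $g$ be a Schwartz function on $\mathbb{R}^d$, and for $0<\sigma<1$ (with $\sigma\ne\frac12$ if $d=3$) let $u_\sigma$ be the solution, given by the explicit formula in the context, of the Neumann problem $$\begin{cases}\partial_t^2u+\frac{1-2\sigma}{t}\partial_tu=\Delta u,\\ u(\cdot,0)=0,\quad\partial_t^\sigma u(\cdot,0)=g .\end{cases}$$ Then for every $x\in\mathbb{R}^d$ and $t>0$, $$\lim_\sigma u_\sigma(x,t)=\frac{1}{c_dt}\int_{\partial B(x,t)}g(y)\,dS(y)$$ in each of the following cases: (i) $d=2$ and $\sigma\searrow0$, with $c_2=2\pi$; (ii) $d=3$ and $\sigma\to\frac12$, with $c_3=4\pi$; (iii) $d=4$ and $\sigma\nearrow1$, with $c_4=2\pi^2$.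
   Context: $\partial_t^\sigma=\frac{1}{2\sigma}t^{1-2\sigma}\partial_t$; $\Delta$ is the Laplacian in $x\in\mathbb{R}^d$; $B(x,t)$ is the open ball with centre $x$ and radius $t$, and $dS$ is surface measure on its boundary. The solution $u_\sigma$ is the following function of $x\in\mathbb{R}^d$, $t>0$. If $0<\frac d2-\sigma<1$ (that is, $d=2$, or $d=3$ and $\sigma>\frac12$): $$u_\sigma(x,t)=\frac{\sigma\sin\big((\frac d2-\sigma)\pi\big)\Gamma(\frac d2-\sigma)}{\pi^{\frac d2}\sin(\sigma\pi)\Gamma(1-\sigma)}\int_{B(x,t)}\frac{g(y)}{(t^2-|x-y|^2)^{\frac d2-\sigma}}\,dy .$$ If $1<\frac d2-\sigma<2$ (that is, $d=4$, or $d=3$ and $\sigma<\frac12$): $$u_\sigma(x,t)=\frac{\sigma\sin\big((\frac d2-\sigma-1)\pi\big)\Gamma(\frac d2-\sigma-1)}{2\pi^{\frac d2}\sin(\sigma\pi)\Gamma(1-\sigma)}\,\frac{1}{t^2}\int_{B(x,t)}\frac{2(\sigma+1)g(y)+(y-x)\cdot\nabla g(y)}{(t^2-|x-y|^2)^{\frac d2-\sigma-1}}\,dy .$$ *)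

(* Defs.v *)
From HB Require Import structures.
From mathcomp Require Import all_boot all_order all_algebra.
From mathcomp Require Import complex.
From mathcomp Require Import all_classical all_reals all_analysis.

Set Implicit Arguments.
Unset Strict Implicit.
Unset Printing Implicit Defensive.

Import Order.TTheory GRing.Theory Num.Theory.
Import numFieldNormedType.Exports.

Local Open Scope classical_set_scope.
Local Open Scope complex_scope.
Local Open Scope ring_scope.

(* R^n is 'rV[R]_n.  The library norm on 'rV[R]_n is the sup norm, which
   induces the usual topology and derivatives; lengths use [enorm]. *)
Section euclidean.
Context {R : realType}.

Definition enorm n (v : 'rV[R]_n) : R := Num.sqrt (\sum_i v 0 i ^+ 2).

Definition eball n (x : 'rV[R]_n) (t : R) : set 'rV[R]_n :=
  [set y | enorm (y - x) < t].

End euclidean.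

(* The Borel sigma-algebra of R^n, generated by the coordinates. *)
Section borel_rV.
Context {R : realType} {n : nat}.

Definition coord_preimages : set (set 'rV[R]_n) :=
  [set A | exists i, exists2 B : set (measurableTypeR R),
    measurable B & A = [set v : 'rV[R]_n | B (v 0 i)]].

Let borel_rV := <<s coord_preimages >>.

Let borel_rV0 : borel_rV set0.
Proof. exact: sigma_algebra0. Qed.

Let borel_rVC A : borel_rV A -> borel_rV (~` A).
Proof. exact: sigma_algebraC. Qed.

Let borel_rV_bigcup (F : (set 'rV[R]_n)^nat) :
  (forall i, borel_rV (F i)) -> borel_rV (\bigcup_i F i).
Proof. exact: sigma_algebra_bigcup. Qed.

HB.instance Definition _ := @isMeasurable.Build default_measure_display
  'rV[R]_n borel_rV borel_rV0 borel_rVC borel_rV_bigcup.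

Lemma measurable_coord (i : 'I_n) :
  measurable_fun setT (fun v : 'rV[R]_n => v 0 i : measurableTypeR R).
Proof.
move=> _ B mB; rewrite setTI; apply: sub_sigma_algebra.
by exists i, B.
Qed.

Lemma measurable_fun_rVP d (T : measurableType d) (f : T -> 'rV[R]_n) :
  (forall i, measurable_fun setT (fun x => f x 0 i : measurableTypeR R)) ->
  measurable_fun setT f.
Proof.
move=> mf; apply: (measurability coord_preimages) => // _ [_ [i [B mB ->]] <-].
exact: mf.
Qed.

End borel_rV.

Section lebesgue_rV.
Context {R : realType}.

Definition cons_rV n (p : measurableTypeR R * 'rV[R]_n) : 'rV[R]_n.+1 :=
  row_mx (p.1 : R)%:M p.2.

Definition behead_rV n (v : 'rV[R]_n.+1) : 'rV[R]_n :=
  rsubmx (v : 'rV[R]_(1 + n)).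

Let uncons_rV n (v : 'rV[R]_n.+1) : measurableTypeR R * 'rV[R]_n :=
  (v 0 0, behead_rV v).

Let cons_rVK n : cancel (@cons_rV n) (@uncons_rV n).
Proof.
case=> a v; rewrite /uncons_rV /behead_rV row_mxKr; congr pair.
by rewrite /cons_rV mxE; case: splitP => j // _; rewrite mxE !ord1.
Qed.

Lemma measurable_cons_rV n : measurable_fun setT (@cons_rV n).
Proof.
apply: measurable_fun_rVP => i; under eq_fun do rewrite mxE.
case: splitP => j _ //; under eq_fun do rewrite ?mxE ?ord1 ?eqxx ?mulr1n.
- exact: measurable_fst.
- exact: measurableT_comp (measurable_coord j) measurable_snd.
Qed.

Let measurable_uncons_rV n : measurable_fun setT (@uncons_rV n).
Proof.
apply/measurable_fun_pairP; split; first exact: measurable_coord.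
apply: measurable_fun_rVP => i.
under eq_fun do rewrite /= mxE.
exact: measurable_coord.
Qed.

Section step.
Variables (n : nat) (mu : {sigma_finite_measure set 'rV[R]_n -> \bar R}).

Definition lebesgue_step : set 'rV[R]_n.+1 -> \bar R :=
  pushforward (@lebesgue_measure R \x mu)%E (@cons_rV n).

Let pushforward_cons :=
  measure_function_pushforward__canonical__measure_function_Measure
    (@lebesgue_measure R \x mu)%E (@measurable_cons_rV n).

HB.instance Definition _ := isMeasure.Build _ _ _ lebesgue_step
  (measure0 pushforward_cons) (measure_ge0 pushforward_cons)
  (@measure_semi_sigma_additive _ _ _ pushforward_cons).

Let lebesgue_step_sigma_finite : sigma_finite setT lebesgue_step.
Proof.
have /sigma_finiteP[F [TF ndF Foo]] := sigma_finiteT (@lebesgue_measure R).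
have /sigma_finiteP[G [TG ndG Goo]] := sigma_finiteT mu.
exists (fun k => @uncons_rV n @^-1` (F k `*` G k)).
  rewrite -preimage_bigcup -[LHS](preimage_setT (@uncons_rV n)).
  congr (_ @^-1` _); rewrite -setXTT TF TG predeqE => -[x y]; split.
    move=> [/= [i _ Fix] [j _ Gjy]]; exists (maxn i j) => //; split.
    - by move: x Fix; exact/subsetPset/ndF/leq_maxl.
    - by move: y Gjy; exact/subsetPset/ndG/leq_maxr.
  by move=> [i _ []/= ? ?]; split; exists i.
move=> k; have [mF Fk] := Foo k; have [mG Gk] := Goo k; split.
  by rewrite -[X in measurable X]setTI; apply: measurable_uncons_rV => //;
    exact: measurableX.
rewrite /lebesgue_step /pushforward -comp_preimage.
rewrite (_ : _ \o _ = id) ?preimage_id; last exact/funext/cons_rVK.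
by rewrite product_measure1E// lte_mul_pinfty// ge0_fin_numE.
Qed.

HB.instance Definition _ := Measure_isSigmaFinite.Build _ _ _
  lebesgue_step lebesgue_step_sigma_finite.

End step.
End lebesgue_rV.

(* n-dimensional Lebesgue measure, by iterated products (\d_0 is the unit mass
   on the one-point space R^0). *)
Fixpoint lebesgue_rV (R : realType) (n : nat) :
    {sigma_finite_measure set 'rV[R]_n -> \bar R} :=
  match n with
  | 0 => \d_(0 : 'rV[R]_0)
  | m.+1 => lebesgue_step (lebesgue_rV R m)
  end.

Section complex_valued.
Context {R : realType} {n : nat}.
Implicit Types (f : 'rV[R]_n -> R[i]) (D : set 'rV[R]_n).

Definition cintegral D f : R[i] :=
  (\int[lebesgue_rV R n]_(y in D) complex.Re (f y)) +i*
  (\int[lebesgue_rV R n]_(y in D) complex.Im (f y)).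

Definition cpartial (i : 'I_n) f (x : 'rV[R]_n) : R[i] :=
  ('D_(delta_mx 0 i) (fun y => complex.Re (f y)) x) +i*
  ('D_(delta_mx 0 i) (fun y => complex.Im (f y)) x).

(* A multi-index is given as the list of the coordinates to differentiate in. *)
Definition cpartials (s : seq 'I_n) f : 'rV[R]_n -> R[i] := foldr cpartial f s.

Definition smooth f := forall s x,
  differentiable (fun y => complex.Re (cpartials s f y)) x /\
  differentiable (fun y => complex.Im (cpartials s f y)) x.

Definition schwartz f := smooth f /\
  forall (s : seq 'I_n) (k : nat), exists C : R, forall x,
    enorm x ^+ k * Normc.normc (cpartials s f x) <= C.

End complex_valued.

Section sphere.
Context {R : realType} {n : nat}.

Definition area_element (h : 'rV[R]_n -> R) (y : 'rV[R]_n) : R :=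
  Num.sqrt (1 + \sum_i ('D_(delta_mx 0 i) h y) ^+ 2).

(* Surface integral over the graph {(h y, y) : y in D} in R^(n+1). *)
Definition graph_integral (D : set 'rV[R]_n) (h : 'rV[R]_n -> R)
    (f : 'rV[R]_n.+1 -> R[i]) : R[i] :=
  cintegral D (fun y => (area_element h y)%:C * f (cons_rV (h y, y))).

Definition hemisphere (e : R) (x : 'rV[R]_n.+1) (t : R) (y : 'rV[R]_n) : R :=
  x 0 0 + e * Num.sqrt (t ^+ 2 - enorm (y - behead_rV x) ^+ 2).

(* Integral over the boundary of eball x t against surface measure: the two
   open hemispheres are graphs over the same n-dimensional ball, and what they
   leave out of the sphere, the equator, is null for surface measure. *)
Definition sphere_integral (x : 'rV[R]_n.+1) (t : R)
    (f : 'rV[R]_n.+1 -> R[i]) : R[i] :=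
  graph_integral (eball (behead_rV x) t) (hemisphere 1 x t) f +
  graph_integral (eball (behead_rV x) t) (hemisphere (-1) x t) f.

End sphere.

Section solution.
Context {R : realType}.

Definition Gamma (a : R) : R :=
  \int[@lebesgue_measure R]_(s in `]0, +oo[) (s `^ (a - 1) * expR (- s)).

(* The explicit solution u_sigma with Neumann datum g.  The value 0 is
   arbitrary and never taken for d and sigma as in the Neumann problem. *)
Definition u_sol (d : nat) (g : 'rV[R]_d -> R[i]) (sigma : R)
    (x : 'rV[R]_d) (t : R) : R[i] :=
  let k := d%:R / 2 - sigma in
  if 0 < k < 1 then
    (sigma * sin (k * pi) * Gamma k /
     (pi `^ (d%:R / 2) * sin (sigma * pi) * Gamma (1 - sigma)))%:C *
    cintegral (eball x t) (fun y =>
      g y / ((t ^+ 2 - enorm (x - y) ^+ 2) `^ k)%:C)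
  else if 1 < k < 2 then
    (sigma * sin ((k - 1) * pi) * Gamma (k - 1) /
     (2 * pi `^ (d%:R / 2) * sin (sigma * pi) * Gamma (1 - sigma)))%:C *
    ((t ^+ 2)^-1)%:C *
    cintegral (eball x t) (fun y =>
      ((2 * (sigma + 1))%:C * g y +
       \sum_i ((y - x) 0 i)%:C * cpartial i g y) /
      ((t ^+ 2 - enorm (x - y) ^+ 2) `^ (k - 1))%:C)
  else 0.

End solution.

(* Main.v *)
Require Import Defs.
From mathcomp Require Import all_boot all_order all_algebra.
From mathcomp Require Import complex lra ring.
From mathcomp Require Import all_classical all_reals all_analysis.
From mathcomp Require Import measurable_realfun.
Import Order.TTheory GRing.Theory Num.Theory.
Import numFieldNormedType.Exports.
Set Implicit Arguments.
Unset Strict Implicit.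
Unset Printing Implicit Defensive.
Local Open Scope classical_set_scope.
Local Open Scope ring_scope.

(** Let [d] be the dimension and [u = t ^+ 2 - |y - x| ^+ 2]. The three values of
    sigma in the theorem are all the critical value [d / 2 - 1], at which the
    exponent [k = d / 2 - sigma] of [u] crosses [1]; let [eps] be the distance
    of sigma to it, and [S h] the surface integral of [h] over the sphere.

    On the side [k = 1 - eps] the weight [u `^ (eps - 1)] is barely integrable,
    and [eps] times it concentrates on the sphere. In polar coordinates
    [y = x + s *: (w - x)] with [w] on the sphere, the radial part is the
    density [2 * eps * s * (1 - s ^+ 2) `^ (eps - 1)] of total mass [1], whose
    mass moves to [s = 1]; hence the integral of [eps * h / u `^ (1 - eps)]
    tends to [S h / (2 * t)] ([cvg_concentration]).

    On the side [k = 1 + eps] the weight [u `^ (- eps)] tends to [1]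
    ([cvg_weight_removal]), and [2 * (sigma + 1) * h + (y - x) . grad h] is the
    divergence of [h y *: (y - x)] up to [2 * eps * h]. This field has normal
    component [t * h] on the sphere, so the integral tends to [t * S h]
    ([flux_identity], [cvg_flux_integral]).

    Both limits rest on [polar_formula]. Lebesgue measure being an iterated
    product and the sphere a union of two graphs, polar coordinates are obtained
    from a substitution in coordinate [0], Tonelli, and a dilation of the other
    coordinates.

    The constants in front of the two branches make the limits agree: both
    become [c / (2 * t) * S h], where [c] is [pi^-1] for [d = 2],
    [(2 * pi)^-1] for [d = 3], and [(pi ^+ 2)^-1] for [d = 4]. For [d = 3] this
    uses that [sin (eps * pi) / eps] tends to [pi], that [eps * Gamma eps] tends
    to [1], that [Gamma] is continuous, and the values of [Gamma] at [1] and
    [1 / 2]. Complex data are treated through their real and imaginary parts. *)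

(** * Improper substitution on the line *)

Section substitution.
Context {R : realType}.
Notation mu := (@lebesgue_measure R).

Lemma itv_oo_exhaustion (a b : R) : a < b ->
  exists u v : R^nat, [/\ forall n, u n < v n, nonincreasing_seq u,
    nondecreasing_seq v & `]a, b[%classic = \bigcup_n `[u n, v n]%classic].
Proof.
move=> ab.
have h0 n : 0 < (n.+3%:R : R)^-1 by rewrite invr_gt0.
have hn m n : (m <= n)%N -> (n.+3%:R : R)^-1 <= (m.+3%:R)^-1.
  by move=> mn; rewrite lef_pV2 ?posrE// ler_nat !ltnS.
(* With denominators from [3] on, the intervals are nondegenerate. *)
exists (fun n => a + (b - a) / n.+3%:R), (fun n => b - (b - a) / n.+3%:R).
have ba : 0 < b - a by rewrite subr_gt0.
split.
- move=> n.
  have : (n.+3%:R : R)^-1 <= 3^-1 by rewrite lef_pV2 ?posrE// ler_nat.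
  move: (h0 n) => + h3; set z := _^-1 in h3 *; nra.
- move=> m n mn; rewrite lerD2l ler_pM2l//; exact: hn.
- move=> m n mn; rewrite lerD2l lerN2 ler_pM2l//; exact: hn.
- apply/seteqP; split => [x|x [n _]] /=; rewrite !in_itv/=; last first.
    move=> /andP[h1 h2]; move: (h0 n) => z0.
    by move: h1 h2; set z := _^-1 in z0 *; nra.
  move=> /andP[ax xb].
  pose e := Num.min (x - a) (b - x) / (b - a).
  have e0 : 0 < e by rewrite divr_gt0// lt_min !subr_gt0 ax xb.
  exists (Num.truncn e^-1) => //=.
  have : (Num.truncn e^-1).+3%:R^-1 < e.
    rewrite invf_plt ?posrE//.
    apply: lt_trans (truncnS_gt _) _; by rewrite ltr_nat.
  rewrite /e ltr_pdivlMr// lt_min => /andP[h1 h2].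
  rewrite in_itv/= [(b - a) * _]mulrC; move: h1 h2; set w := _ * (b - a).
  by move: w => w; lra.
Qed.

Lemma itv_oy_exhaustion (a : R) :
  exists u v : R^nat, [/\ forall n, u n < v n, nonincreasing_seq u,
    nondecreasing_seq v & `]a, +oo[%classic = \bigcup_n `[u n, v n]%classic].
Proof.
have h0 n : 0 < (n.+1%:R : R)^-1 by rewrite invr_gt0.
exists (fun n => a + n.+1%:R^-1), (fun n => a + n.+2%:R); split.
- move=> n; rewrite ltrD2l; apply: (@le_lt_trans _ _ 1).
    by rewrite invf_le1 ?ler1n.
  by rewrite ltr1n.
- by move=> m n mn; rewrite lerD2l lef_pV2 ?posrE// ler_nat !ltnS.
- by move=> m n mn; rewrite lerD2l ler_nat !ltnS.
- apply/seteqP; split => [x|x [n _]] /=; rewrite !in_itv/= ?andbT; last first.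
    by move=> /andP[h1 _]; apply: lt_le_trans h1; rewrite ltrDl.
  move=> ax; have xa0 : 0 < x - a by rewrite subr_gt0.
  exists (maxn (Num.truncn (x - a)^-1) (Num.truncn (x - a))) => //=.
  rewrite in_itv/=; apply/andP; split.
    rewrite -lerBrDl invf_ple ?posrE//; apply/ltW/(lt_le_trans (truncnS_gt _)).
    by rewrite ler_nat ltnS leq_maxl.
  rewrite -lerBlDl; apply/ltW/(lt_le_trans (truncnS_gt _)); rewrite ler_nat ltnS.
  exact: leq_trans (leq_maxr _ _) (leqnSn _).
Qed.

(** [F'] or [f] may blow up at the ends of the intervals, so the substitution
    rule for compact intervals is applied along an exhaustion from inside, and
    monotone convergence passes to the limit. *)
Lemma ge0_substitution_open (i j : interval R) (F G F' f : R -> R) :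
  (exists u v : R^nat, [/\ forall n, u n < v n, nonincreasing_seq u,
    nondecreasing_seq v & [set` i] = \bigcup_n `[u n, v n]%classic]) ->
  open [set` i] ->
  (forall x, x \in i -> F x \in j) -> (forall y, y \in j -> G y \in i) ->
  (forall y, y \in j -> F (G y) = y) ->
  (forall x, x \in i -> is_derive x 1 F (F' x)) ->
  (forall x, x \in i -> 0 < F' x) ->
  (forall x, x \in i -> {for x, continuous F'}) ->
  (forall y, y \in j -> {for y, continuous f}) ->
  (forall y, y \in j -> 0 <= f y) ->
  (\int[mu]_(y in [set` j]) (f y)%:E =
   \int[mu]_(x in [set` i]) (f (F x) * F' x)%:E)%E.
Proof.
move=> [u [v [uv ninc ndec iE]]] oi Fij Gji FG dF F'0 cF' cf f0.
have iuv n x : x \in `[u n, v n] -> x \in i.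
  by move=> xuv; have : [set` i] x by rewrite iE; exists n.
have ui n : u n \in i by apply: (iuv n); rewrite in_itv/= lexx ltW.
have vi n : v n \in i by apply: (iuv n); rewrite in_itv/= lexx ltW.
have F1 x : x \in i -> derivable F x 1 by move=> /dF[].
have cF x : x \in i -> {for x, continuous F}.
  by move=> /F1/derivable1_diffP/differentiable_continuous.
have dFE x : x \in i -> derive1 F x = F' x.
  by move=> xi; rewrite derive1E; have [_ ->] := dF _ xi.
have incr x y : x \in i -> y \in i -> x < y -> F x < F y.
  move=> xi yi xy.
  have xyi z : z \in `[x, y] -> z \in i.
    rewrite in_itv/= => xzy.
    by have := interval_is_interval xi yi => /(_ z); apply.
  have [z zxy||z zxy E] := @MVT _ F F' x y xy.
  - by apply/dF/xyi; exact: subset_itv_oo_cc.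
  - by apply: continuous_in_subspaceT => z; rewrite inE => /xyi; exact: cF.
  - by rewrite -subr_gt0 E mulr_gt0 ?subr_gt0 ?F'0//; apply: xyi; exact: subset_itv_oo_cc.
have inci x y : x \in i -> y \in i -> x <= y -> F x <= F y.
  by move=> xi yi; rewrite le_eqVlt => /predU1P[->//|/(incr _ _ xi yi)/ltW].
have jsub n : `[F (u n), F (v n)] `<=` [set` j].
  move=> y; rewrite /= in_itv/= => h.
  by have := interval_is_interval (Fij _ (ui n)) (Fij _ (vi n)) => /(_ y); apply.
have jE : [set` j] = \bigcup_n `[F (u n), F (v n)]%classic.
  apply/seteqP; split => [y /= yj|y [n _]]; last exact: jsub.
  have : [set` i] (G y) by exact: Gji.
  rewrite iE => -[n _ /= Gyn]; exists n => //=.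
  have Gyi := iuv _ _ Gyn.
  rewrite -(FG y)// in_itv/=; move: Gyn; rewrite in_itv/= => /andP[h1 h2].
  by rewrite !inci.
have oj : measurable_fun [set` j] f.
  rewrite jE; apply/measurable_fun_bigcup => // n.
  apply: subspace_continuous_measurable_fun => //.
  by apply: continuous_in_subspaceT => y; rewrite inE => /jsub; exact: cf.
have mfF : measurable_fun [set` i] (fun x => f (F x) * F' x).
  apply: open_continuous_measurable_fun => // x; rewrite inE /= => xi.
  apply: continuousM; last exact: cF'.
  by apply: continuous_comp; [exact: cF|exact/cf/Fij].
have L1 : (\int[mu]_(y in `[F (u n), F (v n)]%classic) (f y)%:E)%E @[n --> \oo] -->
    (\int[mu]_(y in [set` j]) (f y)%:E)%E.
  rewrite jE; apply: ge0_nondecreasing_set_cvg_integral => //.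
  - move=> m n mn; apply/subsetPset => y /=; rewrite !in_itv/= => /andP[h1 h2].
    by rewrite (le_trans _ h1) ?(le_trans h2)// inci//; [exact: ndec|exact: ninc].
  - by move=> n; apply/measurable_EFinP; apply: measurable_funS oj; [exact: measurable_itv|exact: jsub].
  - by move=> n y /jsub; rewrite lee_fin; exact: f0.
have L2 : (\int[mu]_(x in `[u n, v n]%classic) (f (F x) * F' x)%:E)%E @[n --> \oo] -->
    (\int[mu]_(x in [set` i]) (f (F x) * F' x)%:E)%E.
  rewrite iE; apply: ge0_nondecreasing_set_cvg_integral => //.
  - move=> m n mn; apply/subsetPset => y /=; rewrite !in_itv/= => /andP[h1 h2].
    by rewrite (le_trans _ h1) ?(le_trans h2)//; [exact: ndec|exact: ninc].
  - by move=> n; apply/measurable_EFinP; apply: measurable_funS mfF; [exact: measurable_itv|exact: iuv].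
  - move=> n x /iuv xi; rewrite lee_fin mulr_ge0 ?f0 ?Fij//.
    exact/ltW/F'0.
have E n : (\int[mu]_(y in `[F (u n), F (v n)]%classic) (f y)%:E =
    \int[mu]_(x in `[u n, v n]%classic) (f (F x) * F' x)%:E)%E.
  have F'c x : x \in i -> derive1 F y @[y --> x] --> F' x.
    move=> xi; apply: cvg_trans (cF' _ xi); apply: near_eq_cvg.
    by near=> y; rewrite dFE//; near: y; exact: (@open_nbhs_nbhs _ _ [set` i]).
  rewrite integration_by_substitution_increasing.
  - by apply: eq_integral => x; rewrite inE => /iuv xi; rewrite !fctE dFE.
  - exact/ltW/uv.
  - by move=> x y /iuv xi /iuv yi; exact: incr.
  - move=> x xuv; rewrite /continuous_at dFE; last first.
      by apply: iuv; apply: subset_itv_oo_cc xuv.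
    by apply: F'c; apply: iuv; apply: subset_itv_oo_cc xuv.
  - by apply/cvg_ex; exists (F' (u n)); apply: cvg_at_right_filter; exact: F'c.
  - by apply/cvg_ex; exists (F' (v n)); apply: cvg_at_left_filter; exact: F'c.
  - split.
    + by move=> x xuv; apply/F1/(iuv n); apply: subset_itv_oo_cc xuv.
    + by apply: cvg_at_right_filter; exact: cF.
    + by apply: cvg_at_left_filter; exact: cF.
  - by apply: continuous_in_subspaceT => y; rewrite inE => /jsub; exact: cf.
move: L1; under eq_fun do rewrite E.
by move=> L1; exact: cvg_unique L1 L2.
Unshelve. all: by end_near. Qed.

End substitution.

Section improper.
Context {R : realType}.
Notation mu := (@lebesgue_measure R).

(** The case [f = 1] of the substitution rule is a fundamental theorem of
    calculus for improper integrals: the increment of [F] is the length of its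
    range. *)
Lemma integral_derive_open (i j : interval R) (F G F' : R -> R) :
  (exists u v : R^nat, [/\ forall n, u n < v n, nonincreasing_seq u,
    nondecreasing_seq v & [set` i] = \bigcup_n `[u n, v n]%classic]) ->
  open [set` i] ->
  (forall x, x \in i -> F x \in j) -> (forall y, y \in j -> G y \in i) ->
  (forall y, y \in j -> F (G y) = y) ->
  (forall x, x \in i -> is_derive x 1 F (F' x)) ->
  (forall x, x \in i -> 0 < F' x) ->
  (forall x, x \in i -> {for x, continuous F'}) ->
  (\int[mu]_(x in [set` i]) (F' x)%:E = mu [set` j])%E.
Proof.
move=> ei oi Fij Gji FG dF F'0 cF'.
rewrite -[RHS]mul1e -integral_cst// (@ge0_substitution_open R i j F G F' (cst 1))//.
- by apply: eq_integral => x _; rewrite mul1r.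
- by move=> y _; exact: cst_continuous.
Qed.

Lemma integral_powR_unit (a : R) : 0 < a ->
  (\int[mu]_(s in `]0%R, 1%R[) (a * s `^ (a - 1))%:E = 1)%E.
Proof.
move=> a0.
have ltp (p x : R) : 0 < p -> x \in `]0, 1[ -> x `^ p \in `]0, 1[.
  move=> p0; rewrite !in_itv/= => /andP[x0 x1]; rewrite powR_gt0//=.
  have : x `^ p < 1 `^ p by rewrite gt0_ltr_powR// nnegrE ltW.
  by rewrite powR1.
rewrite -(_ : mu `]0, 1[%classic = 1%E); last by rewrite lebesgue_measure_itv/= lte_fin ltr01 oppr0 addr0.
apply: (@integral_derive_open `]0, 1[ `]0, 1[ (fun s => s `^ a)
  (fun y => y `^ a^-1) (fun s => a * s `^ (a - 1))).
- exact: itv_oo_exhaustion.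
- exact: itv_open.
- by move=> x; exact: ltp.
- by move=> x; apply: ltp; rewrite invr_gt0.
- move=> y; rewrite in_itv/= => /andP[y0 _].
  by rewrite -powRrM mulVf ?gt_eqF// powRr1// ltW.
- by move=> x; rewrite in_itv/= => /andP[x0 _]; exact: is_derive1_powR.
- by move=> x; rewrite in_itv/= => /andP[x0 _]; rewrite mulr_gt0// powR_gt0.
- move=> x; rewrite in_itv/= => /andP[x0 _]; apply: continuousM; first exact: cst_continuous.
  apply/differentiable_continuous/derivable1_diffP/derivable_powR.
  by rewrite in_itv/= x0.
Qed.

Lemma integral_radial_weight (a : R) : 0 < a ->
  (\int[mu]_(s in `]0%R, 1%R[) (2 * a * s * (1 - s ^+ 2) `^ (a - 1))%:E = 1)%E.
Proof.
move=> a0.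
have ltp (p x : R) : 0 < p -> 0 < x < 1 -> 0 < x `^ p < 1.
  move=> p0 /andP[x0 x1]; rewrite powR_gt0//=.
  have : x `^ p < 1 `^ p by rewrite gt0_ltr_powR// nnegrE ltW.
  by rewrite powR1.
have lts (x : R) : 0 < x < 1 -> 0 < 1 - x ^+ 2 < 1.
  by move=> /andP[x0 x1]; apply/andP; split; nra.
rewrite -(_ : mu `](-1), 0[%classic = 1%E); last by rewrite lebesgue_measure_itv/= lte_fin ltrN10 -?EFinD ?sub0r ?opprK ?add0r.
apply: (@integral_derive_open `]0, 1[ `](-1), 0[ (fun s => - (1 - s ^+ 2) `^ a)
  (fun y => Num.sqrt (1 - (- y) `^ a^-1)) (fun s => 2 * a * s * (1 - s ^+ 2) `^ (a - 1))).
- exact: itv_oo_exhaustion.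
- exact: itv_open.
- move=> x; rewrite !in_itv/= => /lts/(ltp _ _ a0) => /andP[h1 h2].
  by rewrite ltrN2 h2 oppr_lt0 h1.
- move=> y; rewrite !in_itv/= => /andP[y0 y1].
  have : 0 < (- y) `^ a^-1 < 1.
    by apply: ltp; [rewrite invr_gt0|rewrite oppr_gt0 y1 ltrNl].
  move=> /andP[h1 h2]; rewrite sqrtr_gt0 subr_gt0 h2/=.
  by rewrite -[ltRHS]sqrtr1 ltr_sqrt// ltrBlDr ltrDl.
- move=> y; rewrite in_itv/= => /andP[y0 y1].
  have /andP[h1 h2] : 0 < (- y) `^ a^-1 < 1.
    by apply: ltp; [rewrite invr_gt0|rewrite oppr_gt0 y1 ltrNl].
  rewrite sqr_sqrtr ?subr_ge0 1?ltW// opprB addrC subrK.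
  by rewrite -powRrM mulVf ?gt_eqF// powRr1 ?opprK// oppr_ge0 ltW.
- move=> x; rewrite in_itv/= => /lts /andP[x0 _].
  have H := @is_derive1_powR R a _ x0.
  have H2 : is_derive x 1 (fun s : R => 1 - s ^+ 2) (- (2 * x)).
    by apply: is_derive_eq; rewrite /GRing.scale/=; ring.
  have H3 := @is_derive1_comp R (fun y => y `^ a) (fun s : R => 1 - s ^+ 2) x _ _ H H2.
  apply: is_derive_eq (is_deriveN H3) _.
  ring.
- move=> x; rewrite in_itv/= => /[dup] /lts /andP[h _] /andP[x0 _].
  by rewrite !mulr_gt0// powR_gt0.
- move=> x; rewrite in_itv/= => /[dup] /lts /andP[h _] /andP[x0 _].
  apply: continuousM; first by apply: continuousM; [exact: cst_continuous|exact: id].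
  apply: (@continuous_comp _ _ _ (fun s : R => 1 - s ^+ 2) (fun y => y `^ (a - 1))).
    apply: continuousB; first exact: cst_continuous.
    exact: exprn_continuous.
  apply/differentiable_continuous/derivable1_diffP/derivable_powR.
  by rewrite in_itv/= h.
Qed.

Lemma integral_expR_decay (c : R) : 0 < c ->
  (\int[mu]_(s in `]0%R, +oo[) (c * expR (- (c * s)))%:E = 1)%E.
Proof.
move=> c0.
rewrite -(_ : mu `]0, 1[%classic = 1%E); last by rewrite lebesgue_measure_itv/= lte_fin ltr01 oppr0 adde0.
apply: (@integral_derive_open `]0, +oo[ `]0, 1[ (fun s => 1 - expR (- (c * s)))
  (fun y => - ln (1 - y) / c) (fun s => c * expR (- (c * s)))).
- exact: itv_oy_exhaustion.
- exact: itv_open_ends_open.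
- move=> x; rewrite !in_itv/= andbT => x0.
  by rewrite subr_gt0 expR_lt1 oppr_lt0 mulr_gt0//= ltrBlDr ltrDl expR_gt0.
- move=> y; rewrite !in_itv/= andbT => /andP[y0 y1].
  by rewrite divr_gt0// oppr_gt0 ln_lt0// subr_gt0 y1 ltrBlDr ltrDl.
- move=> y; rewrite in_itv/= => /andP[y0 y1].
  rewrite mulrC divfK ?gt_eqF// opprK lnK ?posrE ?subr_gt0//.
  by rewrite opprB addrC subrK.
- move=> x _; apply: is_derive_eq.
  by rewrite /GRing.scale/=; ring.
- by move=> x _; rewrite mulr_gt0// expR_gt0.
- move=> x _; apply: continuousM; first exact: cst_continuous.
  apply: (@continuous_comp _ _ _ (fun s : R => - (c * s)) expR); last exact: continuous_expR.
  by apply: continuousN; apply: continuousM; [exact: cst_continuous|exact: id].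
Qed.

End improper.

(** * The Gamma function *)

Section gamma.
Context {R : realType}.
Notation mu := (@lebesgue_measure R).

Lemma integral_powR_unit' (a : R) : 0 < a ->
  (\int[mu]_(s in `]0%R, 1%R[) (s `^ (a - 1))%:E = (a^-1)%:E)%E.
Proof.
move=> a0; rewrite -[RHS]mule1 -(integral_powR_unit a0).
rewrite -ge0_integralZl//; last 3 first.
- by apply/measurable_EFinP/measurable_funM => //; apply: measurable_funTS; exact: measurable_powR.
- by move=> s _; rewrite lee_fin mulr_ge0 ?powR_ge0 ?ltW.
- by rewrite lee_fin invr_ge0 ltW.
by apply: eq_integral => s _; rewrite -EFinM mulKf// gt_eqF.
Qed.

Lemma measurable_gamma_integrand (a : R) (D : set R) :
  measurable_fun D (fun s : R => s `^ (a - 1) * expR (- s)).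
Proof.
apply: measurable_funTS; apply: measurable_funM; first exact: measurable_powR.
by apply: measurableT_comp => //; exact: measurable_funTS.
Qed.

Lemma gamma_integrand_ge0 (a s : R) : 0 <= s `^ (a - 1) * expR (- s).
Proof. by rewrite mulr_ge0// ?powR_ge0// expR_ge0. Qed.

Lemma gamma_integrand_tail (a s : R) : a <= 2 -> 1 <= s ->
  s `^ (a - 1) * expR (- s) <= 2 * expR (- (s / 2)).
Proof.
move=> a2 s1.
have s0 : 0 <= s by rewrite (le_trans _ s1).
have h1 : s `^ (a - 1) <= 2 * expR (s / 2).
  apply: (@le_trans _ _ s).
    by rewrite -[leRHS]powRr1// ler_powR//; lra.
  by have := expR_ge1Dx (s / 2); lra.
rewrite (_ : - (s / 2) = s / 2 + - s); last by field.
by rewrite expRD mulrA ler_wpM2r// expR_ge0.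
Qed.

(** The exponential is at most [1] on the unit interval; beyond it the power is
    absorbed by half of the exponential decay. *)
Lemma gamma_integral_le (a : R) : 0 < a <= 2 ->
  (\int[mu]_(s in `]0%R, +oo[) (s `^ (a - 1) * expR (- s))%:E <= (a^-1 + 4)%:E)%E.
Proof.
move=> /andP[a0 a2].
pose p := ((fun s : R => (s `^ (a - 1))%:E) \_ `]0%R, 1%R[)%E.
pose q := fun s : R => (2 * expR (- (s / 2)))%:E.
have mp : measurable_fun setT p.
  apply/(measurable_restrictT _ _).1 => //; apply/measurable_EFinP/measurable_funTS.
  exact: measurable_powR.
have mq : measurable_fun setT q.
  apply/measurable_EFinP; apply: measurable_funM => //; apply: measurableT_comp => //.
  by apply: measurableT_comp => //; apply: measurable_funM.
have p0 s : (0 <= p s)%E.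
  by rewrite /p patchE; case: ifPn => // _; rewrite lee_fin powR_ge0.
have q0 s : (0 <= q s)%E by rewrite lee_fin mulr_ge0 ?expR_ge0.
apply: (@le_trans _ _ (\int[mu]_(s in `]0%R, +oo[) (p s + q s))%E).
  apply: ge0_le_integral => //.
  - by move=> s _; rewrite lee_fin gamma_integrand_ge0.
  - by apply/measurable_EFinP; exact: measurable_gamma_integrand.
  - by apply: measurable_funTS; exact: emeasurable_funD.
  move=> s /=; rewrite in_itv/= andbT => s0.
  rewrite /p patchE; case: ifPn.
    rewrite inE/= in_itv/= => _; apply: lee_paddr => //.
    by rewrite lee_fin ler_piMr ?powR_ge0// -expR0 ler_expR oppr_le0 ltW.
  rewrite notin_setE/= in_itv/= s0/= => /negP; rewrite -leNgt => s1.
  by rewrite add0e lee_fin gamma_integrand_tail.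
rewrite ge0_integralD//; [|exact: measurable_funTS..].
rewrite EFinD leeD//.
  rewrite -integral_mkcondr (_ : _ `&` _ = `]0, 1[%classic).
    by rewrite integral_powR_unit'.
  by apply/seteqP; split => [s [_ //]|s /= s01]; split => //; move: s01; rewrite /= !in_itv/= andbT => /andP[].
rewrite (_ : 4 = 4 * 1 :> R); last by rewrite mulr1.
rewrite EFinM -(@integral_expR_decay _ (2^-1 : R))// -ge0_integralZl//; last first.
- apply/measurable_EFinP/measurable_funTS; apply: measurable_funM => //.
  apply: measurableT_comp => //.
  by apply: measurableT_comp => //; apply: measurable_funM.
apply: ge0_le_integral => //.
- exact: measurable_funTS.
- apply/measurable_EFinP/measurable_funTS; do 2 apply: measurable_funM => //.
  apply: measurableT_comp => //.
  by apply: measurableT_comp => //; apply: measurable_funM.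
by move=> s _; rewrite -EFinM lee_fin mulrA [_^-1 * s]mulrC ler_wpM2r ?expR_ge0//; lra.
Qed.

Lemma integrable_gamma (a : R) : 0 < a <= 2 ->
  mu.-integrable `]0%R, +oo[ (EFin \o (fun s : R => s `^ (a - 1) * expR (- s))).
Proof.
move=> a02; apply/integrableP; split.
  by apply/measurable_EFinP; exact: measurable_gamma_integrand.
under eq_integral do rewrite /= ger0_norm ?gamma_integrand_ge0//.
by rewrite (le_lt_trans (gamma_integral_le a02))// ltry.
Qed.

Lemma EFin_Gamma (a : R) : 0 < a <= 2 ->
  (Gamma a)%:E = (\int[mu]_(s in `]0%R, +oo[) (s `^ (a - 1) * expR (- s))%:E)%E.
Proof.
by move=> a02; rewrite fineK//; apply: integrable_fin_num => //; exact: integrable_gamma.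
Qed.

Lemma mul_Gamma_le (a : R) : 0 < a <= 2 -> a * Gamma a <= 1 + 4 * a.
Proof.
move=> /[dup] a02 /andP[a0 a2]; have := gamma_integral_le a02.
rewrite -EFin_Gamma// lee_fin -(ler_pM2l a0) mulrDr divff ?gt_eqF//.
by rewrite [a * 4]mulrC.
Qed.

(** Since [1 - s <= expR (- s)], already the unit interval contributes
    [1 / a - 1 / (a + 1)]. *)
Lemma mul_Gamma_ge (a : R) : 0 < a <= 2 -> (1 + a)^-1 <= a * Gamma a.
Proof.
move=> /[dup] a02 /andP[a0 a2].
have a10 : 0 < a + 1 by rewrite addr_gt0.
have : ((a^-1)%:E <= (Gamma a)%:E + ((a + 1)^-1)%:E)%E.
  rewrite -(integral_powR_unit' a0) -(integral_powR_unit' a10) EFin_Gamma// addrK.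
  apply: (@le_trans _ _ (\int[mu]_(s in `]0%R, 1%R[)
      ((s `^ (a - 1) * expR (- s))%:E + (s `^ a)%:E))%E).
    apply: ge0_le_integral => //.
    - by move=> s _; rewrite lee_fin powR_ge0.
    - by apply/measurable_EFinP/measurable_funTS; exact: measurable_powR.
    - apply/measurable_EFinP; apply: measurable_funD.
        exact: measurable_gamma_integrand.
      by apply: measurable_funTS; exact: measurable_powR.
    move=> s /=; rewrite in_itv/= => /andP[s0 s1]; rewrite -EFinD lee_fin.
    rewrite (_ : s `^ a = s `^ (a - 1) * s); last first.
      by rewrite -{3}(powRr1 (ltW s0)) -powRD ?subrK// gt_eqF ?implybT.
    rewrite -mulrDr ler_peMr ?powR_ge0//.
    by have := expR_ge1Dx (- s); lra.
  rewrite ge0_integralD//.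
  - rewrite leeD2r// ge0_subset_integral//.
    + by apply/measurable_EFinP; exact: measurable_gamma_integrand.
    + by move=> s _; rewrite lee_fin gamma_integrand_ge0.
    + by move=> s /=; rewrite !in_itv/= andbT => /andP[].
  - by move=> s _; rewrite lee_fin gamma_integrand_ge0.
  - by apply/measurable_EFinP; exact: measurable_gamma_integrand.
  - by move=> s _; rewrite lee_fin powR_ge0.
  - by apply/measurable_EFinP/measurable_funTS; exact: measurable_powR.
rewrite -EFinD lee_fin => h.
rewrite -(ler_pM2l a0) divff ?gt_eqF// mulrDr in h.
rewrite (_ : (1 + a)^-1 = 1 - a / (a + 1)); last first.
  by rewrite addrC; field; rewrite gt_eqF.
by rewrite lerBlDr.
Qed.

Lemma Gamma_gt0 (a : R) : 0 < a <= 2 -> 0 < Gamma a.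
Proof.
move=> /[dup] a02 /andP[a0 a2]; rewrite -(pmulr_rgt0 _ a0).
by apply: lt_le_trans (mul_Gamma_ge a02); rewrite invr_gt0 addr_gt0.
Qed.

Lemma cvg_mul_Gamma_0 : a * Gamma a @[a --> 0^'+] --> (1 : R).
Proof.
apply: (@squeeze_cvgr _ _ _ _ (fun a : R => (1 + a)^-1) (fun a => 1 + 4 * a)).
- near=> a; have a02 : 0 < a <= 2.
    by apply/andP; split; near: a; [exact: nbhs_right_gt|exact: nbhs_right_le].
  by rewrite mul_Gamma_ge// mul_Gamma_le.
- apply: cvg_at_right_filter; rewrite -[X in _ --> X]invr1.
  apply: cvgV => //; rewrite -[X in _ --> X]addr0.
  by apply: cvgD; [exact: cvg_cst|exact: cvg_id].
- apply: cvg_at_right_filter; rewrite -[X in _ --> X]addr0 -[X in _ --> _ + X](mulr0 4).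
  by apply: cvgD; [exact: cvg_cst|apply: cvgM; [exact: cvg_cst|exact: cvg_id]].
Unshelve. all: by end_near. Qed.

(** Dominated convergence: for parameters in [`]a / 2, 2[] the integrand is
    dominated by the one of parameter [a / 2] near [0] and by
    [2 * expR (- (s / 2))] at infinity. *)
Lemma continuous_Gamma (a : R) : 0 < a < 2 -> {for a, continuous (@Gamma R)}.
Proof.
move=> /andP[a0 a2].
pose u := a / 2.
have u02 : 0 < u <= 2 by rewrite /u; apply/andP; split; lra.
apply: (@continuity_under_integral R _ _ mu (fun b s => s `^ (b - 1) * expR (- s))
   `]0%R, +oo[ _ u 2 _ _ (fun s => s `^ (u - 1) * expR (- s) + 2 * expR (- (s / 2)))).
- exact: measurable_itv.
- move=> b /=; rewrite in_itv/= => /andP[ub b2]; apply: integrable_gamma.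
  by move: u02 => /andP[u0 _]; rewrite (lt_trans u0 ub) ltW.
- apply: aeW => s /=; rewrite in_itv/= andbT => s0 b _.
  suff : {for b, continuous (fun c : R => (s : R) `^ (c - 1) * expR (- (s : R)))} by [].
  apply: continuousM; last exact: cst_continuous.
  rewrite (_ : (fun b => _) = fun b => expR ((b - 1) * ln s)); last first.
    by apply/funext => c; rewrite /powR gt_eqF.
  apply: (@continuous_comp _ _ _ (fun b : R => (b - 1) * ln s) expR).
    apply: continuousM; last exact: cst_continuous.
    by apply: continuousB; [exact: id|exact: cst_continuous].
  exact: continuous_expR.
- rewrite (_ : _ \o _ = (EFin \o (fun s : R => s `^ (u - 1) * expR (- s))%R) \+
      (fun s : R => 4%:E * (2^-1 * expR (- (2^-1 * s)))%:E))%E; last first.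
    apply/funext => s /=; rewrite -EFinM -EFinD [_^-1 * s]mulrC mulrA.
    by congr (_ + _ * _)%:E; lra.
  apply: integrableD => //; first exact: integrable_gamma.
  apply: integrableZl => //; apply/integrableP; split.
    apply/measurable_EFinP/measurable_funTS; apply: measurable_funM => //.
    apply: measurableT_comp => //.
    by apply: measurableT_comp => //; apply: measurable_funM.
  under eq_integral do rewrite gee0_abs ?lee_fin ?mulr_ge0 ?expR_ge0//.
  by rewrite integral_expR_decay// ltry.
- move=> b /=; rewrite in_itv/= => /andP[ub b2].
  apply: aeW => s /=; rewrite in_itv/= andbT => s0.
  rewrite ger0_norm ?gamma_integrand_ge0//.
  have [s1|s1] := leP 1 s.
    by rewrite ler_wpDl ?gamma_integrand_ge0// gamma_integrand_tail// ltW.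
  rewrite ler_wpDr ?mulr_ge0 ?expR_ge0// ler_wpM2r ?expR_ge0//.
  by rewrite ger_powR ?s0 ?(ltW s1)// lerD2r ltW.
- by rewrite inE/= in_itv/= a2 andbT /u; lra.
Qed.

Lemma Gamma1 : Gamma (1 : R) = 1.
Proof.
apply: EFin_inj; rewrite EFin_Gamma ?ltr01 ?ler1n//.
rewrite -(@integral_expR_decay _ (1 : R))//.
by apply: eq_integral => s _; rewrite subrr powRr0 !mul1r.
Qed.

(** The substitution of [x ^+ 2] turns the integral into the Gaussian one. *)
Lemma Gamma_half : Gamma (2^-1 : R) = Num.sqrt pi.
Proof.
apply: EFin_inj; rewrite EFin_Gamma; last by apply/andP; split; lra.
transitivity (\int[mu]_(x in `]0%R, +oo[)
    ((x ^+ 2) `^ (2^-1 - 1) * expR (- (x ^+ 2)) * (2 * x))%:E)%E; last first.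
  transitivity (\int[mu]_(x in `]0%R, +oo[) (2%:E * (gauss_fun x)%:E))%E.
    apply: eq_integral => x; rewrite inE/= in_itv/= andbT => x0.
    rewrite -EFinM /gauss_fun; congr (_%:E).
    rewrite (_ : 2^-1 - 1 = - 2^-1); last by lra.
    rewrite powRN -[x ^+ 2]powR_mulrn ?ltW// -powRrM mulfV// powRr1 ?ltW//.
    by rewrite mulrC mulrA -[2 * x * _]mulrA mulfV ?gt_eqF// mulr1.
  rewrite ge0_integralZl//; last 2 first.
  - by apply/measurable_EFinP/measurable_funTS; exact: measurable_gauss_fun.
  - by move=> x _; rewrite lee_fin gauss_fun_ge0.
  rewrite integral_itv_obnd_cbnd; last first.
    by apply/measurable_EFinP/measurable_funTS; exact: measurable_gauss_fun.
  by rewrite integral0y_gauss -EFinM mulrC divfK.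
apply: (@ge0_substitution_open _ `]0, +oo[ `]0, +oo[ (fun x => x ^+ 2) Num.sqrt
  (fun x => 2 * x) (fun s => s `^ (2^-1 - 1) * expR (- s))).
- exact: itv_oy_exhaustion.
- exact: itv_open_ends_open.
- by move=> x; rewrite !in_itv/= !andbT => x0; rewrite exprn_gt0.
- by move=> x; rewrite !in_itv/= !andbT => x0; rewrite sqrtr_gt0.
- by move=> x; rewrite !in_itv/= !andbT => x0; rewrite sqr_sqrtr// ltW.
- by move=> x _; apply: is_derive_eq; rewrite /GRing.scale/=; ring.
- by move=> x; rewrite !in_itv/= !andbT => x0; rewrite mulr_gt0.
- by move=> x _; apply: continuousM; [exact: cst_continuous|exact: id].
- move=> x; rewrite !in_itv/= !andbT => x0; apply: continuousM.
    apply/differentiable_continuous/derivable1_diffP/derivable_powR.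
    by rewrite in_itv/= x0.
  apply: (@continuous_comp _ _ _ (fun s : R => - s) expR); last exact: continuous_expR.
  exact: continuousN.
- by move=> x _; exact: gamma_integrand_ge0.
Qed.

End gamma.

(** * Euclidean space *)

Section borel.
Context {R : realType}.

Lemma cons_rV0 n (a : R) (v : 'rV[R]_n) : cons_rV (a, v) 0 0 = a.
Proof.
by rewrite /cons_rV mxE; case: splitP => j // _; rewrite mxE !ord1.
Qed.

Lemma behead_rVE n (v : 'rV[R]_n.+1) i : behead_rV v 0 i = v 0 (lift ord0 i).
Proof. by rewrite mxE; congr (v _ _); apply: val_inj. Qed.

Lemma behead_cons_rV n (a : R) (v : 'rV[R]_n) : behead_rV (cons_rV (a, v)) = v.
Proof. by rewrite /behead_rV row_mxKr. Qed.

Lemma cons_rVS n (a : R) (v : 'rV[R]_n) i : cons_rV (a, v) 0 (lift ord0 i) = v 0 i.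
Proof. by rewrite -behead_rVE behead_cons_rV. Qed.

Lemma enorm_sqr n (v : 'rV[R]_n) : enorm v ^+ 2 = \sum_i v 0 i ^+ 2.
Proof. by rewrite sqr_sqrtr// sumr_ge0// => i _; exact: sqr_ge0. Qed.

Lemma enorm_ge0 n (v : 'rV[R]_n) : 0 <= enorm v.
Proof. exact: sqrtr_ge0. Qed.

Lemma enormN n (v : 'rV[R]_n) : enorm (- v) = enorm v.
Proof. by congr Num.sqrt; apply: eq_bigr => i _; rewrite mxE sqrrN. Qed.

Lemma enorm_sqr_cons n (v : 'rV[R]_n.+1) :
  enorm v ^+ 2 = v 0 0 ^+ 2 + enorm (behead_rV v) ^+ 2.
Proof.
rewrite !enorm_sqr big_ord_recl; congr (_ + _).
by apply: eq_bigr => i _; rewrite behead_rVE.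
Qed.

Lemma enormZ n (s : R) (v : 'rV[R]_n) : enorm (s *: v) ^+ 2 = s ^+ 2 * enorm v ^+ 2.
Proof.
rewrite !enorm_sqr mulr_sumr; apply: eq_bigr => i _.
by rewrite mxE exprMn.
Qed.

Lemma eball_sqr n (x y : 'rV[R]_n) (t : R) : 0 < t ->
  eball x t y <-> enorm (y - x) ^+ 2 < t ^+ 2.
Proof. by move=> t0; rewrite /eball/= ltr_pXn2r// nnegrE ?enorm_ge0// ltW. Qed.

Lemma continuous_enorm_sqr n (x : 'rV[R]_n) : continuous (fun y : 'rV[R]_n => enorm (y - x) ^+ 2).
Proof.
rewrite (_ : (fun y : 'rV[R]_n => _) = fun y : 'rV[R]_n => \sum_i (y 0 i - x 0 i) ^+ 2); last first.
  by apply/funext => y; rewrite enorm_sqr; apply: eq_bigr => i _; rewrite !mxE.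
apply: continuous_big => [|i _ y]; first exact: add_continuous.
apply: (@continuous_comp _ _ _ (fun y : 'rV[R]_n => y 0 i - x 0 i) (fun z => z ^+ 2));
  last exact: exprn_continuous.
apply: continuousB; last exact: cst_continuous.
exact: coord_continuous.
Qed.

Lemma open_eball n (x : 'rV[R]_n) (t : R) : 0 < t -> open (eball x t).
Proof.
move=> t0; rewrite (_ : eball x t = (fun y : 'rV[R]_n => enorm (y - x) ^+ 2) @^-1` `]-oo, t ^+ 2[%classic); last first.
  by apply/seteqP; split => y; rewrite eball_sqr//= in_itv.
apply: open_comp; last exact: itv_open_ends_open.
by move=> y _; exact: continuous_enorm_sqr.
Qed.

Lemma measurable_box n (c : 'rV[R]_n) (e : R) :
  measurable [set v : 'rV[R]_n | forall i, `|v 0 i - c 0 i| < e].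
Proof.
rewrite (_ : mkset _ = \bigcap_(i in [set: 'I_n])
    [set v : 'rV[R]_n | `|v 0 i - c 0 i| < e]); last first.
  by apply/seteqP; split => [v h i _|v h i]; exact: h.
apply: fin_bigcap_measurable; first exact: finite_finset.
move=> i _.
have := @measurable_coord R n i measurableT `]c 0 i - e, c 0 i + e[%classic (measurable_itv _).
rewrite setTI; congr measurable; apply/seteqP; split => v /=;
  by rewrite in_itv/= ltr_distl.
Qed.

(** The sup norm has a countable base of rational boxes. *)
Lemma open_measurable_rV n (U : set 'rV[R]_n) : open U -> measurable U.
Proof.
move=> oU.
pose box (p : 'rV[rat]_n * nat) := [set v : 'rV[R]_n |
  forall i, `|v 0 i - (\row_i ratr (p.1 0 i) : 'rV[R]_n) 0 i| < p.2.+1%:R^-1].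
rewrite (_ : U = \bigcup_(p : 'rV[rat]_n * nat)
    (if `[< box p `<=` U >] then box p else set0)); last first.
  apply/seteqP; split => [v Uv|v [p _]]; last by case: asboolP => // + bv; exact.
  have /nbhs_ballP[e /= e0 vU] : nbhs v U by exact: open_nbhs_nbhs.
  pose k := Num.truncn (2 / e).
  have ke : k.+1%:R^-1 < e / 2.
    rewrite invf_plt ?posrE ?divr_gt0// invf_div; exact: truncnS_gt.
  have k0 : 0 < (k.+1%:R : R)^-1 by rewrite invr_gt0.
  have /choice[q hq] : forall i, exists q : rat, `|v 0 i - ratr q| < k.+1%:R^-1.
    move=> i; have /rat_in_itvoo[q] : v 0 i - k.+1%:R^-1 < v 0 i + k.+1%:R^-1.
      by rewrite ltrBlDr -addrA ltrDl addr_gt0.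
    by rewrite in_itv/= => h; exists q; rewrite distrC ltr_distl.
  exists (\row_i q i, k) => //.
  have bv : box (\row_i q i, k) v by move=> i; rewrite /= !mxE.
  rewrite ifT//; apply/asboolP => w bw; apply: vU.
  split => // i j; rewrite (ord1 i) /ball/=.
  have := bv j; have := bw j; rewrite /= !mxE => h1 h2.
  rewrite (le_lt_trans (ler_distD (ratr (q j)) _ _))//.
  by rewrite [ltRHS]splitr ltrD// ?(lt_trans h2)// distrC (lt_trans h1).
apply: countable_bigcupT_measurable => //.
by move=> p; case: ifP => // _; exact: measurable_box.
Qed.

Lemma continuous_measurable_rV n (D : set 'rV[R]_n) (f : 'rV[R]_n -> R) :
  open D -> (forall y, D y -> {for y, continuous f}) -> measurable_fun D f.
Proof.
move=> oD cf; apply: (measurability _ (RGenOpens.measurableE R)).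
move=> _ [_ [a [b ->] <-]]; apply: open_measurable_rV.
rewrite openE => y [Dy fy]; apply: filterI; first exact: open_nbhs_nbhs.
apply: (cf _ Dy); apply: open_nbhs_nbhs; split => //; exact: interval_open.
Qed.

Lemma measurable_eball n (x : 'rV[R]_n) (t : R) : 0 < t -> measurable (eball x t).
Proof. by move=> t0; apply: open_measurable_rV; exact: open_eball. Qed.

End borel.

Section lebesgue_rV_theory.
Context {R : realType}.
Notation mu := (@lebesgue_measure R).
Local Open Scope ereal_scope.

Lemma ge0_integral_affine (b s : R) (f : R -> \bar R) : (0 < s)%R ->
  measurable_fun setT f -> (forall y, 0 <= f y) ->
  s%:E * \int[mu]_y f (b + s * y)%R = \int[mu]_y f y.
Proof.
move=> s0 mf f0.
pose phi (y : measurableTypeR R) : measurableTypeR R := (b + s * y)%R.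
have mphi : measurable_fun setT phi.
  by apply: measurable_funD => //; exact: measurable_funM.
pose nu := mscale (NngNum (ltW s0))
  (measure_function_pushforward__canonical__measure_function_Measure mu mphi).
transitivity (\int[nu]_y f y); last first.
  apply: eq_measure_integral => A mA _; apply/esym.
  apply: lebesgue_measure_unique => // _ [[u v] /= uv <-].
  rewrite /nu /mscale/= /pushforward.
  rewrite (_ : phi @^-1` _ = `]((u - b) / s)%R, ((v - b) / s)%R]%classic); last first.
    apply/seteqP; split => y; rewrite /phi/= !in_itv/=;
      by rewrite ltr_pdivrMr// ler_pdivlMr// ltrBlDl lerBrDl mulrC.
  rewrite !lebesgue_measure_itv/= !lte_fin ltr_pM2r ?invr_gt0// ltrD2r.
  case: ifPn => _; last by rewrite mule0.
  rewrite -!EFinB -EFinM; congr _%:E.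
  by rewrite -mulrBl mulrC divfK ?gt_eqF// opprB addrA subrK.
rewrite ge0_integral_mscale//; congr (_ * _).
by rewrite ge0_integral_pushforward// preimage_setT.
Qed.

Variable n : nat.
Implicit Types (f : 'rV[R]_n.+1 -> \bar R).

Lemma measurable_comp_cons_rV f : measurable_fun setT f ->
  measurable_fun setT (f \o @cons_rV R n).
Proof.
move=> mf; apply: (measurableT_comp mf); exact: measurable_cons_rV.
Qed.

Lemma integral_lebesgue_rV_cons f : measurable_fun setT f -> (forall y, 0 <= f y) ->
  \int[lebesgue_rV R n.+1]_y f y = \int[(mu \x lebesgue_rV R n)]_p f (cons_rV p).
Proof.
move=> mf f0 /=.
transitivity (\int[measure_function_pushforward__canonical__measure_function_Measure
    (mu \x lebesgue_rV R n) (@measurable_cons_rV R n)]_y f y).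
  by apply: eq_measure_integral.
by rewrite ge0_integral_pushforward//; exact: measurable_cons_rV.
Qed.

Lemma integral_lebesgue_rVS f : measurable_fun setT f -> (forall y, 0 <= f y) ->
  \int[lebesgue_rV R n.+1]_y f y = \int[mu]_a \int[lebesgue_rV R n]_v f (cons_rV (a, v)).
Proof.
move=> mf f0; rewrite integral_lebesgue_rV_cons//.
rewrite (fubini_tonelli1 (f \o @cons_rV R n))//; first exact: measurable_comp_cons_rV.
by move=> p; exact: f0.
Qed.

Lemma integral_lebesgue_rVS2 f : measurable_fun setT f -> (forall y, 0 <= f y) ->
  \int[lebesgue_rV R n.+1]_y f y = \int[lebesgue_rV R n]_v \int[mu]_a f (cons_rV (a, v)).
Proof.
move=> mf f0; rewrite integral_lebesgue_rV_cons//.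
rewrite (fubini_tonelli2 (f \o @cons_rV R n))//; first exact: measurable_comp_cons_rV.
by move=> p; exact: f0.
Qed.

End lebesgue_rV_theory.

Section affine.
Context {R : realType}.
Notation mu := (@lebesgue_measure R).
Local Open Scope ereal_scope.

Lemma affine_rVE n (b w : 'rV[R]_n) (s : R) i :
  ((b + s *: w) 0 i = b 0 i + s * w 0 i)%R.
Proof. by rewrite !mxE. Qed.

Lemma measurable_affine_rV n (b : 'rV[R]_n) (s : R) :
  measurable_fun setT (fun y : 'rV[R]_n => (b + s *: y)%R).
Proof.
apply: measurable_fun_rVP => i; under eq_fun do rewrite !mxE.
apply: measurable_funD => //; apply: measurable_funM => //; exact: measurable_coord.
Qed.

(** Tonelli splits off coordinate [0], on which the affine map acts by itself;
    induction does the rest. *)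
Lemma ge0_integral_affine_rV n (b : 'rV[R]_n) (s : R) (f : 'rV[R]_n -> \bar R) : (0 < s)%R ->
  measurable_fun setT f -> (forall y, 0 <= f y) ->
  (s ^+ n)%:E * \int[lebesgue_rV R n]_y f (b + s *: y)%R = \int[lebesgue_rV R n]_y f y.
Proof.
move=> s0; elim: n b f => [|n IH] b f mf f0.
  rewrite expr0 mul1e; apply: eq_integral => y _; congr f.
  by apply/rowP => -[].
rewrite integral_lebesgue_rVS//; last exact: measurableT_comp mf (measurable_affine_rV _ _).
rewrite [RHS]integral_lebesgue_rVS//.
have mF : measurable_fun setT (fun a : R => \int[lebesgue_rV R n]_v f (cons_rV (a, v))).
  apply: (measurable_fun_fubini_tonelli_F (f \o @cons_rV R n)).
    exact: measurable_comp_cons_rV.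
  by move=> p; exact: f0.
pose F (a : R) := \int[lebesgue_rV R n]_v f (cons_rV (a, v)).
transitivity (s%:E * \int[mu]_a F (b 0 0 + s * a)%R); last first.
  by apply: ge0_integral_affine => // a; exact: integral_ge0.
rewrite exprS EFinM -muleA; congr (_ * _).
rewrite -ge0_integralZl//=; last 3 first.
- apply: (measurable_fun_fubini_tonelli_F
    ((fun y => f (b + s *: y)%R) \o @cons_rV R n)) => [|p].
    apply: (@measurable_comp_cons_rV _ n (fun y => f (b + s *: y)%R)).
    exact: measurableT_comp mf (measurable_affine_rV _ _).
  exact: f0.
- by move=> a _; apply: integral_ge0.
- by rewrite lee_fin exprn_ge0// ltW.
apply: eq_integral => a _.
pose G (v : 'rV[R]_n) := f (cons_rV (b 0 0 + s * a, v)%R).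
transitivity ((s ^+ n)%:E * \int[lebesgue_rV R n]_v G (behead_rV b + s *: v)%R).
  congr (_ * _); apply: eq_integral => v _; congr f.
  apply/rowP => i; case: (unliftP ord0 i) => [j ->|->]; rewrite affine_rVE.
    by rewrite !cons_rVS affine_rVE behead_rVE.
  by rewrite !cons_rV0.
apply: IH => [|v]; last exact: f0.
apply: (measurableT_comp mf); apply: measurable_fun_rVP => i.
case: (unliftP ord0 i) => [j ->|->].
  under eq_fun do rewrite cons_rVS; exact: measurable_coord.
under eq_fun do rewrite cons_rV0; exact: measurable_cst.
Qed.

Lemma lebesgue_rV_box n (c : 'rV[R]_n) (t : R) :
  lebesgue_rV R n [set v : 'rV[R]_n | forall i, (`|v 0 i - c 0 i| < t)%R] < +oo.
Proof.
elim: n c => [|n IH] c; first by rewrite /= diracE ltry.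
set B := [set v : 'rV[R]_n.+1 | _].
have BE : @cons_rV R n @^-1` B = [set a : measurableTypeR R | (`|a - c 0 0| < t)%R] `*`
    [set v : 'rV[R]_n | forall i, (`|v 0 i - behead_rV c 0 i| < t)%R].
  apply/seteqP; split => -[a v]; rewrite /B/=.
    move=> h; split; first by have := h 0%R; rewrite cons_rV0.
    by move=> i; have := h (lift ord0 i); rewrite cons_rVS behead_rVE.
  move=> [ha hv] i; case: (unliftP ord0 i) => [j ->|->]; last by rewrite cons_rV0.
  by rewrite cons_rVS -behead_rVE.
have -> : lebesgue_rV R n.+1 B = (mu \x lebesgue_rV R n)
    ([set a : measurableTypeR R | (`|a - c 0 0| < t)%R] `*`
     [set v : 'rV[R]_n | forall i, (`|v 0 i - behead_rV c 0 i| < t)%R]).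
  by rewrite -BE.
rewrite product_measure1E; last 2 first.
- rewrite (_ : mkset _ = `](c 0 0 - t)%R, (c 0 0 + t)%R[%classic); first exact: measurable_itv.
  by apply/seteqP; split => a /=; rewrite in_itv/= ltr_distl.
- exact: measurable_box.
have E : [set a : measurableTypeR R | (`|a - c 0 0| < t)%R] =
    `](c 0 0 - t)%R, (c 0 0 + t)%R[%classic.
  by apply/seteqP; split => a /=; rewrite in_itv/= ltr_distl.
rewrite lte_mul_pinfty// E /= lebesgue_measure_itv/=; by case: ifPn.
Qed.

Lemma lebesgue_rV_eball n (c : 'rV[R]_n) (t : R) : (0 < t)%R ->
  lebesgue_rV R n (eball c t) < +oo.
Proof.
move=> t0; apply: le_lt_trans (lebesgue_rV_box c t).
apply: le_measure; rewrite ?inE; [exact: measurable_eball|exact: measurable_box|].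
move=> v /(eball_sqr _ _ t0) vt i.
rewrite -(ltr_pXn2r (ltn0Sn 1)) ?nnegrE// ?ltW//.
apply: le_lt_trans vt; rewrite enorm_sqr (bigD1 i)//= real_normK ?num_real//.
by rewrite !mxE lerDl sumr_ge0// => j _; exact: sqr_ge0.
Qed.

End affine.

(** * Polar coordinates *)

Section polar.
Context {R : realType}.
Notation mu := (@lebesgue_measure R).

Lemma ge0_integral_two_halves (a : R) (k : R -> \bar R) :
  measurable_fun setT k -> (forall y, 0 <= k y)%E ->
  (\int[mu]_y k y = \int[mu]_(w in `]0%R, +oo[) k (a + 1 * w)%R +
                    \int[mu]_(w in `]0%R, +oo[) k (a + -1 * w)%R)%E.
Proof.
move=> mk k0.
have ma (e : R) : measurable_fun setT (fun w : R => k (a + e * w)).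
  apply: (measurableT_comp mk); apply: measurable_funD => //; exact: measurable_funM.
rewrite -(ge0_integral_affine a ltr01 mk k0) mul1e.
rewrite (_ : setT = `]-oo, 0%R] `|` `]0%R, +oo[ :> set R); last first.
  apply/seteqP; split => // y _ /=; rewrite !in_itv/= andbT.
  by case: leP => _; [left|right].
rewrite ge0_integral_setU//=; last 2 first.
- exact: measurable_funTS (ma 1).
- apply/eqP/seteqP; split => // y /= []; rewrite !in_itv/= andbT.
  by rewrite leNgt => /negP.
rewrite addeC; congr (_ + _)%E.
rewrite integral_itv_obnd_cbnd; last exact: measurable_funTS (ma (-1)).
rewrite ge0_integration_by_substitution0//.
by apply: eq_integral => y _; rewrite mulrN mulN1r opprK mul1r.
Qed.

Lemma continuous_cons_rV n (v : 'rV[R]_n) : continuous (fun a : R => cons_rV (a, v)).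
Proof.
rewrite (_ : (fun a : R => _) = fun a : R => cons_rV (0, v) + a *: delta_mx 0 0).
  move=> a; apply: cvgD; first exact: cvg_cst.
  by apply: cvgZ; [exact: cvg_id|exact: cvg_cst].
apply/funext => a; apply/rowP => i; rewrite affine_rVE.
case: (unliftP ord0 i) => [j ->|->]; rewrite ?cons_rVS ?cons_rV0 mxE ?eqxx.
  by rewrite andbF mulr0 addr0.
by rewrite mulr1 add0r.
Qed.

Variable n : nat.
Implicit Types (x y : 'rV[R]_n.+1) (v z : 'rV[R]_n) (t : R).

Lemma behead_rVB x y : behead_rV (y - x) = behead_rV y - behead_rV x.
Proof. by apply/rowP => i; rewrite !(behead_rVE, mxE). Qed.

Lemma eball_cons x t a v : 0 < t ->
  eball x t (cons_rV (a, v)) <->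
  (a - x 0 0) ^+ 2 + enorm (v - behead_rV x) ^+ 2 < t ^+ 2.
Proof.
move=> t0; rewrite eball_sqr// enorm_sqr_cons behead_rVB behead_cons_rV.
by rewrite [X in X ^+ 2 + _](_ : _ = a - x 0 0)// mxE cons_rV0 mxE.
Qed.

(** Coordinate [0] of a point of the half ball is traded for the ratio [s] of
    its distance from the centre to [t]. *)
Lemma ge0_substitution_radius (f : R -> R) (q t : R) : 0 < t -> 0 <= q < t ^+ 2 ->
  (forall w, w \in `]0, Num.sqrt (t ^+ 2 - q)[ -> {for w, continuous f}) ->
  (forall w, w \in `]0, Num.sqrt (t ^+ 2 - q)[ -> 0 <= f w) ->
  (\int[mu]_(w in `]0%R, Num.sqrt (t ^+ 2 - q)[) (f w)%:E =
   \int[mu]_(s in `](Num.sqrt q / t)%R, 1%R[)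
     (f (Num.sqrt (s ^+ 2 * t ^+ 2 - q)) *
      (s * t ^+ 2 / Num.sqrt (s ^+ 2 * t ^+ 2 - q)))%:E)%E.
Proof.
move=> t0 /andP[q0 qt] cf f0.
have t20 : 0 < t ^+ 2 by rewrite exprn_gt0.
have sq s : s \in `](Num.sqrt q / t), 1[ -> [/\ 0 < s, s < 1 & q < s ^+ 2 * t ^+ 2].
  rewrite in_itv/= => /andP[qs s1].
  have s0 : 0 < s by apply: le_lt_trans qs; rewrite divr_ge0 ?sqrtr_ge0 ?ltW.
  split => //; rewrite ltr_pdivrMr// in qs.
  by rewrite -[ltLHS](sqr_sqrtr q0) -exprMn ltr_pXn2r// nnegrE ?sqrtr_ge0// mulr_ge0 ?ltW.
apply: (@ge0_substitution_open _ _ _ (fun s => Num.sqrt (s ^+ 2 * t ^+ 2 - q))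
  (fun w => Num.sqrt (w ^+ 2 + q) / t)
  (fun s => s * t ^+ 2 / Num.sqrt (s ^+ 2 * t ^+ 2 - q)) f) => //.
- apply: itv_oo_exhaustion; rewrite ltr_pdivrMr// mul1r.
  by rewrite -[ltRHS]gtr0_norm// -sqrtr_sqr ltr_sqrt.
- move=> s /sq[s0 s1 qs]; rewrite in_itv/= sqrtr_gt0 subr_gt0 qs/=.
  by rewrite ltr_sqrt ?subr_gt0// ltrD2r gtr_pMl// expr_lt1// ltW.
- move=> w; rewrite !in_itv/= => /andP[w0 wt].
  have wt2 : w ^+ 2 < t ^+ 2 - q.
    rewrite -[ltRHS]sqr_sqrtr ?subr_ge0 ?(ltW qt)// ltr_pXn2r// nnegrE ?sqrtr_ge0//.
    exact: ltW.
  have wq : 0 < w ^+ 2 + q by rewrite ltr_wpDr// exprn_gt0.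
  rewrite ltr_pM2r ?invr_gt0// ltr_sqrt// ltrDr exprn_gt0//=.
  rewrite ltr_pdivrMr// mul1r -[ltRHS]gtr0_norm// -sqrtr_sqr ltr_sqrt//.
  by rewrite -ltrBrDr.
- move=> w; rewrite !in_itv/= => /andP[w0 wt].
  rewrite expr_div_n divfK ?gt_eqF// sqr_sqrtr ?addr_ge0 ?sqr_ge0// addrK.
  by rewrite sqrtr_sqr gtr0_norm.
- move=> s /sq[s0 s1 qs].
  have H : is_derive s 1 (fun s : R => s ^+ 2 * t ^+ 2 - q) (2 * s * t ^+ 2).
    by apply: is_derive_eq; rewrite /GRing.scale/=; ring.
  have h0 : 0 < s ^+ 2 * t ^+ 2 - q by rewrite subr_gt0.
  have := @is_derive1_comp R Num.sqrt (fun s : R => s ^+ 2 * t ^+ 2 - q) s _ _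
    (is_derive1_sqrt h0) H.
  move=> H2; apply: is_derive_eq H2 _.
  by field; rewrite gt_eqF// sqrtr_gt0.
- move=> s /sq[s0 s1 qs]; rewrite divr_gt0// ?mulr_gt0// sqrtr_gt0 subr_gt0//.
- move=> s /sq[s0 s1 qs]; apply: continuousM.
    by apply: continuousM; [exact: id|exact: cst_continuous].
  apply: (@continuousV _ _ (fun s : R => Num.sqrt (s ^+ 2 * t ^+ 2 - q))).
    by rewrite gt_eqF// sqrtr_gt0 subr_gt0.
  apply: (@continuous_comp _ _ _ (fun s : R => s ^+ 2 * t ^+ 2 - q) Num.sqrt);
    last exact: sqrt_continuous.
  apply: continuousB; last exact: cst_continuous.
  by apply: continuousM; [exact: exprn_continuous|exact: cst_continuous].
Qed.

End polar.

Section rays_of_sphere.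
Context {R : realType} {n : nat}.

Lemma sub_rVE m (a b : 'rV[R]_m) i : (a - b) 0 i = a 0 i - b 0 i.
Proof. by rewrite !mxE. Qed.

Lemma measurable_inv : measurable_fun setT (@GRing.inv R).
Proof.
rewrite -(setvU [set (0:R)]); apply/measurable_funU => //; first exact: measurableC.
split.
  apply: open_continuous_measurable_fun; first by rewrite openC; exact: closed_eq.
  by move=> y; rewrite inE/= => /eqP y0; exact: inv_continuous.
exact: measurable_fun_set1.
Qed.

Variables (x : 'rV[R]_n.+1) (t : R).
Hypothesis t0 : 0 < t.
Let c := behead_rV x.

Definition sphere_point (e : R) (z : 'rV[R]_n) : 'rV[R]_n.+1 :=
  cons_rV (hemisphere e x t z, z).

(** Surface measure of either hemisphere relative to Lebesgue measure on the
    equatorial ball; [area_elementE] links it to [area_element]. *)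
Definition area_density (z : 'rV[R]_n) : R :=
  t / Num.sqrt (t ^+ 2 - enorm (z - c) ^+ 2).

Lemma area_density_ge0 z : 0 <= area_density z.
Proof. by rewrite divr_ge0 ?sqrtr_ge0// ltW. Qed.

Lemma area_density_out z : ~ eball c t z -> area_density z = 0.
Proof.
move=> /(eball_sqr _ _ t0)/negP; rewrite -leNgt => tz.
by rewrite /area_density ler0_sqrtr ?subr_le0// invr0 mulr0.
Qed.

Lemma measurable_enorm_sqr : measurable_fun setT (fun z : 'rV[R]_n => enorm (z - c) ^+ 2).
Proof.
apply: continuous_measurable_rV; first exact: openT.
by move=> z _; exact: continuous_enorm_sqr.
Qed.

Lemma measurable_sqrt : measurable_fun setT (@Num.sqrt R).
Proof. by apply: continuous_measurable_fun; exact: sqrt_continuous. Qed.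

Lemma measurable_area_density : measurable_fun setT area_density.
Proof.
apply: measurable_funM => //; apply: (measurableT_comp measurable_inv).
apply: (measurableT_comp measurable_sqrt); apply: measurable_funB => //.
exact: measurable_enorm_sqr.
Qed.

Lemma ray_in_eball (e s : R) z : e ^+ 2 = 1 -> 0 < s < 1 -> eball c t z ->
  enorm (x + s *: (sphere_point e z - x) - x) ^+ 2 = s ^+ 2 * t ^+ 2.
Proof.
move=> e1 s01 /(eball_sqr _ _ t0) zt.
rewrite [_ - x]addrAC subrr add0r enormZ; congr (_ * _).
rewrite enorm_sqr_cons behead_rVB behead_cons_rV.
rewrite [X in X ^+ 2 + _](_ : _ = e * Num.sqrt (t ^+ 2 - enorm (z - c) ^+ 2)); last first.
  by rewrite mxE cons_rV0 mxE /hemisphere addrAC subrr add0r.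
by rewrite exprMn e1 mul1r sqr_sqrtr ?subr_ge0 ?ltW// subrK.
Qed.

Lemma ray_cons (e s : R) z : x + s *: (sphere_point e z - x) =
  cons_rV (x 0 0 + s * (e * Num.sqrt (t ^+ 2 - enorm (z - c) ^+ 2)),
           c + s *: (z - c)).
Proof.
apply/rowP => i; rewrite affine_rVE; case: (unliftP ord0 i) => [j ->|->].
  rewrite cons_rVS affine_rVE /c behead_rVE; congr (_ + _ * _).
  by rewrite !sub_rVE cons_rVS behead_rVE.
rewrite cons_rV0; congr (_ + _ * _).
by rewrite mxE cons_rV0 mxE /hemisphere addrAC subrr add0r.
Qed.

Lemma measurable_ray (e : R) : measurable_fun setT
  (fun p : measurableTypeR R * 'rV[R]_n => x + p.1 *: (sphere_point e p.2 - x)).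
Proof.
apply: measurable_fun_rVP => i.
under eq_fun do rewrite ray_cons.
case: (unliftP ord0 i) => [j ->|->].
  under eq_fun do rewrite cons_rVS affine_rVE.
  apply: measurable_funD => //; apply: measurable_funM => //.
  under eq_fun do rewrite mxE.
  apply: measurable_funD; first exact: measurableT_comp (measurable_coord j) measurable_snd.
  exact: measurable_cst.
under eq_fun do rewrite cons_rV0.
apply: measurable_funD => //; apply: measurable_funM => //; apply: measurable_funM => //.
apply: (measurableT_comp measurable_sqrt); apply: measurable_funB => //.
exact: measurableT_comp measurable_enorm_sqr measurable_snd.
Qed.

End rays_of_sphere.

Section polar_integration.
Context {R : realType} {n : nat}.
Notation mu := (@lebesgue_measure R).
Notation leb := (lebesgue_rV R n).
Variables (x : 'rV[R]_n.+1) (t : R).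
Hypothesis t0 : 0 < t.
Let c := behead_rV x.
Let Q (z : 'rV[R]_n) := enorm (z - c) ^+ 2.

(** Contribution to an integral over the ball of the rays that end on the
    hemisphere [e]: for [y = x + s *: (w - x)] with [w] on the sphere, the
    volume element is [s ^+ n * t] times the product of [ds] and the surface
    element. *)
Definition ray_integral (e : R) (phi : 'rV[R]_n.+1 -> R) : \bar R :=
  (\int[leb]_(z in eball c t) \int[mu]_(s in `]0%R, 1%R[)
    (phi (x + s *: (sphere_point x t e z - x)) * s ^+ n *
     (t * area_density x t z))%:E)%E.

(** The integrand of [ray_integral], extended by [0] to a product space on which
    Tonelli applies. *)
Definition ray_kernel (e : R) (phi : 'rV[R]_n.+1 -> R)
    (p : measurableTypeR R * 'rV[R]_n) : \bar R :=
  (((EFin \o phi) \_ (eball x t)) (x + p.1 *: (sphere_point x t e p.2 - x))%R *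
  (\1_(`]0%R, 1%R[%classic : set R) p.1 * p.1 ^+ n * (t * area_density x t p.2))%:E)%E.

Section ray_kernel.
Variables (e : R) (phi : 'rV[R]_n.+1 -> R).
Hypothesis e1 : e ^+ 2 = 1.
Hypothesis cphi : forall y, eball x t y -> {for y, continuous phi}.
Hypothesis phi0 : forall y, eball x t y -> 0 <= phi y.

Lemma measurable_patch_ball : measurable_fun setT ((EFin \o phi) \_ (eball x t)).
Proof.
apply/(measurable_restrictT _ _).1; first exact: measurable_eball.
by apply/measurable_EFinP; apply: continuous_measurable_rV => //; exact: open_eball.
Qed.

Lemma patch_ball_ge0 y : (0 <= ((EFin \o phi) \_ (eball x t)) y)%E.
Proof. by rewrite patchE; case: ifPn => //; rewrite inE => /phi0; rewrite lee_fin. Qed.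

Lemma ray_kernel_ge0 p : (0 <= ray_kernel e phi p)%E.
Proof.
rewrite mule_ge0 ?patch_ball_ge0// lee_fin indicE.
case: (boolP (_ \in _)); last by rewrite !mul0r.
rewrite inE/= in_itv/= => /andP[p0 _]; rewrite mul1r mulr_ge0 ?exprn_ge0 ?(ltW p0)//.
by rewrite mulr_ge0 ?area_density_ge0// ltW.
Qed.

Lemma measurable_ray_kernel : measurable_fun setT (ray_kernel e phi).
Proof.
apply: emeasurable_funM.
  exact: measurableT_comp measurable_patch_ball (measurable_ray _ _ _).
apply/measurable_EFinP/measurable_funM.
  apply: measurable_funM.
    by apply: (measurableT_comp _ measurable_fst); exact: measurable_indic.
  by apply: measurable_funX; exact: measurable_fst.
apply: measurable_funM => //.
exact: measurableT_comp (measurable_area_density _ _) measurable_snd.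
Qed.

Lemma integral_ray_kernel z : eball c t z ->
  (\int[mu]_s ray_kernel e phi (s, z) = \int[mu]_(s in `]0%R, 1%R[)
    (phi (x + s *: (sphere_point x t e z - x)) * s ^+ n *
     (t * area_density x t z))%:E)%E.
Proof.
move=> zt; rewrite [RHS]integral_mkcond; apply: eq_integral => s _.
rewrite patchE /ray_kernel/= indicE; case: ifPn => s01; last by rewrite !mul0r mule0.
have := s01; rewrite inE/= in_itv/= => s01'.
rewrite patchE mem_set; first by rewrite mul1r /= -EFinM !mulrA.
apply/(eball_sqr _ _ t0); rewrite ray_in_eball//.
move: s01' => /andP[s0 s1]; rewrite gtr_pMl ?exprn_gt0//.
by rewrite expr_lt1// ltW.
Qed.

Lemma measurable_ray_inner : measurable_fun (eball c t) (fun z =>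
  \int[mu]_(s in `]0%R, 1%R[) (phi (x + s *: (sphere_point x t e z - x)) * s ^+ n *
     (t * area_density x t z))%:E)%E.
Proof.
apply: (eq_measurable_fun (fun z => \int[mu]_s ray_kernel e phi (s, z))%E).
  by move=> z; rewrite inE => zt; rewrite integral_ray_kernel.
apply: measurable_funTS.
apply: measurable_fun_fubini_tonelli_G; first exact: measurable_ray_kernel.
exact: ray_kernel_ge0.
Qed.

End ray_kernel.

(** At fixed [v], coordinate [0] is traded for the ratio [s] of radii. Then
    Tonelli makes [s] the outer variable and [v] is dilated by [s] about the
    centre: this produces the factor [s ^+ n] and moves the point to the ray
    through [sphere_point x t e v]. *)
Lemma ray_integral_half (e : R) (phi : 'rV[R]_n.+1 -> R) : e ^+ 2 = 1 ->
  (forall y, eball x t y -> {for y, continuous phi}) ->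
  (forall y, eball x t y -> 0 <= phi y) ->
  (\int[leb]_v \int[mu]_(w in `]0%R, +oo[)
     ((EFin \o phi) \_ (eball x t)) (cons_rV (x 0 0 + e * w, v)%R) =
   ray_integral e phi)%E.
Proof.
move=> e1 cphi phi0.
pose f := (EFin \o phi) \_ (eball x t).
have mf : measurable_fun setT f by exact: measurable_patch_ball.
have f0 y : (0 <= f y)%E by exact: patch_ball_ge0.
have mQ : measurable_fun setT Q by exact: measurable_enorm_sqr.
pose g (p : measurableTypeR R * 'rV[R]_n) : \bar R :=
  (f (cons_rV (x 0 0 + e * Num.sqrt (p.1 ^+ 2 * t ^+ 2 - Q p.2), p.2)%R) *
  (\1_(`]0%R, 1%R[%classic : set R) p.1 *
   (p.1 * t ^+ 2 / Num.sqrt (p.1 ^+ 2 * t ^+ 2 - Q p.2)))%:E)%E.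
have ind0 (s : R) : 0 <= \1_(`]0%R, 1%R[%classic : set R) s :> R by rewrite indicE.
have g0 p : (0 <= g p)%E.
  rewrite mule_ge0// lee_fin indicE; case: (boolP (_ \in _)); last by rewrite mul0r.
  by rewrite inE/= in_itv/= => /andP[p0 _]; rewrite mul1r divr_ge0 ?sqrtr_ge0// mulr_ge0 ?sqr_ge0// ltW.
have mQ2 : measurable_fun setT (fun p : measurableTypeR R * 'rV[R]_n => Num.sqrt (p.1 ^+ 2 * t ^+ 2 - Q p.2)).
  apply: (measurableT_comp (@measurable_sqrt R)); apply: measurable_funB.
    by apply: measurable_funM => //; apply: measurable_funX; exact: measurable_fst.
  exact: measurableT_comp mQ measurable_snd.
have mg : measurable_fun setT g.
  apply: emeasurable_funM.
    apply: (measurableT_comp mf); apply: measurable_fun_rVP => i.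
    case: (unliftP ord0 i) => [j ->|->].
      under eq_fun do rewrite cons_rVS.
      exact: measurableT_comp (measurable_coord j) measurable_snd.
    under eq_fun do rewrite cons_rV0.
    by apply: measurable_funD => //; apply: measurable_funM.
  apply/measurable_EFinP/measurable_funM.
    by apply: (measurableT_comp _ measurable_fst); exact: measurable_indic.
  apply: measurable_funM; last exact: (measurableT_comp (@measurable_inv R)).
  by apply: measurable_funM => //; exact: measurable_fst.
transitivity (\int[leb]_v \int[mu]_s g (s, v))%E.
  apply: eq_integral => v _.
  have [vt|vt] := ltP (Q v) (t ^+ 2); last first.
    transitivity (0%R : \bar R); [|apply/esym]; apply: integral0_eq => w; last first.
      rewrite /g/= indicE; case: (boolP (_ \in _)); last by rewrite mul0r mule0.
      rewrite inE/= in_itv/= => /andP[w0 w1] _.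
      rewrite [Num.sqrt _]ler0_sqrtr ?invr0 ?mulr0 ?mule0// subr_le0.
      rewrite (le_trans _ vt)// ler_piMl ?sqr_ge0// expr_le1// ltW//.
    rewrite /= in_itv/= andbT => w0; rewrite -/f /f patchE ifN// notin_setE => /(eball_cons _ _ _ t0).
    rewrite ltNge => /negP; apply; rewrite (le_trans vt)// lerDr sqr_ge0//.
  pose b := Num.sqrt (t ^+ 2 - Q v).
  have b0 : 0 < b by rewrite sqrtr_gt0 subr_gt0.
  have bE : b ^+ 2 = t ^+ 2 - Q v by rewrite sqr_sqrtr// subr_ge0 ltW.
  have inB w : 0 < w -> eball x t (cons_rV (x 0 0 + e * w, v)) <-> w < b.
    move=> w0; rewrite eball_cons// addrAC subrr add0r exprMn e1 mul1r -ltrBrDr -bE.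
    by rewrite ltr_pXn2r// nnegrE ltW.
  transitivity (\int[mu]_(w in `]0%R, b[) (phi (cons_rV (x 0 0 + e * w, v)%R))%:E)%E.
    rewrite integral_mkcond [RHS]integral_mkcond; apply: eq_integral => w _.
    rewrite patchE [RHS]patchE.
    rewrite (_ : (w \in _) = (0 < w)); last by rewrite mem_setE in_itv/= andbT.
    rewrite (_ : (w \in _) = (0 < w) && (w < b)); last by rewrite mem_setE in_itv.
    have [w0|//] := ltP 0 w; rewrite -/f /f patchE.
    have [wb|bw] := ltP w b; first by rewrite mem_set//; exact/inB.
    by rewrite memNset// => /(inB _ w0); rewrite ltNge bw.
  have Q0 : 0 <= Q v by exact: sqr_ge0.
  rewrite (@ge0_substitution_radius _ (fun w => phi (cons_rV (x 0 0 + e * w, v)%R)) (Q v) t)//; last first.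
  - by move=> w; rewrite in_itv/= => /andP[w0 wb]; apply/phi0/inB.
  - move=> w; rewrite in_itv/= => /andP[w0 wb].
    apply: (@continuous_comp _ _ _ (fun w : R => x 0 0 + e * w) (fun a => phi (cons_rV (a, v)))).
      apply: continuousD; first exact: cst_continuous.
      by apply: continuousM; [exact: cst_continuous|exact: id].
    apply: (@continuous_comp _ _ _ (fun a : R => cons_rV (a, v)) phi).
      exact: continuous_cons_rV.
    exact/cphi/inB.
  - by rewrite Q0.
  rewrite integral_mkcond; apply: eq_integral => s _; rewrite patchE mem_setE in_itv/=.
  rewrite /g/= indicE mem_setE in_itv/=.
  have [s0|s0] := ltP 0 s; last first.
    rewrite mul0r mule0 ifF//; apply/negbTE; rewrite negb_and -leNgt.
    by rewrite (le_trans s0)// divr_ge0 ?sqrtr_ge0// ltW.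
  have [s1|s1] := ltP s 1; last by rewrite andbF mul0r mule0.
  rewrite andbT mul1r ltr_pdivrMr//.
  have sE : (Num.sqrt (Q v) < s * t) = (Q v < s ^+ 2 * t ^+ 2).
    rewrite -[Q v in RHS](sqr_sqrtr Q0) -exprMn ltr_pXn2r// nnegrE ?sqrtr_ge0//.
    by apply: mulr_ge0; exact: ltW.
  rewrite sE; case: ltP => sQ; last first.
    by rewrite [Num.sqrt _]ler0_sqrtr ?subr_le0// invr0 !mulr0 mule0.
  rewrite -/f /f patchE mem_set//.
  apply/inB; first by rewrite sqrtr_gt0 subr_gt0.
  rewrite ltr_sqrt ?subr_gt0// ltrD2r gtr_pMl ?exprn_gt0//.
  by rewrite expr_lt1// ltW.
rewrite -(fubini_tonelli g)//.
pose h := ray_kernel e phi.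
have h0 p : (0 <= h p)%E by exact: ray_kernel_ge0.
have mh : measurable_fun setT h by exact: measurable_ray_kernel.
transitivity (\int[mu]_s \int[leb]_z h (s, z))%E.
  apply: eq_integral => s _.
  have [|s01] := boolP (s \in (`]0%R, 1%R[%classic : set R)); last first.
    by rewrite !integral0_eq// => z _; rewrite /h/ray_kernel/g/= indicE (negbTE s01) !mul0r mule0.
  move=> s01; have := s01; rewrite inE/= in_itv/= => /andP[s0 s1].
  have mgs : measurable_fun setT (fun v => g (s, v)).
    exact: measurableT_comp mg (measurable_pair1 _).
  rewrite -(@ge0_integral_affine_rV R n ((1 - s) *: c) s (fun v => g (s, v)))//.
  rewrite -ge0_integralZl//=; last 2 first.
  - by apply: (measurableT_comp mgs); exact: measurable_affine_rV.
  - by rewrite lee_fin exprn_ge0// ltW.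
  apply: eq_integral => z _; rewrite /g /h /ray_kernel/= indicE s01 !mul1r.
  have vE : (1 - s) *: c + s *: z = c + s *: (z - c).
    by rewrite scalerBl scale1r scalerBr addrA addrAC.
  have QE : Q ((1 - s) *: c + s *: z) = s ^+ 2 * Q z.
    by rewrite /Q vE addrAC subrr add0r enormZ.
  have sqE : Num.sqrt (s ^+ 2 * t ^+ 2 - Q ((1 - s) *: c + s *: z)) =
      s * Num.sqrt (t ^+ 2 - Q z).
    by rewrite QE -mulrBr sqrtrM ?sqr_ge0// sqrtr_sqr gtr0_norm.
  rewrite sqE vE ray_cons -/c -/(Q z) [(e * (s * _))%R]mulrCA muleCA; congr (_ * _)%E.
  rewrite -EFinM; congr _%:E; rewrite /area_density -/c -/(Q z).
  have [->|sz] := eqVneq (Num.sqrt (t ^+ 2 - Q z)) 0; first by rewrite mulr0 !invr0 !mulr0.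
  by field; rewrite sz gt_eqF.
rewrite (fubini_tonelli h)// /ray_integral [RHS]integral_mkcond; apply: eq_integral => z _.
rewrite patchE; case: ifPn => [|zt]; last first.
  rewrite integral0_eq// => s _; rewrite /h /ray_kernel/= area_density_out ?mulr0 ?mule0//.
  by move/mem_set => zt'; rewrite zt' in zt.
by rewrite inE => zt; rewrite integral_ray_kernel.
Qed.

(** The equatorial hyperplane, a null set, cuts the ball in two halves, and
    [ray_integral_half] sweeps each of them by its rays. *)
Lemma polar_formula (phi : 'rV[R]_n.+1 -> R) :
  (forall y, eball x t y -> {for y, continuous phi}) ->
  (forall y, eball x t y -> 0 <= phi y) ->
  (\int[lebesgue_rV R n.+1]_(y in eball x t) (phi y)%:E =
   ray_integral 1 phi + ray_integral (-1) phi)%E.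
Proof.
move=> cphi phi0.
pose f := (EFin \o phi) \_ (eball x t).
have mf : measurable_fun setT f by exact: measurable_patch_ball.
have f0 y : (0 <= f y)%E by exact: patch_ball_ge0.
rewrite -(ray_integral_half (expr1n _ 2))// -(@ray_integral_half (-1))//; last first.
  by rewrite sqrrN expr1n.
rewrite integral_mkcond -/f integral_lebesgue_rVS2//.
have mF (e : R) : measurable_fun setT (fun v : 'rV[R]_n =>
    \int[mu]_(w in `]0%R, +oo[) f (cons_rV (x 0 0 + e * w, v)%R))%E.
  under eq_fun do rewrite integral_mkcond.
  apply: (@measurable_fun_fubini_tonelli_G _ _ _ _ _ mu (fun p : measurableTypeR R * 'rV[R]_n =>
    ((fun w => f (cons_rV (x 0 0 + e * w, p.2)%R)) \_ `]0%R, +oo[) p.1)).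
    rewrite (_ : (fun p => _) = (fun p : measurableTypeR R * 'rV[R]_n =>
        f (cons_rV (x 0 0 + e * p.1, p.2)%R) *
        (\1_(`]0%R, +oo[%classic : set R) p.1)%:E))%E; last first.
      apply/funext => p; rewrite patchE indicE; case: ifPn => _; last by rewrite mule0.
      by rewrite mule1.
    apply: emeasurable_funM.
      apply: (measurableT_comp mf); apply: measurable_fun_rVP => i.
      case: (unliftP ord0 i) => [j ->|->].
        under eq_fun do rewrite cons_rVS.
        exact: measurableT_comp (measurable_coord j) measurable_snd.
      under eq_fun do rewrite cons_rV0.
      by apply: measurable_funD => //; apply: measurable_funM.
    apply/measurable_EFinP.
    by apply: (measurableT_comp _ measurable_fst); exact: measurable_indic.
  by move=> p; rewrite patchE; case: ifPn.
rewrite -ge0_integralD//; last 2 first.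
- by move=> v _; exact: integral_ge0.
- by move=> v _; exact: integral_ge0.
apply: eq_integral => v _; apply: ge0_integral_two_halves => //.
apply: (measurableT_comp mf); apply: measurable_fun_rVP => i.
case: (unliftP ord0 i) => [j ->|->].
  under eq_fun do rewrite cons_rVS; exact: measurable_cst.
under eq_fun do rewrite cons_rV0; exact: measurable_id.
Qed.

End polar_integration.

(** * Surface area and rays *)

Section rays.
Context {R : realType} {n : nat}.
Notation mu := (@lebesgue_measure R).
Notation leb := (lebesgue_rV R n).
Variables (x : 'rV[R]_n.+1) (t : R).
Hypothesis t0 : 0 < t.
Let c := behead_rV x.

Lemma integral_exprn_unit (m : nat) :
  (\int[mu]_(s in `]0%R, 1%R[) (s ^+ m)%:E = (m.+1%:R^-1)%:E)%E.
Proof.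
rewrite -integral_powR_unit'//; apply: eq_integral => s.
by rewrite inE/= in_itv/= => /andP[s0 _]; rewrite -natr1 addrK powR_mulrn// ltW.
Qed.

(** By the polar formula for the constant [1], this area is at most a multiple
    of the volume of the ball. *)
Lemma sphere_area_fin :
  (\int[leb]_(z in eball c t) (area_density x t z)%:E < +oo)%E.
Proof.
have mA : measurable_fun (eball c t) (EFin \o area_density x t).
  apply/measurable_EFinP/measurable_funTS; exact: measurable_area_density.
have A0 z : eball c t z -> (0 <= (area_density x t z)%:E)%E.
  by move=> _; rewrite lee_fin area_density_ge0.
have k0 : 0 < n.+1%:R^-1 * t by rewrite mulr_gt0// invr_gt0.
have E : ray_integral x t 1 (cst 1) = ((n.+1%:R^-1 * t)%:E *
    \int[leb]_(z in eball c t) (area_density x t z)%:E)%E.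
  rewrite -ge0_integralZl//; last 2 first.
  - exact: measurable_eball.
  - by rewrite lee_fin ltW.
  apply: eq_integral => z _.
  rewrite -[RHS]EFinM -mulrA EFinM -integral_exprn_unit -ge0_integralZr//.
  - by apply: eq_integral => s _; rewrite mul1r EFinM.
  - by apply/measurable_EFinP/measurable_funTS/measurable_funX.
  - by move=> s /=; rewrite in_itv/= => /andP[s0 _]; rewrite lee_fin exprn_ge0// ltW.
  - by rewrite lee_fin mulr_ge0 ?area_density_ge0// ltW.
have V : (\int[lebesgue_rV R n.+1]_(y in eball x t) (1%R)%:E =
    ray_integral x t 1 (cst (1:R)%R) + ray_integral x t (-1) (cst (1:R)%R))%E.
  apply: (@polar_formula R n x t t0 (cst (1:R)%R)) => // y _; exact: cst_continuous.
have {}V : (lebesgue_rV R n.+1 (eball x t) =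
    ray_integral x t 1 (cst (1:R)%R) + ray_integral x t (-1) (cst (1:R)%R))%E.
  by rewrite -V integral_cst ?mul1e//; exact: measurable_eball.
have : (ray_integral x t 1 (cst (1:R)%R) < +oo)%E.
  apply: le_lt_trans (lebesgue_rV_eball x t0); rewrite V leeDl//.
  apply: integral_ge0 => z _; apply: integral_ge0 => s /=.
  rewrite in_itv/= => /andP[s0 _]; rewrite lee_fin mul1r mulr_ge0 ?exprn_ge0 ?(ltW s0)//.
  by rewrite mulr_ge0 ?area_density_ge0// ltW.
have : (0 <= \int[leb]_(z in eball c t) (area_density x t z)%:E)%E.
  by apply: integral_ge0 => z; exact: A0.
rewrite E; case: (\int[leb]_(z in _) _)%E => [r||]//=.
- by move=> *; rewrite ltry.
- by rewrite gt0_muley// lte_fin.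
Qed.

Lemma enorm_sphere_point (e : R) z : e ^+ 2 = 1 -> eball c t z ->
  enorm (sphere_point x t e z - x) ^+ 2 = t ^+ 2.
Proof.
move=> e1 /(eball_sqr _ _ t0) zt.
rewrite enorm_sqr_cons behead_rVB behead_cons_rV.
rewrite [X in X ^+ 2 + _](_ : _ = e * Num.sqrt (t ^+ 2 - enorm (z - c) ^+ 2)); last first.
  by rewrite sub_rVE cons_rV0 /hemisphere addrAC subrr add0r.
by rewrite exprMn e1 mul1r sqr_sqrtr ?subr_ge0 ?ltW// subrK.
Qed.

Lemma coord_le_enorm m (v : 'rV[R]_m) i : `|v 0 i| <= enorm v.
Proof.
rewrite -ler_sqr ?nnegrE ?enorm_ge0// enorm_sqr real_normK ?num_real//.
by rewrite (bigD1 i)//= lerDl sumr_ge0// => j _; exact: sqr_ge0.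
Qed.

End rays.

Section ray_derivative.
Context {R : realType} {m : nat}.
Variable h : 'rV[R]_m -> R.
Hypothesis dh : forall y, differentiable h y.

Lemma derive_coord (y v : 'rV[R]_m) :
  'D_v h y = \sum_i v 0 i * 'D_(delta_mx 0 i) h y.
Proof.
rewrite deriveE//; rewrite [in LHS](row_sum_delta v) linear_sum/=.
by apply: eq_bigr => i _; rewrite linearZ/= deriveE.
Qed.

Lemma is_derive_ray (x v : 'rV[R]_m) (s : R) :
  is_derive s 1 (fun s => h (x + s *: v))
    (\sum_i v 0 i * 'D_(delta_mx 0 i) h (x + s *: v)).
Proof.
rewrite -derive_coord.
have E : (fun l : R => l^-1 *: ((h (x + (l *: 1 + s) *: v)) - h (x + s *: v))) =
    (fun l => l^-1 *: (h (l *: v + (x + s *: v)) - h (x + s *: v))).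
  apply/funext => l; congr (_ *: (h _ - _)).
  have -> : l *: (1 : R) = l by exact: mulr1.
  by rewrite scalerDl [RHS]addrCA.
have D : derivable h (x + s *: v) v by exact: diff_derivable.
apply: DeriveDef.
  by rewrite /derivable/= E; exact: D.
by rewrite /derive/= E.
Qed.

Lemma continuous_ray (x v : 'rV[R]_m) : continuous (fun s : R => x + s *: v).
Proof.
move=> s; apply: cvgD; first exact: cvg_cst.
by apply: cvgZ; [exact: cvg_id|exact: cvg_cst].
Qed.

End ray_derivative.

(** * Concentration of singular weights at the sphere *)

Section radial_weight.
Context {R : realType}.
Notation mu := (@lebesgue_measure R).

(** A probability density on the unit interval, concentrating at [1] as [a]
    tends to [0]. It comes from a power of [t ^+ 2 - enorm (y - x) ^+ 2] along a
    ray and one factor [s] of the polar Jacobian. *)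
Definition radial_weight (a s : R) : R := 2 * a * s * (1 - s ^+ 2) `^ (a - 1).

Lemma radial_weight_ge0 a s : 0 < a -> 0 <= s -> 0 <= radial_weight a s.
Proof. by move=> a0 s0; rewrite !mulr_ge0 ?powR_ge0// ltW. Qed.

Lemma measurable_radial_weight a D : measurable_fun D (radial_weight a).
Proof.
apply: measurable_funTS; apply: measurable_funM; first exact: measurable_funM.
apply: (measurableT_comp (measurable_powR (a - 1))).
by apply: measurable_funB => //; exact: measurable_funX.
Qed.

(** The second weight, [a / (a + 1) * radial_weight (a + 1) s], is
    [(1 - s ^+ 2) * radial_weight a s]: an error of order [1 - s ^+ 2] has an
    integral that vanishes with [a]. *)
Lemma integral_radial_weights a (p q : R) : 0 < a -> 0 <= p -> 0 <= q ->
  (\int[mu]_(s in `]0%R, 1%R[)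
     (radial_weight a s * p + a / (a + 1) * radial_weight (a + 1) s * q)%:E =
   (p + a / (a + 1) * q)%:E)%E.
Proof.
move=> a0 p0 q0; have a10 : 0 < a + 1 by rewrite addr_gt0.
have k0 : 0 <= a / (a + 1) * q by rewrite mulr_ge0// divr_ge0 ?ltW.
transitivity (\int[mu]_(s in `]0%R, 1%R[) ((radial_weight a s)%:E * p%:E) +
    \int[mu]_(s in `]0%R, 1%R[) ((radial_weight (a + 1) s)%:E * (a / (a + 1) * q)%:E))%E.
  rewrite -ge0_integralD//.
  - by apply: eq_integral => s _; rewrite -!EFinM -EFinD; congr (_ + _)%:E; rewrite mulrAC mulrC.
  - move=> s /=; rewrite in_itv/= => /andP[s0 _].
    by rewrite mule_ge0// lee_fin radial_weight_ge0// ltW.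
  - apply: emeasurable_funM => //; apply/measurable_EFinP; exact: measurable_radial_weight.
  - move=> s /=; rewrite in_itv/= => /andP[s0 _].
    by rewrite mule_ge0// lee_fin radial_weight_ge0// ltW.
  - apply: emeasurable_funM => //; apply/measurable_EFinP; exact: measurable_radial_weight.
have w0 b s : 0 < b -> (`]0%R, 1%R[%classic : set R) s -> (0 <= (radial_weight b s)%:E)%E.
  by move=> b0 /=; rewrite in_itv/= => /andP[s0 _]; rewrite lee_fin radial_weight_ge0// ltW.
rewrite !ge0_integralZr//.
- by rewrite !integral_radial_weight// !mul1e -EFinD.
- by apply/measurable_EFinP; exact: measurable_radial_weight.
- by move=> s; exact: w0.
- by apply/measurable_EFinP; exact: measurable_radial_weight.
- by move=> s; exact: w0.
Qed.

End radial_weight.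

Section concentration.
Context {R : realType} {m : nat}.
Let n := m.+1.
Notation mu := (@lebesgue_measure R).
Notation leb := (lebesgue_rV R n).
Variables (x : 'rV[R]_n.+1) (t : R).
Hypothesis t0 : 0 < t.
Let c := behead_rV x.
Let P e z := sphere_point x t e z.
Let A := area_density x t.

Lemma measurable_sphere_point e : measurable_fun setT (P e).
Proof.
rewrite (_ : P e = fun z => x + 1 *: (sphere_point x t e z - x)); last first.
  by apply/funext => z; rewrite scale1r addrC subrK.
exact: measurableT_comp (measurable_ray x t e) (measurable_pair1 (1 : measurableTypeR R)).
Qed.

Variable h : 'rV[R]_n.+1 -> R.
Hypothesis ch : continuous h.

Lemma measurable_on_sphere e D : measurable_fun D (fun z => h (P e z)).
Proof.
apply: measurable_funTS; apply: measurableT_comp (measurable_sphere_point e).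
by apply: continuous_measurable_rV => [|y _]; [exact: openT|exact: ch].
Qed.

Lemma integrable_on_sphere e (C : R) : (forall y, `|h y| <= C) ->
  leb.-integrable (eball c t) (fun z => (A z * h (P e z))%:E).
Proof.
move=> hC; have C0 : 0 <= C by rewrite (le_trans _ (hC 0)).
have mA : measurable_fun (eball c t) A.
  by apply: measurable_funTS; exact: measurable_area_density.
apply: (@le_integrable _ _ _ leb _ _ _ (fun z => (C%:E * (A z)%:E)%E)).
- exact: measurable_eball.
- by apply/measurable_EFinP/measurable_funM => //; exact: measurable_on_sphere.
- move=> z _; have Az := area_density_ge0 x t0 z.
  rewrite /= lee_fin normrM [`|A z|]ger0_norm// [leRHS]ger0_norm 1?mulr_ge0//.
  by rewrite mulrC ler_wpM2r.
- apply: integrableZl; first exact: measurable_eball.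
  apply/integrableP; split; first exact/measurable_EFinP.
  under eq_integral do rewrite gee0_abs ?lee_fin ?area_density_ge0//.
  exact: sphere_area_fin.
Qed.

Variables (eps L : R).
Hypothesis eps0 : 0 < eps.
Hypothesis L0 : 0 <= L.
Hypothesis h0 : forall y, 0 <= h y.
Hypothesis Lh : forall e z s, e ^+ 2 = 1 -> eball c t z -> 0 < s < 1 ->
  `|s ^+ m * h (x + s *: (P e z - x)) - h (P e z)| <= L * (1 - s ^+ 2).

Let phi y := h y * (eps * (t ^+ 2 - enorm (y - x) ^+ 2) `^ (eps - 1)).
Let kappa : R := (t ^+ 2) `^ (eps - 1) / 2.

Let kappa0 : 0 <= kappa. Proof. by rewrite divr_ge0 ?powR_ge0. Qed.

Let ray_inner e z : e ^+ 2 = 1 -> eball c t z ->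
  (\int[mu]_(s in `]0%R, 1%R[) (phi (x + s *: (P e z - x)) * s ^+ n * (t * A z))%:E =
   \int[mu]_(s in `]0%R, 1%R[) (radial_weight eps s *
     (kappa * t * A z * (s ^+ m * h (x + s *: (P e z - x)))))%:E)%E.
Proof.
move=> e1 zt; apply: eq_integral => s; rewrite inE/= in_itv/= => s01.
rewrite /phi ray_in_eball//; move: s01 => /andP[s0 s1].
congr (_%:E); rewrite (_ : t ^+ 2 - _ = (1 - s ^+ 2) * t ^+ 2); last by rewrite mulrBl mul1r.
rewrite powRM ?sqr_ge0//; last by rewrite subr_ge0 expr_le1// ltW.
(* One factor [s] of the Jacobian goes into the weight, since [n = m.+1]. *)
rewrite /radial_weight /kappa [s ^+ n]exprS.
by field.
Qed.

Let cphi y : eball x t y -> {for y, continuous phi}.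
Proof.
move=> /(eball_sqr _ _ t0) yt; apply: continuousM; first exact: ch.
apply: continuousM; first exact: cst_continuous.
apply: (@continuous_comp _ _ _ (fun y : 'rV[R]_n.+1 => t ^+ 2 - enorm (y - x) ^+ 2)
  (fun u : R => u `^ (eps - 1))).
  by apply: continuousB; [exact: cst_continuous|exact: continuous_enorm_sqr].
apply/differentiable_continuous/derivable1_diffP/derivable_powR.
by rewrite in_itv/= andbT subr_gt0.
Qed.

Let phi0 y : eball x t y -> 0 <= phi y.
Proof. by move=> _; rewrite !mulr_ge0 ?powR_ge0// ltW. Qed.

Let Aint : R := (\int[leb]_(z in eball c t) A z).
Let S e : R := (\int[leb]_(z in eball c t) (A z * h (P e z))).

Let EFin_A : (\int[leb]_(z in eball c t) (A z)%:E = Aint%:E)%E.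
Proof.
rewrite fineK// ge0_fin_numE; first exact: sphere_area_fin.
by apply: integral_ge0 => z _; rewrite lee_fin area_density_ge0.
Qed.

Lemma measurable_ray_factor e z : eball c t z ->
  measurable_fun (`]0%R, 1%R[%classic : set R) (fun s : R => s ^+ m * h (x + s *: (P e z - x))).
Proof.
move=> zt; have cs (s : R) : {for s, continuous (fun s : R => s ^+ m * h (x + s *: (P e z - x)))}.
  apply: continuousM; first exact: exprn_continuous.
  apply: (@continuous_comp _ _ _ (fun s : R => x + s *: (P e z - x)) h); last exact: ch.
  exact: continuous_ray.
by apply: open_continuous_measurable_fun => [|s _]; [exact: itv_open|exact: cs].
Qed.

Let err := eps / (eps + 1) * L.

(** The weight on a ray is a probability density, and replacing [h] inside by its
    value at the end of the ray costs at most [L * (1 - s ^+ 2)]. Two one-sided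
    inequalities, with the errors added on the larger side, keep all integrands
    nonnegative. *)
Let ray_bounds e (C : R) : e ^+ 2 = 1 -> (forall y, `|h y| <= C) ->
  (ray_integral x t e phi <= (kappa * t * (S e + err * Aint))%:E)%E /\
  ((kappa * t * S e)%:E <= ray_integral x t e phi + (kappa * t * (err * Aint))%:E)%E.
Proof.
move=> e1 hC.
have mB := measurable_eball c t0.
have kt0 : 0 <= kappa * t by rewrite mulr_ge0// ltW.
have err0 : 0 <= err by rewrite mulr_ge0// divr_ge0 ?ltW// addr_gt0.
have ktA0 z : 0 <= kappa * t * A z by rewrite mulr_ge0// area_density_ge0.
have EFin_S : (\int[leb]_(z in eball c t) (A z * h (P e z))%:E = (S e)%:E)%E.
  by rewrite fineK//; apply: integrable_fin_num => //; exact: (integrable_on_sphere _ hC).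
have mA : measurable_fun (eball c t) A.
  by apply: measurable_funTS; exact: measurable_area_density.
have mAh : measurable_fun (eball c t) (fun z => A z * h (P e z)).
  by apply: measurable_funM => //; exact: measurable_on_sphere.
have ES : (\int[leb]_(z in eball c t) ((kappa * t)%:E * (A z * h (P e z))%:E) =
    (kappa * t * S e)%:E)%E.
  rewrite ge0_integralZl//; first by rewrite EFin_S.
  - exact/measurable_EFinP.
  - by move=> z _; rewrite lee_fin mulr_ge0// area_density_ge0.
have EA : (\int[leb]_(z in eball c t) ((kappa * t * err)%:E * (A z)%:E) =
    (kappa * t * (err * Aint))%:E)%E.
  rewrite ge0_integralZl//; first by rewrite EFin_A -EFinM mulrA.
  - exact/measurable_EFinP.
  - by move=> z _; rewrite lee_fin area_density_ge0.
  - by rewrite lee_fin mulr_ge0.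
have mJ := measurable_ray_inner t0 e1 cphi phi0.
have rw0 s : 0 < s < 1 -> 0 <= radial_weight eps s.
  by move=> /andP[/ltW s0 _]; exact: radial_weight_ge0.
have hpos z (s : R) : 0 < s -> 0 <= kappa * t * A z * (s ^+ m * h (x + s *: (P e z - x))).
  by move=> /ltW s0; apply: mulr_ge0 => //; apply: mulr_ge0 => //; exact: exprn_ge0.
have J0 z : eball c t z -> (0 <= \int[mu]_(s in `]0%R, 1%R[)
    (phi (x + s *: (P e z - x)) * s ^+ n * (t * A z))%:E)%E.
  move=> zt; rewrite ray_inner//; apply: integral_ge0 => s /=; rewrite in_itv/= => /andP[s0 s1].
  by rewrite lee_fin; apply: mulr_ge0; [rewrite rw0// s0|exact: hpos].
have rwE s : 0 < s < 1 -> eps / (eps + 1) * radial_weight (eps + 1) s =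
    radial_weight eps s * (1 - s ^+ 2).
  move=> /andP[s0 s1]; rewrite /radial_weight addrK.
  have u0 : 0 < 1 - s ^+ 2 by rewrite subr_gt0 expr_lt1// ltW.
  rewrite -[X in _ = _ * X](powRr1 (ltW u0)) -[RHS]mulrA -powRD; last first.
    by apply/implyP => _; rewrite gt_eqF.
  by rewrite subrK; field; rewrite gt_eqF// addr_gt0.
have eps10 : 0 < eps + 1 by rewrite addr_gt0.
have mI z : eball c t z -> measurable_fun (`]0%R, 1%R[%classic : set R) (fun s : R => (radial_weight eps s *
    (kappa * t * A z * (s ^+ m * h (x + s *: (P e z - x)))))%:E).
  move=> zt; apply/measurable_EFinP/measurable_funM; first exact: measurable_radial_weight.
  by apply: measurable_funM => //; exact: measurable_ray_factor.
have I0 z s : eball c t z -> (`]0%R, 1%R[%classic : set R) s -> (0 <= (radial_weight eps s *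
    (kappa * t * A z * (s ^+ m * h (x + s *: (P e z - x)))))%:E)%E.
  move=> zt /=; rewrite in_itv/= => s01; rewrite lee_fin; apply: mulr_ge0; first exact: rw0.
  by move: s01 => /andP[s0 _]; exact: hpos.
have mW p q : measurable_fun (`]0%R, 1%R[%classic : set R) (fun s : R =>
    (radial_weight eps s * p + eps / (eps + 1) * radial_weight (eps + 1) s * q)%:E).
  apply/measurable_EFinP; apply: measurable_funD.
    by apply: measurable_funM => //; exact: measurable_radial_weight.
  do 2 apply: measurable_funM => //; exact: measurable_radial_weight.
have hAz z : (0 <= (kappa * t)%:E * (A z * h (P e z))%:E)%E.
  by rewrite -EFinM lee_fin mulrA; apply: mulr_ge0.
have hz1 z : 0 <= kappa * t * A z * h (P e z) by exact: mulr_ge0.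
have hz2 z : 0 <= kappa * t * A z * L by exact: mulr_ge0.
have hAe z : (0 <= (kappa * t * err)%:E * (A z)%:E)%E.
  rewrite -EFinM lee_fin; apply: mulr_ge0; first exact: mulr_ge0.
  exact: area_density_ge0.
split.
- rewrite mulrDr EFinD -ES -EA -ge0_integralD//; last 2 first.
  + by apply/measurable_EFinP; exact: measurable_funM.
  + by apply/measurable_EFinP; exact: measurable_funM.
  apply: ge0_le_integral => //.
  + apply: emeasurable_funD; apply/measurable_EFinP; exact: measurable_funM.
  move=> z zt; rewrite ray_inner// -!EFinM -EFinD.
  rewrite (_ : _ + _ = kappa * t * A z * h (P e z) + eps / (eps + 1) * (kappa * t * A z * L)); last first.
    by rewrite /err; ring.
  rewrite -integral_radial_weights//.
  apply: ge0_le_integral => //.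
  + by move=> s; exact: I0.
  + exact: mI.
  + exact: mW.
  move=> s /=; rewrite in_itv/= => s01; rewrite lee_fin rwE//.
  rewrite -[X in _ <= _ + X]mulrA -mulrDr ler_wpM2l ?rw0//.
  rewrite (mulrCA (1 - _)) -mulrDr ler_wpM2l// [_ * L]mulrC.
  by have := Lh e1 zt s01; rewrite ler_norml => /andP[_]; rewrite lerBlDl.
- rewrite -ES -EA -ge0_integralD//; last first.
  + by apply/measurable_EFinP; exact: measurable_funM.
  apply: ge0_le_integral => //.
  + by apply/measurable_EFinP; exact: measurable_funM.
  + by apply: emeasurable_funD => //; apply/measurable_EFinP; exact: measurable_funM.
  move=> z zt; rewrite ray_inner// -!EFinM.
  rewrite (_ : kappa * t * (A z * _) = kappa * t * A z * h (P e z) + eps / (eps + 1) * 0); last first.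
    by ring.
  rewrite (_ : kappa * t * err * A z = 0 + eps / (eps + 1) * (kappa * t * A z * L)); last first.
    by rewrite /err; ring.
  rewrite -!integral_radial_weights//.
  rewrite -ge0_integralD//; last 4 first.
  + by move=> s; exact: I0.
  + exact: mI.
  + move=> s /=; rewrite in_itv/= => s01; rewrite lee_fin rwE// mulr0 add0r; apply: mulr_ge0 => //.
    apply: mulr_ge0; first exact: rw0.
    by move: s01 => /andP[s0 s1]; rewrite subr_ge0 expr_le1// ltW.
  + exact: mW.
  apply: ge0_le_integral => //.
  + move=> s /=; rewrite in_itv/= => s01; rewrite lee_fin mulr0 addr0; apply: mulr_ge0 => //; exact: rw0.
  + exact: mW.
  + by apply: emeasurable_funD; [exact: mI|exact: mW].
  move=> s /=; rewrite in_itv/= => s01; rewrite -EFinD lee_fin !mulr0 addr0 add0r rwE//.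
  rewrite -[X in _ <= _ + X]mulrA -mulrDr ler_wpM2l ?rw0//.
  rewrite (mulrCA (1 - _)) -mulrDr ler_wpM2l// [_ * L]mulrC.
  have := Lh e1 zt s01; rewrite ler_norml => /andP[+ _].
  by rewrite lerBrDr addrC lerBlDr.
Qed.

Lemma concentration_bound (C : R) : (forall y, `|h y| <= C) ->
  (lebesgue_rV R n.+1).-integrable (eball x t) (EFin \o phi) /\
  `|\int[lebesgue_rV R n.+1]_(y in eball x t) phi y - kappa * t * (S 1 + S (-1))|
    <= kappa * t * (eps * (L * Aint)) *+ 2.
Proof.
move=> hC.
have [u1 l1] := ray_bounds (expr1n _ 2) hC.
have [u2 l2] := @ray_bounds (-1) _ (etrans (sqrrN 1) (expr1n _ 2)) hC.
have E := polar_formula t0 cphi phi0.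
have kt0 : 0 <= kappa * t by rewrite mulr_ge0// ltW.
have fin e (B : R) : (ray_integral x t e phi <= B%:E)%E -> e ^+ 2 = 1 ->
    ray_integral x t e phi \is a fin_num.
  move=> rB e1; rewrite ge0_fin_numE; first by rewrite (le_lt_trans rB)// ltry.
  apply: integral_ge0 => z zt; apply: integral_ge0 => s /=; rewrite in_itv/= => s01.
  have y_in : eball x t (x + s *: (sphere_point x t e z - x)).
    apply/(eball_sqr _ _ t0); rewrite ray_in_eball//.
    move: s01 => /andP[s0 s1]; rewrite gtr_pMl ?exprn_gt0//.
    by rewrite expr_lt1// ltW.
  move: s01 => /andP[/ltW s0 _]; rewrite lee_fin mulr_ge0//.
    by rewrite mulr_ge0 ?exprn_ge0// phi0.
  by rewrite mulr_ge0 ?area_density_ge0// ltW.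
have f1 := fin _ _ u1 (expr1n _ 2).
have f2 := fin _ _ u2 (etrans (sqrrN 1) (expr1n _ 2)).
have errE : err <= eps * L.
  rewrite /err ler_wpM2r// ler_pdivrMr ?addr_gt0// ler_peMr ?ltW//.
  by rewrite ltrDr.
have A0 : 0 <= Aint by apply: Rintegral_ge0 => z _; exact: area_density_ge0.
have kerr : kappa * t * (err * Aint) <= kappa * t * (eps * (L * Aint)).
  by rewrite ler_wpM2l// mulrA ler_wpM2r.
have mphi : measurable_fun (eball x t) phi.
  by apply: continuous_measurable_rV; [exact: open_eball|exact: cphi].
split.
  apply/integrableP; split; first exact/measurable_EFinP.
  rewrite (eq_integral (fun y => (phi y)%:E)); last first.
    by move=> y; rewrite inE => yB; rewrite /= ger0_norm// phi0.
  by rewrite E -(fineK f1) -(fineK f2) -EFinD ltry.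
have [a1 a1E] : exists a, ray_integral x t 1 phi = a%:E.
  by exists (fine (ray_integral x t 1 phi)); exact: (esym (fineK f1)).
have [a2 a2E] : exists a, ray_integral x t (-1) phi = a%:E.
  by exists (fine (ray_integral x t (-1) phi)); exact: (esym (fineK f2)).
have -> : \int[lebesgue_rV R n.+1]_(y in eball x t) phi y = a1 + a2.
  by rewrite /Rintegral E a1E a2E.
rewrite a1E -?EFinD !lee_fin in u1 l1; rewrite a2E -?EFinD !lee_fin in u2 l2.
rewrite mulrDr in u1; rewrite mulrDr in u2; rewrite mulrDr.
move: u1 l1 u2 l2 kerr.
move: (kappa * t * S 1) (kappa * t * S (-1)) (kappa * t * (err * Aint)).
move: (kappa * t * (eps * (L * Aint))) => Y S1 S2 X u1 l1 u2 l2 kerr.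
by rewrite ler_norml mulr2n; apply/andP; split; lra.
Qed.

End concentration.

Section concentration_limit.
Context {R : realType} {m : nat}.
Let n := m.+1.
Notation leb := (lebesgue_rV R n).
Variables (x : 'rV[R]_n.+1) (t : R).
Hypothesis t0 : 0 < t.
Let c := behead_rV x.
Let P e z := sphere_point x t e z.
Let A := area_density x t.

(** [sphere_integral] for real data. *)
Definition surface_integral (h : 'rV[R]_n.+1 -> R) : R :=
  \int[leb]_(z in eball c t) (A z * h (P 1 z)) +
  \int[leb]_(z in eball c t) (A z * h (P (-1) z)).

Lemma surface_integralDC (h : 'rV[R]_n.+1 -> R) (C K : R) : continuous h ->
  (forall y, `|h y| <= C) ->
  surface_integral (fun y => h y + K) = surface_integral h + surface_integral (cst K).
Proof.
move=> ch hC; have mB := measurable_eball c t0.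
have E e : \int[leb]_(z in eball c t) (A z * (h (P e z) + K)) =
    \int[leb]_(z in eball c t) (A z * h (P e z)) + \int[leb]_(z in eball c t) (A z * K).
  rewrite -RintegralD//.
  - by apply: eq_Rintegral => z _; rewrite mulrDr.
  - exact: (integrable_on_sphere x t0 ch e hC).
  - apply: (@integrable_on_sphere _ _ x _ t0 (cst K) _ e `|K|) => //.
    by move=> y; exact: cst_continuous.
by rewrite /surface_integral !E addrACA.
Qed.

Section lipschitz.
Variables (h : 'rV[R]_n.+1 -> R) (C : R).
Hypothesis dh : forall y, differentiable h y.
Hypothesis hC : forall y, `|h y| <= C.
Hypothesis dhC : forall i y, `|'D_(delta_mx 0 i) h y| <= C.

Let C0 : 0 <= C. Proof. exact: le_trans (hC 0). Qed.

Lemma ray_derivative_bound e z y : e ^+ 2 = 1 -> eball c t z ->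
  `|\sum_i (P e z - x) 0 i * 'D_(delta_mx 0 i) h y| <= n.+1%:R * t * C.
Proof.
move=> e1 zt; apply: (le_trans (ler_norm_sum _ _ _)).
apply: (@le_trans _ _ (\sum_(i < n.+1) t * C)); last first.
  by rewrite sumr_const card_ord -[leLHS]mulr_natl mulrA.
apply: ler_sum => i _; rewrite normrM ler_pM//.
rewrite (le_trans (coord_le_enorm _ _))//.
rewrite -ler_sqr ?nnegrE ?enorm_ge0 ?(ltW t0)//.
by rewrite enorm_sphere_point.
Qed.

(** The mean value theorem along the ray, and [1 - s <= 1 - s ^+ 2]. *)
Lemma ray_lipschitz e z s : e ^+ 2 = 1 -> eball c t z -> 0 < s < 1 ->
  `|s ^+ m * h (x + s *: (P e z - x)) - h (P e z)| <=
  (m%:R + n.+1%:R * t) * C * (1 - s ^+ 2).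
Proof.
move=> e1 zt /andP[s0 s1].
pose v := P e z - x.
pose k (s : R) := s ^+ m * h (x + s *: v).
pose k' (s : R) := s ^+ m * (\sum_i v 0 i * 'D_(delta_mx 0 i) h (x + s *: v)) +
  h (x + s *: v) * (m%:R * s ^+ m.-1).
have dk (r : R) : is_derive r 1 k (k' r).
  have d1 := is_derive_ray dh x v r.
  have d2 : is_derive r 1 (fun s : R => s ^+ m) (m%:R * r ^+ m.-1).
    apply: DeriveDef; first exact: exprn_derivable.
    by rewrite exp_derive; exact: mulr1.
  exact: (is_deriveM d2 d1).
have [|r /[!in_itv]/= /andP[sr r1] E] := @MVT R k k' s 1 s1 (fun r _ => dk r).
  apply: continuous_in_subspaceT => r _.
  by apply/differentiable_continuous/derivable1_diffP; have [] := dk r.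
have -> : s ^+ m * h (x + s *: (P e z - x)) - h (P e z) = - (k 1 - k s).
  by rewrite /k expr1n mul1r scale1r /v [x + (P e z - x)]addrC subrK opprB.
rewrite normrN E normrM [`|1 - s|]ger0_norm ?subr_ge0 ?(ltW s1)//.
apply: ler_pM => //; [by rewrite subr_ge0 ltW| |]; last first.
  by rewrite lerB// expr2 ler_piMl// ltW.
have r0 : 0 <= r by rewrite ltW// (lt_trans s0).
rewrite addrC mulrDl (le_trans (ler_normD _ _))// lerD//.
  rewrite normrM ger0_norm ?exprn_ge0//.
  rewrite -[leRHS]mul1r ler_pM ?exprn_ge0//.
    by rewrite exprn_ile1// ltW.
  exact: ray_derivative_bound.
rewrite normrM [leRHS]mulrC ler_pM// ger0_norm ?mulr_ge0 ?exprn_ge0//.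
by rewrite ler_piMr// exprn_ile1// ltW.
Qed.

End lipschitz.

Let u (y : 'rV[R]_n.+1) := t ^+ 2 - enorm (y - x) ^+ 2.
Let leb' := lebesgue_rV R n.+1.

Variables (h : 'rV[R]_n.+1 -> R) (C : R).
Hypothesis dh : forall y, differentiable h y.
Hypothesis hC : forall y, `|h y| <= C.
Hypothesis dhC : forall i y, `|'D_(delta_mx 0 i) h y| <= C.

Let C0 : 0 <= C. Proof. exact: le_trans (hC 0). Qed.

(** Adding the constant [C] makes [h] nonnegative; both sides are affine. *)
Lemma concentration_signed : exists2 K, 0 <= K & forall eps, 0 < eps ->
  leb'.-integrable (eball x t) (fun y => (h y * (eps * u y `^ (eps - 1)))%:E) /\
  `|\int[leb']_(y in eball x t) (h y * (eps * u y `^ (eps - 1))) -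
    (t ^+ 2) `^ (eps - 1) / 2 * t * surface_integral h| <=
  (t ^+ 2) `^ (eps - 1) / 2 * t * (eps * K).
Proof.
pose L := (m%:R + n.+1%:R * t) * (C + C).
have L0 : 0 <= L by rewrite mulr_ge0 ?addr_ge0// mulr_ge0// ltW.
pose Aint := \int[leb]_(z in eball c t) A z.
have A0 : 0 <= Aint by apply: Rintegral_ge0 => z _; exact: area_density_ge0.
exists (L * Aint *+ 4); first by rewrite mulrn_wge0// mulr_ge0.
move=> eps eps0.
have ch : continuous h by move=> y; exact: differentiable_continuous.
have main (k : 'rV[R]_n.+1 -> R) : (forall y, differentiable k y) -> (forall y, 0 <= k y) ->
    (forall y, `|k y| <= C + C) ->
    (forall i y, `|'D_(delta_mx 0 i) k y| <= C + C) ->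
  leb'.-integrable (eball x t) (EFin \o (fun y => k y * (eps * u y `^ (eps - 1)))) /\
  `|\int[leb']_(y in eball x t) (k y * (eps * u y `^ (eps - 1))) -
    (t ^+ 2) `^ (eps - 1) / 2 * t * surface_integral k| <=
  (t ^+ 2) `^ (eps - 1) / 2 * t * (eps * (L * Aint)) *+ 2.
  move=> dk k0 kC dkC; apply: concentration_bound => //.
  - by move=> y; exact: differentiable_continuous.
  - by move=> e z s e1 zt s01; exact: ray_lipschitz.
have dcst y : differentiable (cst C : 'rV[R]_n.+1 -> R) y by exact: differentiable_cst.
have [i1 b1] := main (cst C) dcst (fun=> C0)
  (fun=> ltac:(by rewrite ger0_norm// lerDl))
  (fun i y => ltac:(by rewrite derive_cst normr0 addr_ge0)).
have dhk y : differentiable (fun y => h y + C) y by exact: differentiableD.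
have [||||i2 b2] := main (fun y => h y + C).
- by [].
- by move=> y; have := hC y; rewrite ler_norml => /andP[+ _]; rewrite -lerBlDr sub0r.
- by move=> y; rewrite (le_trans (ler_normD _ _))// lerD// ger0_norm.
- move=> i y; rewrite (_ : (fun y => _) = h + cst C)//.
  rewrite deriveD//; [|exact: diff_derivable..].
  by rewrite derive_cst addr0 (le_trans (dhC i y))// lerDl.
have E y : h y * (eps * u y `^ (eps - 1)) =
  (h y + C) * (eps * u y `^ (eps - 1)) - C * (eps * u y `^ (eps - 1)).
  by rewrite -mulrBl addrK.
have mB := measurable_eball x t0.
split.
  apply: eq_integrable (integrableB _ i2 i1) => //.
  by move=> y _; rewrite /= E EFinB.
have arith (I I1 I2 S S1 S2 Y k : R) : I = I2 - I1 -> S2 = S + S1 ->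
    `|I1 - k * S1| <= Y *+ 2 -> `|I2 - k * S2| <= Y *+ 2 -> `|I - k * S| <= Y *+ 4.
  move=> -> ->; rewrite mulrDr => b1' b2'.
  rewrite (_ : I2 - I1 - k * S = (I2 - (k * S + k * S1)) - (I1 - k * S1)); last first.
    by rewrite !opprD opprK !addrA [RHS]addrAC subrK [LHS]addrAC.
  by rewrite (le_trans (ler_normB _ _))// (mulrnDr _ 2 2) lerD.
rewrite !mulrnAr; apply: (arith _ _ _ _ _ _ _ _ _ _ b1 b2).
  rewrite -(RintegralB mB i2 i1); apply: eq_Rintegral => y _; exact: E.
exact: (surface_integralDC C ch hC).
Qed.

(** As the weight reaches the edge of integrability, its mass grows like the
    inverse of [eps] and gathers on the sphere. *)
Lemma cvg_concentration :
  eps * \int[leb']_(y in eball x t) (h y / u y `^ (1 - eps)) @[eps --> 0^'+] -->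
  (2 * t)^-1 * surface_integral h.
Proof.
have [K K0 HK] := concentration_signed.
have E eps : 0 < eps -> eps * \int[leb']_(y in eball x t) (h y / u y `^ (1 - eps)) =
    \int[leb']_(y in eball x t) (h y * (eps * u y `^ (eps - 1))).
  move=> eps0; have [ie _] := HK _ eps0.
  have E' y : h y * (eps * u y `^ (eps - 1)) = eps * (h y / u y `^ (1 - eps)).
    by rewrite -powRN opprB mulrCA.
  rewrite -RintegralZl//; first by apply: eq_Rintegral => y _; rewrite E'.
    exact: measurable_eball.
  apply: eq_integrable (integrableZl (measurable_eball x t0) eps^-1 ie).
    exact: measurable_eball.
  by move=> y _; rewrite /= E' -EFinM mulKf// gt_eqF.
have kc : (t ^+ 2) `^ (eps - 1) / 2 * t @[eps --> 0^'+] --> (2 * t)^-1.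
  have -> : (2 * t)^-1 = (t ^+ 2) `^ (0 - 1) / 2 * t.
    rewrite sub0r powRN powRr1 ?sqr_ge0//; field; rewrite gt_eqF//.
  apply: cvgM; last exact: cvg_cst.
  apply: cvgM; last exact: cvg_cst.
  apply: cvg_at_right_filter.
  have t20 : t ^+ 2 != 0 by rewrite expf_neq0// gt_eqF.
  under eq_fun do rewrite /powR (negbTE t20).
  rewrite /powR (negbTE t20).
  apply: continuous_cvg; first exact: continuous_expR.
  apply: cvgM; last exact: cvg_cst.
  by apply: cvgB; [exact: cvg_id|exact: cvg_cst].
have k1 : (t ^+ 2) `^ (eps - 1) / 2 * t * surface_integral h @[eps --> 0^'+] -->
    (2 * t)^-1 * surface_integral h.
  by apply: cvgM => //; exact: cvg_cst.
have k2 : (t ^+ 2) `^ (eps - 1) / 2 * t * (eps * K) @[eps --> 0^'+] --> (0 : R).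
  suff : (t ^+ 2) `^ (eps - 1) / 2 * t * (eps * K) @[eps --> 0^'+] -->
    (2 * t)^-1 * (0 * K) by rewrite mul0r mulr0.
  apply: cvgM => //; apply: cvgM; last exact: cvg_cst.
  by apply: cvg_at_right_filter; exact: cvg_id.
apply: (@squeeze_cvgr _ _ _ _
  (fun eps => (t ^+ 2) `^ (eps - 1) / 2 * t * surface_integral h - (t ^+ 2) `^ (eps - 1) / 2 * t * (eps * K))
  (fun eps => (t ^+ 2) `^ (eps - 1) / 2 * t * surface_integral h + (t ^+ 2) `^ (eps - 1) / 2 * t * (eps * K))).
- near=> eps; have eps0 : 0 < eps by near: eps; exact: nbhs_right_gt.
  by rewrite E//; have [_] := HK _ eps0; rewrite ler_distl.
- by rewrite -[X in _ --> X]subr0; apply: cvgB.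
- by rewrite -[X in _ --> X]addr0; apply: cvgD.
Unshelve. all: by end_near. Qed.

End concentration_limit.

(** * The divergence theorem in a ball *)

Section flux.
Context {R : realType} {m : nat}.
Let n := m.+1.
Notation mu := (@lebesgue_measure R).
Notation leb := (lebesgue_rV R n).
Variables (x : 'rV[R]_n.+1) (t : R).
Hypothesis t0 : 0 < t.
Let c := behead_rV x.
Let P e z := sphere_point x t e z.
Let A := area_density x t.
Let leb' := lebesgue_rV R n.+1.
Let mB : measurable (eball x t) := measurable_eball x t0.

(** The divergence of [h y *: (y - x)]. *)
Definition radial_divergence (h : 'rV[R]_n.+1 -> R) (y : 'rV[R]_n.+1) : R :=
  n.+1%:R * h y + \sum_i (y - x) 0 i * 'D_(delta_mx 0 i) h y.

Lemma coord_in_eball y i : eball x t y -> `|(y - x) 0 i| <= t.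
Proof. by move=> /ltW; apply: le_trans; exact: coord_le_enorm. Qed.

Lemma continuous_radial_divergence h : (forall y, differentiable h y) ->
  (forall i, continuous ('D_(delta_mx 0 i) h)) -> continuous (radial_divergence h).
Proof.
move=> dh cdh y; apply: (@continuousD _ _ _ (fun y => n.+1%:R * h y)
    (fun y : 'rV[R]_n.+1 => \sum_i (y - x) 0 i * 'D_(delta_mx 0 i) h y)).
  apply: continuousM; first exact: cst_continuous.
  exact: differentiable_continuous.
have : continuous (fun y : 'rV[R]_n.+1 => \sum_i (y - x) 0 i * 'D_(delta_mx 0 i) h y).
  apply: continuous_big => [|i _ z]; first exact: add_continuous.
  apply: (@continuousM _ _ (fun y : 'rV[R]_n.+1 => (y - x) 0 i)); last exact: cdh.
  rewrite (_ : (fun y : 'rV[R]_n.+1 => _) = fun y : 'rV[R]_n.+1 => y 0 i - x 0 i); last first.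
    by apply/funext => w; rewrite sub_rVE.
  apply: continuousB; last exact: cst_continuous.
  exact: coord_continuous.
exact.
Qed.

Lemma integrable_eball (psi : 'rV[R]_n.+1 -> R) (M : R) : continuous psi ->
  (forall y, eball x t y -> `|psi y| <= M) ->
  leb'.-integrable (eball x t) (EFin \o psi).
Proof.
move=> cpsi psiM; apply: measurable_bounded_integrable => //.
- exact: lebesgue_rV_eball.
- by apply: continuous_measurable_rV => [|y _]; [exact: open_eball|exact: cpsi].
- exists M; split; first exact: num_real.
  by move=> r Mr y yB; apply: (le_trans (psiM _ yB)); exact: ltW.
Qed.

Lemma continuous_ray_divergence (h : 'rV[R]_n.+1 -> R) (v : 'rV[R]_n.+1) :
  (forall y, differentiable h y) -> (forall i, continuous ('D_(delta_mx 0 i) h)) ->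
  continuous (fun r : R => radial_divergence h (x + r *: v) * r ^+ n : R).
Proof.
move=> dh cdh r.
suff : {for r, continuous (fun r : R => radial_divergence h (x + r *: v) * r ^+ n)} by [].
apply: continuousM; last exact: exprn_continuous.
apply: (@continuous_comp _ _ _ (fun s : R => x + s *: v) (radial_divergence h)).
  exact: continuous_ray.
exact: continuous_radial_divergence.
Qed.

(** On a ray, the divergence times the polar Jacobian is the derivative of
    [s ^+ n.+1 * h (x + s *: v)]. *)
Lemma integral_ray_divergence (h : 'rV[R]_n.+1 -> R) (v : 'rV[R]_n.+1) :
  (forall y, differentiable h y) -> (forall i, continuous ('D_(delta_mx 0 i) h)) ->
  (\int[mu]_(s in `]0%R, 1%R[) (radial_divergence h (x + s *: v) * s ^+ n)%:E = (h (x + v))%:E)%E.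
Proof.
move=> dh cdh.
pose F (s : R) := s ^+ n.+1 * h (x + s *: v).
have dF (r : R) : is_derive r 1 F (radial_divergence h (x + r *: v) * r ^+ n).
  have d1 := is_derive_ray dh x v r.
  have d2 : is_derive r 1 (fun s : R => s ^+ n.+1) (n.+1%:R * r ^+ n).
    apply: DeriveDef; first exact: exprn_derivable.
    by rewrite exp_derive; exact: mulr1.
  apply: is_derive_eq (is_deriveM d2 d1) _.
  rewrite -[LHS]/(r ^+ n.+1 * (\sum_i v 0 i * 'D_(delta_mx 0 i) h (x + r *: v)) +
    h (x + r *: v) * (n.+1%:R * r ^+ n)).
  rewrite /radial_divergence [LHS]addrC [RHS]mulrDl; congr (_ + _).
    by rewrite mulrCA mulrA.
  rewrite mulr_sumr mulr_suml; apply: eq_bigr => i _.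
  by rewrite [x + _]addrC addrK [(r *: v) 0 i]mxE exprS; ring.
have cF' := continuous_ray_divergence dh cdh (v := v).
have cF : continuous F.
  by move=> r; apply/differentiable_continuous/derivable1_diffP; have [] := dF r.
transitivity (\int[mu]_(s in `[0%R, 1%R]) (radial_divergence h (x + s *: v) * s ^+ n)%:E)%E.
  rewrite [RHS]integral_itv_bndoo//; apply/measurable_EFinP.
  by apply: measurable_funTS; exact: continuous_measurable_fun.
rewrite (continuous_FTC2 (F := F))//.
- by rewrite /F expr1n mul1r scale1r expr0n mul0r sube0.
- exact: continuous_subspaceT.
- split.
  + by move=> r _; have [] := dF r.
  + by apply: cvg_at_right_filter; exact: cF.
  + by apply: cvg_at_left_filter; exact: cF.
- by move=> r _; rewrite derive1E; have [_ ->] := dF r.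
Qed.

Let flux_ge0 (k : 'rV[R]_n.+1 -> R) (C : R) : (forall y, differentiable k y) ->
  (forall i, continuous ('D_(delta_mx 0 i) k)) ->
  (forall y, 0 <= k y) -> (forall y, `|k y| <= C) ->
  (forall y, eball x t y -> 0 <= radial_divergence k y) ->
  \int[leb']_(y in eball x t) radial_divergence k y = t * surface_integral x t k.
Proof.
move=> dk cdk k0 kC div0.
have ck : continuous k by move=> y; exact: differentiable_continuous.
have cdiv : continuous (radial_divergence k) by exact: continuous_radial_divergence.
have mBc := measurable_eball c t0.
have P0 (s : R) : 0 < s < 1 -> forall e z, e ^+ 2 = 1 -> eball c t z ->
    0 <= radial_divergence k (x + s *: (P e z - x)).
  move=> s01 e z e1 zt; apply: div0; apply/(eball_sqr _ _ t0); rewrite ray_in_eball//.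
  move: s01 => /andP[s0 s1]; rewrite gtr_pMl ?exprn_gt0//.
  by rewrite expr_lt1// ltW.
have E e : e ^+ 2 = 1 -> ray_integral x t e (radial_divergence k) =
    (t * \int[leb]_(z in eball c t) (A z * k (P e z)))%:E.
  move=> e1; have ie := integrable_on_sphere x t0 ck e kC.
  rewrite -RintegralZl// /Rintegral fineK; last first.
    apply: integrable_fin_num => //; under eq_fun do rewrite EFinM.
    exact: integrableZl.
  apply: eq_integral => z; rewrite inE => zt.
  transitivity ((\int[mu]_(s in `]0%R, 1%R[)
      (radial_divergence k (x + s *: (P e z - x)) * s ^+ n)%:E) * (t * A z)%:E)%E.
    rewrite -ge0_integralZr//.
    - apply/measurable_EFinP/measurable_funTS; apply: continuous_measurable_fun.
      exact: continuous_ray_divergence.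
    - move=> s /=; rewrite in_itv/= => s01; rewrite lee_fin mulr_ge0 ?P0//.
      by rewrite exprn_ge0//; move: s01 => /andP[/ltW].
    - by rewrite lee_fin mulr_ge0 ?area_density_ge0// ltW.
  rewrite integral_ray_divergence// -EFinM [x + _]addrC subrK.
  by congr _%:E; rewrite mulrC mulrA.
have := polar_formula t0 (fun y _ => cdiv y) div0.
rewrite (E 1 (expr1n _ 2)) (E (-1) (etrans (sqrrN 1) (expr1n _ 2))) -EFinD -mulrDr => Epol.
by rewrite /Rintegral Epol.
Qed.

Variables (h : 'rV[R]_n.+1 -> R) (C : R).
Hypothesis dh : forall y, differentiable h y.
Hypothesis cdh : forall i, continuous ('D_(delta_mx 0 i) h).
Hypothesis hC : forall y, `|h y| <= C.
Hypothesis dhC : forall i y, `|'D_(delta_mx 0 i) h y| <= C.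

Lemma radial_divergence_bound y : eball x t y ->
  `|radial_divergence h y| <= n.+1%:R * (C + t * C).
Proof.
move=> yB; rewrite /radial_divergence mulrDr (le_trans (ler_normD _ _))// lerD//.
  by rewrite normrM ger0_norm// ler_wpM2l.
apply: (le_trans (ler_norm_sum _ _ _)).
apply: (@le_trans _ _ (\sum_(i < n.+1) t * C)); last first.
  by rewrite sumr_const card_ord -[leLHS]mulr_natl.
by apply: ler_sum => i _; rewrite normrM ler_pM// coord_in_eball.
Qed.

(** The divergence theorem for [h y *: (y - x)]: along each ray the divergence
    integrates to the value of [h] at the end. *)
Lemma flux_identity :
  \int[leb']_(y in eball x t) radial_divergence h y = t * surface_integral x t h.
Proof.
have C0 : 0 <= C by exact: le_trans (hC 0).
(* The constant [K] makes [h + K] and the divergence of its field nonnegative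
   on the ball. *)
pose K := C + t * C.
have K0 : 0 <= K by rewrite addr_ge0// mulr_ge0// ltW.
have ch : continuous h by move=> y; exact: differentiable_continuous.
have dK y : differentiable (cst K : 'rV[R]_n.+1 -> R) y by exact: differentiable_cst.
have DK i y : 'D_(delta_mx 0 i) (cst K : 'rV[R]_n.+1 -> R) y = 0 by exact: derive_cst.
have divK y : radial_divergence (cst K) y = n.+1%:R * K.
  by rewrite /radial_divergence big1 ?addr0// => i _; rewrite DK mulr0.
pose hK (y : 'rV[R]_n.+1) := h y + K.
have dhK y : differentiable hK y by exact: differentiableD.
have DhK i y : 'D_(delta_mx 0 i) hK y = 'D_(delta_mx 0 i) h y.
  rewrite (_ : hK = h + cst K)//.
  by rewrite deriveD ?DK ?addr0//; exact: diff_derivable.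
have cDhK i : continuous ('D_(delta_mx 0 i) hK).
  by rewrite (_ : (fun _ => _) = 'D_(delta_mx 0 i) h)//; apply/funext => y; exact: DhK.
have cDK i : continuous ('D_(delta_mx 0 i) (cst K : 'rV[R]_n.+1 -> R)).
  rewrite (_ : (fun _ => _) = cst 0); last by apply/funext => y; exact: DK.
  by move=> y; exact: cst_continuous.
have divhK y : radial_divergence hK y = radial_divergence h y + n.+1%:R * K.
  rewrite /radial_divergence (eq_bigr (fun i => (y - x) 0 i * 'D_(delta_mx 0 i) h y)).
    by rewrite [X in X + _ = _]mulrDr addrAC.
  by move=> i _; rewrite DhK.
rewrite -[RHS](addrK (t * surface_integral x t (cst K))) -mulrDr -(surface_integralDC x t0 K ch hC) -/hK.
have KE : forall y, eball x t y -> 0 <= radial_divergence (cst K) y.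
  by move=> y _; rewrite divK mulr_ge0.
have hKE : forall y, eball x t y -> 0 <= radial_divergence hK y.
  move=> y yB; rewrite divhK; have := radial_divergence_bound yB.
  by rewrite ler_norml => /andP[+ _]; rewrite -subr_ge0 opprK.
rewrite -(@flux_ge0 (cst K) K)//; last first.
- by move=> y; rewrite ger0_norm.
rewrite -(@flux_ge0 hK (C + K))//; last 2 first.
- move=> y; have := hC y; rewrite ler_norml => /andP[+ _]; rewrite -subr_ge0 opprK => hy.
  by rewrite /hK (le_trans hy)// lerD2l /K lerDl mulr_ge0// ltW.
- by move=> y; rewrite (le_trans (ler_normD _ _))// lerD// ger0_norm.
rewrite -RintegralB//.
- by apply: eq_Rintegral => y _; rewrite divhK divK addrK.
- apply: (@integrable_eball _ (n.+1%:R * K + n.+1%:R * K)).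
    exact: continuous_radial_divergence.
  move=> y yB; rewrite divhK (le_trans (ler_normD _ _))// lerD ?radial_divergence_bound//.
  by rewrite ger0_norm// mulr_ge0.
- apply: (@integrable_eball _ (n.+1%:R * K)).
    exact: continuous_radial_divergence.
  by move=> y _; rewrite divK ger0_norm// mulr_ge0.
Qed.

End flux.

(** * Weights of vanishing exponent *)

Section weight_removal.
Context {R : realType} {m : nat}.
Let n := m.+1.
Notation mu := (@lebesgue_measure R).
Notation leb := (lebesgue_rV R n).
Variables (x : 'rV[R]_n.+1) (t : R).
Hypothesis t0 : 0 < t.
Let c := behead_rV x.
Let P e z := sphere_point x t e z.
Let A := area_density x t.
Let leb' := lebesgue_rV R n.+1.
Let mB : measurable (eball x t) := measurable_eball x t0.
Let u (y : 'rV[R]_n.+1) := t ^+ 2 - enorm (y - x) ^+ 2.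
Let Aint : R := \int[leb]_(z in eball c t) A z.

(** Divided by its value at the centre, its minimum, the weight exceeds [1] by a
    nonnegative quantity. *)
Definition weight_excess (eps : R) (y : 'rV[R]_n.+1) : R :=
  (t ^+ 2) `^ eps / u y `^ eps - 1.

Section excess.
Variable eps : R.
Hypotheses (eps0 : 0 < eps) (eps1 : eps < 1).

Let u0 y : eball x t y -> 0 < u y.
Proof. by move=> /(eball_sqr _ _ t0); rewrite subr_gt0. Qed.

Let excess_ge0 y : eball x t y -> 0 <= weight_excess eps y.
Proof.
move=> yB; rewrite subr_ge0 ler_pdivlMr ?powR_gt0 ?u0// mul1r.
have ut : u y <= t ^+ 2 by rewrite gerBl sqr_ge0.
by apply: ge0_ler_powR; rewrite ?nnegrE ?sqr_ge0// ltW// u0.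
Qed.

Let cexcess y : eball x t y -> {for y, continuous (weight_excess eps)}.
Proof.
move=> yB; apply: continuousB; last exact: cst_continuous.
apply: continuousM; first exact: cst_continuous.
apply: continuousV; first by rewrite gt_eqF// powR_gt0// u0.
apply: (@continuous_comp _ _ _ u (fun v : R => v `^ eps)).
  by apply: continuousB; [exact: cst_continuous|exact: continuous_enorm_sqr].
apply/differentiable_continuous/derivable1_diffP/derivable_powR.
by rewrite in_itv/= andbT u0.
Qed.

Let ray_excess e z (s : R) : e ^+ 2 = 1 -> eball c t z -> 0 < s < 1 ->
  weight_excess eps (x + s *: (P e z - x)) = (1 - s ^+ 2) `^ (- eps) - 1.
Proof.
move=> e1 zt s01; rewrite /weight_excess /u ray_in_eball//; move: s01 => /andP[s0 s1].
have s2 : 0 < 1 - s ^+ 2 by rewrite subr_gt0 expr_lt1// ltW.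
rewrite (_ : t ^+ 2 - s ^+ 2 * t ^+ 2 = (1 - s ^+ 2) * t ^+ 2); last by rewrite mulrBl mul1r.
rewrite [((1 - _) * _) `^ _]powRM ?sqr_ge0//; last exact: ltW.
by rewrite invfM mulrC divfK ?powRN// gt_eqF// powR_gt0// exprn_gt0.
Qed.

Let delta : R := eps / (2 * (1 - eps)).

Let delta0 : 0 <= delta.
Proof. by rewrite divr_ge0 ?mulr_ge0 ?subr_ge0// ltW. Qed.

Let measurable_excess_unit : measurable_fun (`]0%R, 1%R[%classic : set R)
  (fun s : R => ((1 - s ^+ 2) `^ (- eps) - 1) * s).
Proof.
apply: measurable_funM => //; apply: measurable_funB => //; apply: measurable_funTS.
apply: (measurableT_comp (measurable_powR (- eps))).
by apply: measurable_funB => //; exact: measurable_funX.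
Qed.

Let excess_unit_ge0 (s : R) : 0 < s < 1 -> 0 <= ((1 - s ^+ 2) `^ (- eps) - 1) * s.
Proof.
move=> /andP[s0 s1]; have s2 : 0 < 1 - s ^+ 2 by rewrite subr_gt0 expr_lt1// ltW.
apply: mulr_ge0; last exact: ltW.
rewrite subr_ge0 -[leLHS](powRr0 (1 - s ^+ 2)); apply: ger_powR.
  by rewrite s2/= gerBl sqr_ge0.
by rewrite oppr_le0 ltW.
Qed.

(** Adding back the integral of [s] leaves a multiple of the total mass of
    [radial_weight (1 - eps)]. *)
Let integral_excess_unit :
  (\int[mu]_(s in `]0%R, 1%R[) (((1 - s ^+ 2) `^ (- eps) - 1) * s)%:E = delta%:E)%E.
Proof.
have a0 : 0 < 1 - eps by rewrite subr_gt0.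
set X := (\int[mu]_(s in _) _)%E.
have : (X + \int[mu]_(s in `]0%R, 1%R[) (s ^+ 1)%:E = ((2 * (1 - eps))^-1)%:E)%E.
  rewrite -ge0_integralD//.
  - rewrite -[RHS]mul1e -(integral_radial_weight a0) -ge0_integralZr//.
    + apply: eq_integral => s _; rewrite -EFinD -EFinM; congr _%:E.
      rewrite (_ : 1 - eps - 1 = - eps); last by rewrite addrAC subrr add0r.
      by field; rewrite gt_eqF.
    + by apply/measurable_EFinP; exact: (measurable_radial_weight (1 - eps)).
    + move=> s /=; rewrite in_itv/= => /andP[/ltW s0 _].
      by rewrite lee_fin (radial_weight_ge0 a0).
    + by rewrite lee_fin invr_ge0 mulr_ge0// ltW.
  - by apply/measurable_EFinP.
  - by move=> s /=; rewrite in_itv/= => /andP[s0 _]; rewrite lee_fin expr1 ltW.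
  - by apply/measurable_EFinP/measurable_funTS; exact: measurable_funX.
rewrite integral_exprn_unit; case: X => [r||]//= [] E; congr _%:E.
rewrite -[r](addrK (2%:R^-1)) E /delta; field; rewrite gt_eqF//.
Qed.

Let ray_integral_excess e : e ^+ 2 = 1 ->
  (ray_integral x t e (weight_excess eps) <= (t * delta * Aint)%:E)%E.
Proof.
move=> e1; have mBc := measurable_eball c t0.
have EA : (\int[leb]_(z in eball c t) ((t * delta)%:E * (A z)%:E) = (t * delta * Aint)%:E)%E.
  rewrite ge0_integralZl//.
  - rewrite [RHS]EFinM /Aint /Rintegral fineK// ge0_fin_numE; first exact: sphere_area_fin.
    by apply: integral_ge0 => z _; rewrite lee_fin area_density_ge0.
  - by apply/measurable_EFinP/measurable_funTS; exact: measurable_area_density.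
  - by move=> z _; rewrite lee_fin area_density_ge0.
  - by rewrite lee_fin mulr_ge0// ltW.
have tA0 z : 0 <= t * A z by apply: mulr_ge0; [exact: ltW|exact: area_density_ge0].
rewrite -EA; apply: ge0_le_integral => //.
- move=> z zt; apply: integral_ge0 => s /=; rewrite in_itv/= => s01.
  rewrite lee_fin ray_excess//; apply: mulr_ge0 => //.
  rewrite [s ^+ n]exprS mulrA; apply: mulr_ge0; first exact: excess_unit_ge0.
  by rewrite exprn_ge0//; move: s01 => /andP[/ltW].
- exact: (measurable_ray_inner t0 e1 cexcess excess_ge0).
- apply: emeasurable_funM => //; apply/measurable_EFinP/measurable_funTS.
  exact: measurable_area_density.
move=> z zt.
rewrite (_ : (t * delta)%:E * (A z)%:E = delta%:E * (t * A z)%:E)%E; last first.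
  by rewrite -!EFinM; congr _%:E; rewrite [RHS]mulrCA [RHS]mulrA.
rewrite -integral_excess_unit -ge0_integralZr//; last 2 first.
- by apply/measurable_EFinP.
- by rewrite lee_fin.
apply: ge0_le_integral => //.
- move=> s /=; rewrite in_itv/= => s01; rewrite lee_fin ray_excess//; apply: mulr_ge0 => //.
  rewrite [s ^+ n]exprS mulrA; apply: mulr_ge0; first exact: excess_unit_ge0.
  by rewrite exprn_ge0//; move: s01 => /andP[/ltW].
- apply: (eq_measurable_fun (fun s : R => (((1 - s ^+ 2) `^ (- eps) - 1) * s * s ^+ m * (t * A z))%:E)).
    by move=> s; rewrite inE/= in_itv/= => s01; rewrite ray_excess// [s ^+ n]exprS [_ * (s * s ^+ m)]mulrA.
  apply/measurable_EFinP; do 2 apply: measurable_funM => //.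
- by apply: emeasurable_funM => //; apply/measurable_EFinP.
move=> s /=; rewrite in_itv/= => s01; rewrite -EFinM lee_fin ray_excess// ler_wpM2r//.
rewrite [s ^+ n]exprS mulrA ler_piMr ?excess_unit_ge0//.
by move: s01 => /andP[/ltW s0 /ltW s1]; rewrite exprn_ile1.
Qed.

Lemma weight_excess_bound : leb'.-integrable (eball x t) (EFin \o weight_excess eps) /\
  \int[leb']_(y in eball x t) weight_excess eps y <= delta * (t * Aint *+ 2).
Proof.
have E := polar_formula t0 cexcess excess_ge0.
have le2 : (\int[leb']_(y in eball x t) (weight_excess eps y)%:E <= (delta * (t * Aint *+ 2))%:E)%E.
  rewrite E; apply: (le_trans (leeD (ray_integral_excess (expr1n _ 2))
    (@ray_integral_excess (-1) (etrans (sqrrN 1) (expr1n _ 2))))).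
  have -> : delta * (t * Aint *+ 2) = t * delta * Aint + t * delta * Aint.
    by rewrite mulrnAr mulr2n [delta * (t * Aint)]mulrCA [t * (delta * Aint)]mulrA.
  by rewrite -EFinD.
have ge2 : (0 <= \int[leb']_(y in eball x t) (weight_excess eps y)%:E)%E.
  by apply: integral_ge0 => y yB; rewrite lee_fin excess_ge0.
split; last by rewrite -lee_fin /Rintegral fineK// ge0_fin_numE// (le_lt_trans le2)// ltry.
apply/integrableP; split.
  by apply/measurable_EFinP; apply: continuous_measurable_rV; [exact: open_eball|exact: cexcess].
rewrite (eq_integral (fun y => (weight_excess eps y)%:E)).
  by rewrite (le_lt_trans le2)// ltry.
by move=> y; rewrite inE => yB; rewrite /= ger0_norm// excess_ge0.
Qed.

Lemma weight_excess_ge0 y : eball x t y -> 0 <= weight_excess eps y.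
Proof. exact: excess_ge0. Qed.

End excess.

Variables (psi : 'rV[R]_n.+1 -> R) (M : R).
Hypothesis cpsi : continuous psi.
Hypothesis psiM : forall y, eball x t y -> `|psi y| <= M.

Lemma weight_removal_bound (eps : R) : 0 < eps -> eps < 1 ->
  leb'.-integrable (eball x t) (fun y => (psi y / u y `^ eps)%:E) /\
  `|(t ^+ 2) `^ eps * \int[leb']_(y in eball x t) (psi y / u y `^ eps) -
    \int[leb']_(y in eball x t) psi y| <= M * (eps / (2 * (1 - eps)) * (t * Aint *+ 2)).
Proof.
move=> eps0 eps1; have [ie be] := weight_excess_bound eps0 eps1.
have ipsi := integrable_eball t0 cpsi psiM.
have M0 : 0 <= M.
  have xB : eball x t x.
    by apply/(eball_sqr _ _ t0); rewrite subrr enorm_sqr big1 ?exprn_gt0// => i _; rewrite mxE expr0n.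
  exact: le_trans (psiM xB).
have iM : leb'.-integrable (eball x t) (fun y => (M%:E * (weight_excess eps y)%:E)%E).
  exact: (integrableZl mB M ie).
have ipe : leb'.-integrable (eball x t) (EFin \o (fun y => psi y * weight_excess eps y)).
  apply: (le_integrable mB _ _ iM).
    apply/measurable_EFinP/measurable_funM; last by apply/measurable_EFinP; exact: (measurable_int _ ie).
    by apply: continuous_measurable_rV => [|y _]; [exact: open_eball|exact: cpsi].
  move=> y yB; have e0 := weight_excess_ge0 eps0 yB.
  by rewrite /= lee_fin !normrM ler_wpM2r// (le_trans (psiM yB))// ler_norm.
have t2 : (t ^+ 2) `^ eps != 0 by rewrite gt_eqF// powR_gt0// exprn_gt0.
have E y : psi y + psi y * weight_excess eps y = (t ^+ 2) `^ eps * (psi y / u y `^ eps).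
  by rewrite /weight_excess mulrBr mulr1 addrC subrK mulrCA.
have iD : leb'.-integrable (eball x t) (EFin \o (fun y => (t ^+ 2) `^ eps * (psi y / u y `^ eps))).
  apply: eq_integrable (integrableD mB ipsi ipe) => //.
  by move=> y _; rewrite /= -E EFinD.
have iu : leb'.-integrable (eball x t) (EFin \o (fun y => psi y / u y `^ eps)).
  apply: eq_integrable (integrableZl mB ((t ^+ 2) `^ eps)^-1 iD) => //.
  by move=> y _; rewrite /= -EFinM mulKf.
split => //.
rewrite -RintegralZl//.
rewrite (_ : \int[leb']_(y in eball x t) _ = \int[leb']_(y in eball x t) psi y +
    \int[leb']_(y in eball x t) (psi y * weight_excess eps y)); last first.
  by rewrite -RintegralD//; apply: eq_Rintegral => y _; rewrite E.
rewrite addrC addrA addNr add0r (le_trans (le_normr_Rintegral mB ipe))//.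
apply: (@le_trans _ _ (\int[leb']_(y in eball x t) (M * weight_excess eps y))).
  apply: le_Rintegral => //.
    exact: integrable_norm.
  move=> y yB; have e0 := weight_excess_ge0 eps0 yB.
  by rewrite normrM [`|weight_excess _ _|]ger0_norm// ler_wpM2r// psiM.
by rewrite RintegralZl// ler_wpM2l.
Qed.

(** The integral of the excess of the weight over [1] vanishes with [eps], hence
    so does the effect of the weight on a bounded function. *)
Lemma cvg_weight_removal :
  \int[leb']_(y in eball x t) (psi y / u y `^ eps) @[eps --> 0^'+] -->
  \int[leb']_(y in eball x t) psi y.
Proof.
have t20 : t ^+ 2 != 0 by rewrite expf_neq0// gt_eqF.
have cvgp : (t ^+ 2) `^ (- eps) @[eps --> 0^'+] --> (1 : R).
  suff : (t ^+ 2) `^ (- eps) @[eps --> 0^'+] --> expR (- (0 : R) * ln (t ^+ 2)).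
    by rewrite oppr0 mul0r expR0.
  apply: cvg_at_right_filter.
  under eq_fun do rewrite /powR (negbTE t20).
  apply: continuous_cvg; first exact: continuous_expR.
  by apply: cvgM; [apply: cvgN; exact: cvg_id|exact: cvg_cst].
pose B (eps : R) := M * (eps / (2 * (1 - eps)) * (t * Aint *+ 2)).
have cvgB0 : B eps @[eps --> 0^'+] --> (0 : R).
  suff : B eps @[eps --> 0^'+] --> M * (0 / (2 * (1 - 0)) * (t * Aint *+ 2)).
    by rewrite !mul0r mulr0.
  apply: cvg_at_right_filter; apply: cvgM; first exact: cvg_cst.
  apply: cvgM; last exact: cvg_cst.
  apply: cvgM; first exact: cvg_id.
  apply: cvgV; first by rewrite subr0 mulr1.
  apply: cvgM; first exact: cvg_cst.
  by apply: cvgB; [exact: cvg_cst|exact: cvg_id].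
pose I := \int[leb']_(y in eball x t) psi y.
pose J (eps : R) := \int[leb']_(y in eball x t) (psi y / u y `^ eps).
have cvgJ : (t ^+ 2) `^ eps * J eps @[eps --> 0^'+] --> I.
  apply: (@squeeze_cvgr _ _ _ _ (fun eps => I - B eps) (fun eps => I + B eps)).
  - near=> eps; have eps0 : 0 < eps by near: eps; exact: nbhs_right_gt.
    have eps1 : eps < 1 by near: eps; exact: nbhs_right_lt.
    by have [_] := weight_removal_bound eps0 eps1; rewrite ler_distl.
  - by rewrite -[X in _ --> X]subr0; apply: cvgB => //; exact: cvg_cst.
  - by rewrite -[X in _ --> X]addr0; apply: cvgD => //; exact: cvg_cst.
suff : J eps @[eps --> 0^'+] --> 1 * I by rewrite mul1r.
have -> : J = fun eps => (t ^+ 2) `^ (- eps) * ((t ^+ 2) `^ eps * J eps).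
  apply/funext => eps; rewrite powRN mulKf// gt_eqF// powR_gt0// exprn_gt0//.
exact: cvgM.
Unshelve. all: by end_near. Qed.

End weight_removal.

(** * Surface element and complex data *)

Local Open Scope complex_scope.

Section hemisphere_area.
Context {R : realType} {n : nat}.
Variables (x : 'rV[R]_n.+1) (t : R).
Hypothesis t0 : 0 < t.
Let c := behead_rV x.

Lemma enorm_sqrD_delta (w : 'rV[R]_n) i (s : R) :
  enorm (s *: delta_mx 0 i + w) ^+ 2 = enorm w ^+ 2 + 2 * s * w 0 i + s ^+ 2.
Proof.
rewrite !enorm_sqr (bigD1 i)//= [in RHS](bigD1 i)//=.
rewrite (eq_bigr (fun j => w 0 j ^+ 2)); last first.
  by move=> j ji; rewrite !mxE (negbTE ji) andbF mulr0 add0r.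
by rewrite !mxE !eqxx mulr1; ring.
Qed.

Lemma derive_hemisphere (e : R) z i : eball c t z ->
  'D_(delta_mx 0 i) (hemisphere e x t) z =
  - (e * (z - c) 0 i / Num.sqrt (t ^+ 2 - enorm (z - c) ^+ 2)).
Proof.
move=> /(eball_sqr _ _ t0) zt.
pose q (s : R) := t ^+ 2 - (enorm (z - c) ^+ 2 + 2 * s * (z - c) 0 i + s ^+ 2).
pose k (s : R) := x 0 0 + e * Num.sqrt (q s).
have q0 : 0 < q 0 by rewrite /q mulr0 mul0r expr0n/= !addr0 subr_gt0.
have dq : is_derive (0 : R) 1 q (- (2 * (z - c) 0 i)).
  apply: is_derive_eq; rewrite /GRing.scale/=; ring.
have dk : is_derive (0 : R) 1 k (- (e * (z - c) 0 i / Num.sqrt (q 0))).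
  have d1 := @is_derive1_comp R Num.sqrt q 0 _ _ (is_derive1_sqrt q0) dq.
  apply: is_derive_eq; rewrite /GRing.scale/=.
  by field; rewrite gt_eqF// sqrtr_gt0.
have [_ kE] := dk.
transitivity ('D_1 k 0); last first.
  by rewrite kE /q !(mulr0, mul0r) expr0n/= !addr0.
have hE s : hemisphere e x t (s *: delta_mx 0 i + z) = k (s *: (1 : R) + 0).
  rewrite /k /hemisphere -/c addr0 (_ : s *: (1 : R) = s); last exact: mulr1.
  by rewrite -addrA enorm_sqrD_delta.
have h0 : hemisphere e x t z = k 0.
  by rewrite /k /hemisphere -/c /q !(mulr0, mul0r) expr0n/= !addr0.
have E : (fun s : R => s^-1 *: (hemisphere e x t (s *: delta_mx 0 i + z) - hemisphere e x t z)) =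
    (fun s : R => s^-1 *: (k (s *: (1 : R) + 0) - k 0)).
  by apply/funext => s; rewrite hE h0.
by rewrite /derive/= E.
Qed.

Lemma area_elementE (e : R) z : e ^+ 2 = 1 -> eball c t z ->
  area_element (hemisphere e x t) z = area_density x t z.
Proof.
move=> e1 zt; rewrite /area_element /area_density -/c.
have := zt; move/(eball_sqr _ _ t0); rewrite -subr_gt0.
set q := t ^+ 2 - _ => q0.
under eq_bigr do rewrite derive_hemisphere// -/q sqrrN !exprMn e1 mul1r exprVn sqr_sqrtr ?(ltW q0)//.
rewrite -mulr_suml -enorm_sqr.
rewrite (_ : 1 + _ = t ^+ 2 / q); last first.
  by rewrite (_ : t ^+ 2 = q + enorm (z - c) ^+ 2); [field; rewrite gt_eqF|rewrite subrK].
by rewrite sqrtrM ?sqr_ge0// sqrtr_sqr gtr0_norm// sqrtrV// ltW.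
Qed.

End hemisphere_area.

Section complex_parts.
Context {R : realType}.

Lemma Re_realM (a : R) (z : R[i]) : complex.Re (a%:C * z) = a * complex.Re z.
Proof. by case: z => b d /=; rewrite mul0r subr0. Qed.

Lemma Im_realM (a : R) (z : R[i]) : complex.Im (a%:C * z) = a * complex.Im z.
Proof. by case: z => b d /=; rewrite mul0r addr0. Qed.

Lemma real_complexV (a : R) : (a%:C)^-1 = (a^-1)%:C :> R[i].
Proof. by rewrite -fmorphV. Qed.

Lemma Re_le_normc (z : R[i]) : `|complex.Re z| <= Normc.normc z.
Proof.
case: z => a b /=; rewrite -sqrtr_sqr ler_wsqrtr// lerDl sqr_ge0//.
Qed.

Lemma Im_le_normc (z : R[i]) : `|complex.Im z| <= Normc.normc z.
Proof.
case: z => a b /=; rewrite -sqrtr_sqr ler_wsqrtr// lerDr sqr_ge0//.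
Qed.

Lemma cvg_complex (F : set_system R) (f : R -> R[i]) (l : R[i]) : Filter F ->
  complex.Re (f s) @[s --> F] --> complex.Re l ->
  complex.Im (f s) @[s --> F] --> complex.Im l ->
  (f s : R[i]^o) @[s --> F] --> (l : R[i]^o).
Proof.
move=> FF cre cim; apply/cvgrPdist_lt => /= e e0.
have [r r0 er] : exists2 r : R, 0 < r & e = r%:C.
  case: e e0 => a b; rewrite ltcE/= => /andP[/eqP b0 a0]; exists a => //.
  by rewrite b0.
move/cvgrPdist_lt : cre => /(_ (r / 2)) cre; move/cvgrPdist_lt : cim => /(_ (r / 2)) cim.
near=> s; rewrite er.
have h1 : `|complex.Re l - complex.Re (f s)| < r / 2 by near: s; apply: cre; rewrite divr_gt0.
have h2 : `|complex.Im l - complex.Im (f s)| < r / 2 by near: s; apply: cim; rewrite divr_gt0.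
move: h1 h2; case: (f s) => a b; case: (l) => a' b' /= h1 h2.
rewrite ltcE /= eqxx /=.
rewrite (_ : r = Num.sqrt (r ^+ 2)); last by rewrite sqrtr_sqr gtr0_norm.
rewrite ltr_sqrt ?exprn_gt0//.
rewrite -[_ ^+ 2 in X in X + _]real_normK ?num_real// -[_ ^+ 2 in X in _ + X]real_normK ?num_real//.
have n1 := normr_ge0 (a' - a); have n2 := normr_ge0 (b' - b).
nra.
Unshelve. all: by end_near. Qed.

Context {n : nat}.
Variable g : 'rV[R]_n -> R[i].
Hypothesis sg : schwartz g.

Definition bounded_C1 (h : 'rV[R]_n -> R) (C : R) :=
  [/\ forall y, differentiable h y,
      forall i, continuous ('D_(delta_mx 0 i) h),
      forall y, `|h y| <= C &
      forall i y, `|'D_(delta_mx 0 i) h y| <= C].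

Lemma schwartz_part (p : R[i] -> R) :
  (forall z, `|p z| <= Normc.normc z) ->
  (forall s y, differentiable (fun y => p (cpartials s g y)) y) ->
  (forall i y, 'D_(delta_mx 0 i) (fun y => p (g y)) y = p (cpartial i g y)) ->
  exists C, bounded_C1 (fun y => p (g y)) C.
Proof.
move=> le_p dp Dp; have [_ bg] := sg.
have [C0 hC0] := bg [::] 0%N.
have /choice[C hC] : forall i, exists C : R, forall y, Normc.normc (cpartials [:: i] g y) <= C.
  move=> i; have [K hK] := bg [:: i] 0%N; exists K => y.
  by have := hK y; rewrite expr0 mul1r.
have C0g y : Normc.normc (g y) <= C0 by have := hC0 y; rewrite expr0 mul1r.
have normc0 (z : R[i]) : 0 <= Normc.normc z by case: z => a b; exact: sqrtr_ge0.
have C00 : 0 <= C0 by exact: le_trans (C0g 0).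
have Ci0 i : 0 <= C i by exact: le_trans (hC i 0).
exists (C0 + \sum_i C i); split.
- exact: (dp [::]).
- move=> i.
  have E : (fun y => 'D_(delta_mx 0 i) (fun y => p (g y)) y) =
      (fun y => p (cpartials [:: i] g y)) by apply/funext => y; exact: Dp.
  by rewrite E => y; exact: differentiable_continuous (dp [:: i] y).
- by move=> y; rewrite (le_trans (le_p _))// (le_trans (C0g y))// lerDl sumr_ge0.
- move=> i y; rewrite Dp (bigD1 i)//= (le_trans (le_p _))//.
  by rewrite (le_trans (hC i y))// addrCA lerDl addr_ge0// sumr_ge0.
Qed.

Lemma schwartz_Re : exists C, bounded_C1 (fun y => complex.Re (g y)) C.
Proof.
by apply: schwartz_part => // [z|s y]; [exact: Re_le_normc|have [] := sg.1 s y].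
Qed.

Lemma schwartz_Im : exists C, bounded_C1 (fun y => complex.Im (g y)) C.
Proof.
by apply: schwartz_part => // [z|s y]; [exact: Im_le_normc|have [] := sg.1 s y].
Qed.

End complex_parts.

Section sphere_integral_parts.
Context {R : realType} {m : nat}.
Variables (x : 'rV[R]_m.+2) (t : R) (g : 'rV[R]_m.+2 -> R[i]).
Hypothesis t0 : 0 < t.

Lemma Re_sphere_integral :
  complex.Re (sphere_integral x t g) = surface_integral x t (fun y => complex.Re (g y)).
Proof.
rewrite /sphere_integral /graph_integral /cintegral /surface_integral /=.
congr (_ + _); apply: eq_Rintegral => z; rewrite inE => zt; rewrite Re_realM area_elementE//.
- by rewrite expr1n.
- by rewrite sqrrN expr1n.
Qed.

Lemma Im_sphere_integral :
  complex.Im (sphere_integral x t g) = surface_integral x t (fun y => complex.Im (g y)).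
Proof.
rewrite /sphere_integral /graph_integral /cintegral /surface_integral /=.
congr (_ + _); apply: eq_Rintegral => z; rewrite inE => zt; rewrite Im_realM area_elementE//.
- by rewrite expr1n.
- by rewrite sqrrN expr1n.
Qed.

End sphere_integral_parts.

(** * The solution near the critical exponent *)

Section solution_parts.
Context {R : realType} {d : nat}.
Variables (g : 'rV[R]_d -> R[i]) (x : 'rV[R]_d) (t : R).

(** With [k] the exponent of the weight, the constant in the first branch of
    [u_sol]; the second branch has half of this constant. *)
Definition low_coef (sigma k : R) : R :=
  sigma * sin (k * pi) * Gamma k /
  (pi `^ (d%:R / 2) * sin (sigma * pi) * Gamma (1 - sigma)).

Definition low_solution (h : 'rV[R]_d -> R) (sigma : R) : R :=
  let k := d%:R / 2 - sigma in
  low_coef sigma k * \int[lebesgue_rV R d]_(y in eball x t)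
    (h y / (t ^+ 2 - enorm (y - x) ^+ 2) `^ k).

Definition high_solution (h : 'rV[R]_d -> R) (sigma : R) : R :=
  let eps := d%:R / 2 - sigma - 1 in
  low_coef sigma eps / 2 * (t ^+ 2)^-1 * \int[lebesgue_rV R d]_(y in eball x t)
    ((2 * (sigma + 1) * h y + \sum_i (y - x) 0 i * 'D_(delta_mx 0 i) h y) /
     (t ^+ 2 - enorm (y - x) ^+ 2) `^ eps).

Lemma enorm_subC (y : 'rV[R]_d) : enorm (x - y) = enorm (y - x).
Proof. by rewrite -enormN opprB. Qed.

Lemma Re_divr (z : R[i]) (a : R) : complex.Re (z / a%:C) = complex.Re z / a.
Proof. by rewrite real_complexV mulrC Re_realM mulrC. Qed.

Lemma Im_divr (z : R[i]) (a : R) : complex.Im (z / a%:C) = complex.Im z / a.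
Proof. by rewrite real_complexV mulrC Im_realM mulrC. Qed.

Lemma ReD (z w : R[i]) : complex.Re (z + w) = complex.Re z + complex.Re w.
Proof. by case: z; case: w. Qed.

Lemma ImD (z w : R[i]) : complex.Im (z + w) = complex.Im z + complex.Im w.
Proof. by case: z; case: w. Qed.

Lemma Re_sum n (f : 'I_n -> R[i]) : complex.Re (\sum_i f i) = \sum_i complex.Re (f i).
Proof. exact: (big_morph _ ReD). Qed.

Lemma Im_sum n (f : 'I_n -> R[i]) : complex.Im (\sum_i f i) = \sum_i complex.Im (f i).
Proof. exact: (big_morph _ ImD). Qed.

Lemma Re_u_sol_low sigma : 0 < d%:R / 2 - sigma < 1 ->
  complex.Re (u_sol g sigma x t) = low_solution (fun y => complex.Re (g y)) sigma.
Proof.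
move=> k01; rewrite /u_sol k01 Re_realM; congr (_ * _) => /=.
by apply: eq_Rintegral => y _; rewrite Re_divr enorm_subC.
Qed.

Lemma Im_u_sol_low sigma : 0 < d%:R / 2 - sigma < 1 ->
  complex.Im (u_sol g sigma x t) = low_solution (fun y => complex.Im (g y)) sigma.
Proof.
move=> k01; rewrite /u_sol k01 Im_realM; congr (_ * _) => /=.
by apply: eq_Rintegral => y _; rewrite Im_divr enorm_subC.
Qed.

Lemma high_coefE sigma (k : R) : sigma * sin (k * pi) * Gamma k /
  (2 * pi `^ (d%:R / 2) * sin (sigma * pi) * Gamma (1 - sigma)) = low_coef sigma k / 2.
Proof. by rewrite /low_coef -!(mulrA 2) [(2 * _)^-1]invfM [2^-1 * _]mulrC !mulrA. Qed.

Lemma Re_u_sol_high sigma : 1 < d%:R / 2 - sigma < 2 ->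
  complex.Re (u_sol g sigma x t) = high_solution (fun y => complex.Re (g y)) sigma.
Proof.
move=> k12; rewrite /u_sol ifF; last by apply/negbTE; move: k12; case: ltgtP; rewrite ?andbF.
rewrite k12 -mulrA !Re_realM mulrA high_coefE; congr (_ * _) => /=.
apply: eq_Rintegral => y _; rewrite Re_divr enorm_subC ReD Re_realM Re_sum; congr ((_ + _) / _).
by apply: eq_bigr => i _; rewrite Re_realM.
Qed.

Lemma Im_u_sol_high sigma : 1 < d%:R / 2 - sigma < 2 ->
  complex.Im (u_sol g sigma x t) = high_solution (fun y => complex.Im (g y)) sigma.
Proof.
move=> k12; rewrite /u_sol ifF; last by apply/negbTE; move: k12; case: ltgtP; rewrite ?andbF.
rewrite k12 -mulrA !Im_realM mulrA high_coefE; congr (_ * _) => /=.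
apply: eq_Rintegral => y _; rewrite Im_divr enorm_subC ImD Im_realM Im_sum; congr ((_ + _) / _).
by apply: eq_bigr => i _; rewrite Im_realM.
Qed.

End solution_parts.

Arguments low_coef {R} d sigma k.

Section one_sided.
Context {R : realType}.

Lemma subr_at_right (a : R) : (s - a) @[s --> a^'+] --> (0 : R)^'+.
Proof.
move=> A [e /= e0 Ae]; exists e => //= s; rewrite /ball/= => sa as_.
by apply: Ae; rewrite /= ?subr_gt0// sub0r opprB.
Qed.

Lemma subr_at_left (a : R) : (a - s) @[s --> a^'-] --> (0 : R)^'+.
Proof.
move=> A [e /= e0 Ae]; exists e => //= s; rewrite /ball/= => sa as_.
by apply: Ae; rewrite /= ?subr_gt0// sub0r opprB distrC.
Qed.

Lemma cvg_sin_slope : sin (e * pi) / e @[e --> (0 : R)^'+] --> (pi : R).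
Proof.
have D : is_derive (0 : R) 1 (fun e : R => sin (e * pi)) pi.
  by apply: is_derive_eq; rewrite mul0r cos0 /GRing.scale/= mulr0 add0r mul1r mulr1.
have [dD dE] := D.
have H : e^-1 *: (sin ((e *: (1 : R) + 0) * pi) - sin (0 * pi)) @[e --> (0 : R)^'+] -->
    'D_1 (fun e : R => sin (e * pi)) 0.
  move=> A /dD [e /= e0 Ae]; exists e => //= s es s0; apply: Ae => //.
  by rewrite gt_eqF.
rewrite dE in H; apply: (cvg_trans _ H); apply: near_eq_cvg; near=> e.
rewrite mul0r sin0 subr0 addr0 (_ : e *: (1 : R) = e); last exact: mulr1.
by rewrite /GRing.scale/= mulrC.
Unshelve. all: by end_near. Qed.

Lemma cvg_dnbhs_sides (T : topologicalType) (f : R -> T) (a : R) (l : T) :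
  f s @[s --> a^'+] --> l -> f s @[s --> a^'-] --> l -> f s @[s --> a^'] --> l.
Proof.
move=> fr fl A nA; have [e1 /= e10 A1] := fr _ nA; have [e2 /= e20 A2] := fl _ nA.
exists (Num.min e1 e2) => /=; first by rewrite lt_min e10.
move=> s /=; rewrite lt_min => /andP[s1 s2] sa.
have [sa'|sa'|sa'] := ltgtP s a; [exact: A2|exact: A1|by rewrite sa' eqxx in sa].
Qed.

End one_sided.

Section critical_limits.
Context {R : realType} {m : nat}.
Let n := m.+1.
Notation d := m.+2.
Variables (x : 'rV[R]_n.+1) (t : R).
Hypothesis t0 : 0 < t.
Let leb' := lebesgue_rV R n.+1.
Let u (y : 'rV[R]_n.+1) : R := t ^+ 2 - enorm (y - x) ^+ 2.
(* The value of sigma at which the exponent [d / 2 - sigma] crosses [1]. *)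
Notation crit := (m.+2%:R / 2 - 1 : R).

Section real_part.
Variables (h : 'rV[R]_n.+1 -> R) (C : R).
Hypothesis dh : forall y, differentiable h y.
Hypothesis cdh : forall i, continuous ('D_(delta_mx 0 i) h).
Hypothesis hC : forall y, `|h y| <= C.
Hypothesis dhC : forall i y, `|'D_(delta_mx 0 i) h y| <= C.

(** If [sigma] is the critical value minus [eps], then [2 * (sigma + 1)] is
    [n.+1 - 2 * eps], and the integrand of the second branch is the divergence
    up to a term that vanishes with [eps]. *)
Lemma cvg_flux_integral :
  \int[leb']_(y in eball x t) ((radial_divergence x h y - 2 * eps * h y) / u y `^ eps)
    @[eps --> 0^'+] --> t * surface_integral x t h.
Proof.
have ch : continuous h by move=> y; exact: differentiable_continuous.
have crd : continuous (radial_divergence x h) := @continuous_radial_divergence _ _ x h dh cdh.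
have rdC y (yB : eball x t y) := radial_divergence_bound hC dhC yB.
have c1 := cvg_weight_removal t0 crd rdC.
have c2 := cvg_weight_removal t0 ch (fun y (_ : eball x t y) => hC y).
rewrite -(flux_identity x t0 dh cdh hC dhC).
have c0 : 2 * eps @[eps --> (0 : R)^'+] --> (2 * 0 : R).
  by apply: cvg_at_right_filter; exact: mulrl_continuous.
have F0 : Filter (0 : R)^'+ by typeclasses eauto.
have := cvgB c1 (cvgM c0 c2); rewrite mulr0 mul0r subr0 => /(_ F0 F0) H; apply: (cvg_trans _ H).
apply: near_eq_cvg; near=> eps.
have e0 : 0 < eps by [].
have e1 : eps < 1 by near: eps; exact: nbhs_right_lt.
have [i1 _] := weight_removal_bound t0 crd rdC e0 e1.
have [i2 _] := weight_removal_bound t0 ch (fun y (_ : eball x t y) => hC y) e0 e1.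
pose D := eball x t; have mD : measurable D := measurable_eball x t0.
have i3 : leb'.-integrable D (fun y => (2 * eps * (h y / u y `^ eps))%:E).
  by have := integrableZl mD (2 * eps) i2; apply: eq_integrable.
transitivity (\int[leb']_(y in D) (radial_divergence x h y / u y `^ eps) -
    2 * eps * \int[leb']_(y in D) (h y / u y `^ eps)); first by [].
rewrite -(RintegralZl _ mD i2) -(RintegralB mD i1 i3).
by apply: eq_Rintegral => y _; rewrite mulrBl mulrA.
Unshelve. all: by end_near. Qed.

Lemma cvg_low_solution (c : R) :
  low_coef d (crit + eps) (1 - eps) / eps @[eps --> 0^'+] --> c ->
  low_solution x t h (crit + eps) @[eps --> 0^'+] --> c / (2 * t) * surface_integral x t h.
Proof.
have F0 : Filter (0 : R)^'+ by typeclasses eauto.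
move=> cc; have := cvgM cc (@cvg_concentration _ _ x _ t0 _ _ dh hC dhC).
rewrite mulrA => /(_ F0) H; apply: (cvg_trans _ H); apply: near_eq_cvg; near=> eps.
have e0 : 0 < eps by [].
rewrite /low_solution (_ : d%:R / 2 - (crit + eps) = 1 - eps :> R); last by ring.
by rewrite [LHS]/= mulrA divfK// gt_eqF.
Unshelve. all: by end_near. Qed.

Lemma cvg_high_solution (c : R) :
  low_coef d (crit - eps) eps @[eps --> 0^'+] --> c ->
  high_solution x t h (crit - eps) @[eps --> 0^'+] --> c / (2 * t) * surface_integral x t h.
Proof.
move=> cc.
have F0 : Filter (0 : R)^'+ by typeclasses eauto.
have := cvgM (cvgM cc (cvg_cst (2^-1 * (t ^+ 2)^-1))) cvg_flux_integral.
rewrite (_ : _ * _ * (t * _) = c / (2 * t) * surface_integral x t h); last by field; rewrite gt_eqF.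
move=> /(_ F0 F0 F0) H; apply: (cvg_trans _ H); apply: near_eq_cvg; near=> eps.
rewrite /high_solution (_ : d%:R / 2 - (crit - eps) - 1 = eps :> R); last by ring.
rewrite [LHS]/= mulrA; congr (_ * _); apply: eq_Rintegral => y _; congr (_ / _).
rewrite /radial_divergence addrAC -mulrBl; congr (_ * _ + _).
by rewrite mulrDr mulrBr mulr1; field.
Unshelve. all: by end_near. Qed.

End real_part.

Variable g : 'rV[R]_n.+1 -> R[i].
Hypothesis sg : schwartz g.

Lemma cvg_u_sol_low (c : R) :
  low_coef d (crit + eps) (1 - eps) / eps @[eps --> 0^'+] --> c ->
  (u_sol g sigma x t : R[i]^o) @[sigma --> crit^'+] -->
    ((c / (2 * t))%:C * sphere_integral x t g : R[i]^o).
Proof.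
move=> cc.
suff H : (u_sol g (crit + eps) x t : R[i]^o) @[eps --> 0^'+] -->
    ((c / (2 * t))%:C * sphere_integral x t g : R[i]^o).
  have := cvg_comp _ _ (subr_at_right crit) H => H'; apply: (cvg_trans _ H').
  by apply: near_eq_cvg; near=> s; rewrite /= addrC subrK.
have k01 : \forall eps \near (0:R)^'+, 0 < m.+2%:R / 2 - (crit + eps) < 1.
  near=> eps; have e0 : 0 < eps by [].
  have e1 : eps < 1 by near: eps; exact: nbhs_right_lt.
  rewrite (_ : d%:R / 2 - (crit + eps) = 1 - eps :> R); last by ring.
  by rewrite subr_gt0 e1 ltrBlDr ltrDl.
apply: cvg_complex.
- rewrite Re_realM Re_sphere_integral//.
  have [C [dh cdh hC dhC]] := schwartz_Re sg.
  apply: (cvg_trans _ (cvg_low_solution dh hC dhC cc)); apply: near_eq_cvg.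
  by near=> eps; rewrite Re_u_sol_low//; near: eps.
- rewrite Im_realM Im_sphere_integral//.
  have [C [dh cdh hC dhC]] := schwartz_Im sg.
  apply: (cvg_trans _ (cvg_low_solution dh hC dhC cc)); apply: near_eq_cvg.
  by near=> eps; rewrite Im_u_sol_low//; near: eps.
Unshelve. all: by end_near. Qed.

Lemma cvg_u_sol_high (c : R) :
  low_coef d (crit - eps) eps @[eps --> 0^'+] --> c ->
  (u_sol g sigma x t : R[i]^o) @[sigma --> crit^'-] -->
    ((c / (2 * t))%:C * sphere_integral x t g : R[i]^o).
Proof.
move=> cc.
suff H : (u_sol g (crit - eps) x t : R[i]^o) @[eps --> 0^'+] -->
    ((c / (2 * t))%:C * sphere_integral x t g : R[i]^o).
  have := cvg_comp _ _ (subr_at_left crit) H => H'; apply: (cvg_trans _ H').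
  by apply: near_eq_cvg; near=> s; rewrite /= opprB addrC subrK.
have k12 : \forall eps \near (0:R)^'+, 1 < m.+2%:R / 2 - (crit - eps) < 2.
  near=> eps; have e0 : 0 < eps by [].
  have e1 : eps < 1 by near: eps; exact: nbhs_right_lt.
  rewrite (_ : d%:R / 2 - (crit - eps) = 1 + eps :> R); last by ring.
  by rewrite ltrDl e0 (_ : 2 = 1 + 1)// ltrD2l.
apply: cvg_complex.
- rewrite Re_realM Re_sphere_integral//.
  have [C [dh cdh hC dhC]] := schwartz_Re sg.
  apply: (cvg_trans _ (cvg_high_solution dh cdh hC dhC cc)); apply: near_eq_cvg.
  by near=> eps; rewrite Re_u_sol_high//; near: eps.
- rewrite Im_realM Im_sphere_integral//.
  have [C [dh cdh hC dhC]] := schwartz_Im sg.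
  apply: (cvg_trans _ (cvg_high_solution dh cdh hC dhC cc)); apply: near_eq_cvg.
  by near=> eps; rewrite Im_u_sol_high//; near: eps.
Unshelve. all: by end_near. Qed.

End critical_limits.

(** * Limits of the constants *)

Section coefficients.
Context {R : realType}.
Notation crit d := (d%:R / 2 - 1 : R).

Lemma sin_pi_sub (a : R) : sin (pi - a) = sin a.
Proof. by rewrite sinB sinpi cospi mul0r mulN1r sub0r opprK. Qed.

Lemma sin_mulpi_gt0 (eps : R) : 0 < eps -> eps < 1 -> 0 < sin (eps * pi).
Proof.
move=> e0 e1; apply: sin_gt0_pi; rewrite mulr_gt0 ?pi_gt0//=.
by rewrite -[ltRHS]mul1r ltr_pM2r// pi_gt0.
Qed.

Lemma pi_neq0 : (pi : R) != 0.
Proof. by rewrite gt_eqF// pi_gt0. Qed.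

Lemma powR_pi1 : (pi : R) `^ (2%:R / 2) = pi.
Proof. by rewrite divff// powRr1// pi_ge0. Qed.

Lemma powR_pi2 : (pi : R) `^ (4%:R / 2) = pi ^+ 2.
Proof.
rewrite (_ : 4%:R / 2 = 2%:R); last by field.
by rewrite powR_mulrn// pi_ge0.
Qed.

Lemma powR_pi_half : (pi : R) `^ (3%:R / 2) * Num.sqrt pi = pi ^+ 2.
Proof.
rewrite -powR12_sqrt ?pi_ge0// -powRD; last by rewrite pi_neq0 implybT.
rewrite (_ : _ + _ = 2%:R); last by field.
by rewrite powR_mulrn// pi_ge0.
Qed.

(** In dimensions [2] and [4] the reflection [sin (pi - a) = sin a] makes the
    sines and the Gamma factors cancel exactly. *)
Lemma cvg_low_coef2 :
  low_coef 2 (crit 2 + eps) (1 - eps) / eps @[eps --> 0^'+] --> (pi : R)^-1.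
Proof.
have H : pi^-1 @[_ --> (0 : R)^'+] --> (pi^-1 : R) by exact: cvg_cst.
apply: (cvg_trans _ H); apply: near_eq_cvg; near=> eps.
have e0 : 0 < eps by [].
have e1 : eps < 1 by near: eps; exact: nbhs_right_lt.
rewrite /low_coef powR_pi1 (_ : crit 2 + eps = eps); last by field.
rewrite mulrBl mul1r sin_pi_sub.
have s0 := sin_mulpi_gt0 e0 e1.
have G0 : 0 < Gamma (1 - eps) by apply: Gamma_gt0; rewrite subr_gt0 e1/= lerBlDr; lra.
have p0 := pi_neq0; have s1 := lt0r_neq0 s0; have G1 := lt0r_neq0 G0.
have e1n := lt0r_neq0 e0; move: (sin _) (Gamma (1 - eps)) s1 G1 => S G s1 G1.
by move: pi p0 => p p0; field; rewrite ?p0 ?s1 ?G1 ?e1n.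
Unshelve. all: by end_near. Qed.

Lemma cvg_high_coef4 :
  low_coef 4 (crit 4 - eps) eps @[eps --> 0^'+] --> ((pi : R) ^+ 2)^-1.
Proof.
have H : (1 - eps) * (pi ^+ 2)^-1 @[eps --> (0 : R)^'+] --> (1 - 0) * ((pi : R) ^+ 2)^-1.
  apply: cvg_at_right_filter; apply: cvgMl.
  by apply: cvgB; [exact: cvg_cst|exact: cvg_id].
rewrite subr0 mul1r in H; apply: (cvg_trans _ H); apply: near_eq_cvg; near=> eps.
have e0 : 0 < eps by [].
have e1 : eps < 1 by near: eps; exact: nbhs_right_lt.
rewrite /low_coef powR_pi2 (_ : crit 4 - eps = 1 - eps); last by field.
rewrite [(1 - eps) * pi]mulrBl mul1r sin_pi_sub subKr.
have s0 := sin_mulpi_gt0 e0 e1.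
have G0 : 0 < Gamma eps by apply: Gamma_gt0; rewrite e0/=; lra.
have p0 := pi_neq0; have s1 := lt0r_neq0 s0; have G1 := lt0r_neq0 G0.
have e1n := lt0r_neq0 e0; move: (sin _) (Gamma eps) s1 G1 => S G s1 G1.
by move: pi p0 => p p0; field; rewrite ?p0 ?s1 ?G1 ?e1n.
Unshelve. all: by end_near. Qed.

(** Here [Gamma (1 - sigma)] tends to [Num.sqrt pi], which completes
    [pi `^ (3 / 2)] to [pi ^+ 2]. *)
Lemma cvg_half_denominator (s : R -> R) : s eps @[eps --> 0^'+] --> (2^-1 : R) ->
  s eps / (pi `^ (3%:R / 2) * sin (s eps * pi) * Gamma (1 - s eps)) @[eps --> 0^'+] -->
  (2 * pi ^+ 2 : R)^-1.
Proof.
move=> s2.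
have F0 : Filter (0 : R)^'+ by typeclasses eauto.
have half1 : 1 - 2^-1 = 2^-1 :> R by field.
have sin1 : sin (s eps * pi) @[eps --> 0^'+] --> (1 : R).
  rewrite -(@sin_pihalf R) mulrC; apply: continuous_cvg; first exact: continuous_sin.
  by apply: cvgMl.
have G1 : Gamma (1 - s eps) @[eps --> 0^'+] --> (Num.sqrt pi : R).
  rewrite -Gamma_half -[in X in _ --> X]half1; apply: continuous_cvg.
    by apply: continuous_Gamma; rewrite half1; lra.
  by apply: cvgB s2; exact: cvg_cst.
have D := cvgM (cvgM (cvg_cst (pi `^ (3%:R / 2))) sin1) G1.
have -> : (2 * pi ^+ 2 : R)^-1 = 2^-1 * (pi `^ (3%:R / 2) * 1 * Num.sqrt pi)^-1.
  by rewrite mulr1 powR_pi_half invfM.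
apply: cvgM => //; apply: cvgV; last exact: D.
by rewrite mulr1 powR_pi_half expf_neq0// pi_neq0.
Qed.

Lemma cvg_low_coef3 :
  low_coef 3 (crit 3 + eps) (1 - eps) / eps @[eps --> 0^'+] --> (2 * pi : R)^-1.
Proof.
have s2 : crit 3 + eps @[eps --> (0 : R)^'+] --> crit 3 + 0.
  by apply: cvg_at_right_filter; apply: cvgD; [exact: cvg_cst|exact: cvg_id].
rewrite (_ : crit 3 + 0 = 2^-1) in s2; last by field.
have G1 : Gamma (1 - eps) @[eps --> (0 : R)^'+] --> (1 : R).
  rewrite -[in X in _ --> X]Gamma1 -[in X in _ --> Gamma X](subr0 1).
  apply: cvg_at_right_filter; apply: continuous_cvg.
    by apply: continuous_Gamma; rewrite subr0; lra.
  by apply: cvgB; [exact: cvg_cst|exact: cvg_id].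
have F0 : Filter (0 : R)^'+ by typeclasses eauto.
have := cvgM (cvgM (cvg_half_denominator s2) cvg_sin_slope) G1 => /(_ F0 F0) H.
rewrite (_ : (2 * pi)^-1 = (2 * pi ^+ 2)^-1 * pi * 1); last by move: pi pi_neq0 => p p0; field.
apply: (cvg_trans _ H); apply: near_eq_cvg; near=> eps.
rewrite [LHS]/= /low_coef [(1 - _) * _]mulrBl mul1r sin_pi_sub -!mulrA; congr (_ * _).
by rewrite [RHS]mulrCA; ring.
Unshelve. all: by end_near. Qed.

Lemma cvg_high_coef3 :
  low_coef 3 (crit 3 - eps) eps @[eps --> 0^'+] --> (2 * pi : R)^-1.
Proof.
have s2 : crit 3 - eps @[eps --> (0 : R)^'+] --> crit 3 - 0.
  by apply: cvg_at_right_filter; apply: cvgB; [exact: cvg_cst|exact: cvg_id].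
rewrite (_ : crit 3 - 0 = 2^-1) in s2; last by field.
have F0 : Filter (0 : R)^'+ by typeclasses eauto.
have := cvgM (cvgM (cvg_half_denominator s2) cvg_sin_slope) (@cvg_mul_Gamma_0 R) => /(_ F0 F0) H.
rewrite (_ : (2 * pi)^-1 = (2 * pi ^+ 2)^-1 * pi * 1); last by move: pi pi_neq0 => p p0; field.
apply: (cvg_trans _ H); apply: near_eq_cvg; near=> eps.
have e0 : eps != 0 by rewrite gt_eqF.
rewrite [LHS]/= /low_coef; set D := (_ * Gamma (1 - _))^-1; by field.
Unshelve. all: by end_near. Qed.

End coefficients.

Theorem theorem4 (R : realType) :
  (forall g : 'rV[R]_2 -> R[i], schwartz g ->
    forall (x : 'rV[R]_2) (t : R), 0 < t ->
    (u_sol g sigma x t : R[i]^o) @[sigma --> (0 : R)^'+] -->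
      (((2 * pi * t)^-1)%:C * sphere_integral x t g : R[i]^o))
  /\
  (forall g : 'rV[R]_3 -> R[i], schwartz g ->
    forall (x : 'rV[R]_3) (t : R), 0 < t ->
    (u_sol g sigma x t : R[i]^o) @[sigma --> (2^-1 : R)^'] -->
      (((4 * pi * t)^-1)%:C * sphere_integral x t g : R[i]^o))
  /\
  (forall g : 'rV[R]_4 -> R[i], schwartz g ->
    forall (x : 'rV[R]_4) (t : R), 0 < t ->
    (u_sol g sigma x t : R[i]^o) @[sigma --> (1 : R)^'-] -->
      (((2 * pi ^+ 2 * t)^-1)%:C * sphere_integral x t g : R[i]^o)).
Proof.
split=> [g sg x t t0|]; last split=> g sg x t t0; have tn0 : t != 0 by rewrite gt_eqF.
- have := @cvg_u_sol_low _ _ x _ t0 _ sg _ cvg_low_coef2.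
  rewrite (_ : 2%:R / 2 - 1 = 0 :> R); last by field.
  by rewrite (_ : pi^-1 / (2 * t) = (2 * pi * t)^-1)//; move: pi (@pi_neq0 R) => p p0; field; rewrite p0 tn0.
- have := @cvg_u_sol_low _ _ x _ t0 _ sg _ cvg_low_coef3.
  have := @cvg_u_sol_high _ _ x _ t0 _ sg _ cvg_high_coef3.
  rewrite (_ : 3%:R / 2 - 1 = 2^-1 :> R); last by field.
  rewrite (_ : (2 * pi)^-1 / (2 * t) = (4 * pi * t)^-1); last by move: pi (@pi_neq0 R) => p p0; field; rewrite p0 tn0.
  by move=> lim_left lim_right; exact: cvg_dnbhs_sides.
- have := @cvg_u_sol_high _ _ x _ t0 _ sg _ cvg_high_coef4.
  rewrite (_ : 4%:R / 2 - 1 = 1 :> R); last by field.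
  by rewrite (_ : (pi ^+ 2)^-1 / (2 * t) = (2 * pi ^+ 2 * t)^-1)//; move: pi (@pi_neq0 R) => p p0; field; rewrite p0 tn0.
Qed.
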